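(* Let $\mathcal{Q}=100$, and for $n\ge 2$ let $N=\frac{n(n-1)}{2}$ and let $\phi_n$ be the quantity defined in the context. Then there exists $N_0$ such that $$\phi_n^{-1}\le(4N^{24})^{5N}\qquad\text{for all } n>N_0.$$
   Context: Rotations: fix an ordering of the $N$ coordinate planes of $\mathbb{R}^n$. If the $i$-th plane is spanned by axes $k<\ell$, $\mathrm{R}(i,\theta)$ is the $n\times n$ matrix with $\mathrm{R}(i,\theta)_{kk}=\mathrm{R}(i,\theta)_{\ell\ell}=\cos\theta$, $\mathrm{R}(i,\theta)_{k\ell}=\sin\theta$, $\mathrm{R}(i,\theta)_{\ell k}=-\sin\theta$, $\mathrm{R}(i,\theta)_{jj}=1$ for $j\notin\{k,\ell\}$, and other entries $0$. Lazy choice of marked times: let $\{i_t\}_{t\ge0}$ be i.i.d. uniform on $\{1,\dots,N\}$. Set $s_1=\min\{t\ge0: i_t=1\}$, and inductively $s_{\ell+1}=\min\{t\ge s_\ell+\mathcal{Q}n^2\log(n): i_t=\ell+1\}$ for $1\le\ell<N$. Put $\mathcal{S}=\{s_1,\dots,s_N\}$ and $\mathcal T=s_N+1$. Random map: let $\{\eta_t\}_{t\ge0}$ be i.i.d. uniform on $[0,2\pi)$, independent of $\{i_t\}$, and fix $X\in\mathrm{SO}(n)$. For $x=(x_1,\dots,x_N)$ put $e_t(x)=\eta_t$ if $t\notin\mathcal{S}$ and $e_t(x)=\eta_t+x_\ell$ if $t=s_\ell\in\mathcal{S}$, and for small $x$ define $$f(x)=\mathrm{R}(i_{\mathcal T-1},e_{\mathcal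 T-1}(x))\cdots\mathrm{R}(i_1,e_1(x))\,\mathrm{R}(i_0,e_0(x))\,X\in\mathrm{SO}(n).$$ Let $D$ be the ($N\times N$, random) Jacobian of $f$ at $(0,\dots,0)$, i.e. the matrix of $df_0:\mathbb{R}^N\to T_{f(0)}\mathrm{SO}(n)$ in the standard basis of $\mathbb{R}^N$ and an orthonormal basis of $T_{f(0)}\mathrm{SO}(n)$ for the Hilbert-Schmidt inner product $\langle A,B\rangle=\mathrm{Tr}(A^{\dagger}B)$, where $A^\dagger$ is the transpose; its singular values do not depend on the choice of the orthonormal basis and their law does not depend on $X$. Let $\sigma_1(D)$ be its smallest singular value. Define $$\phi_n=\min\Big((2n)^{-30},\ \sup\big\{r>0:\ \mathbb{P}[\sigma_1(D)\le r]<\tfrac{1}{\sqrt n}\big\}\Big),$$ with $\sup\emptyset=0$ and $0^{-1}=+\infty$. *)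

(* Defs.v *)
From HB Require Import structures.
From mathcomp Require Import all_boot all_order all_algebra.
From mathcomp Require Import all_classical all_reals all_analysis.

Set Implicit Arguments.
Unset Strict Implicit.
Unset Printing Implicit Defensive.

Import Order.TTheory GRing.Theory Num.Theory.
Import numFieldNormedType.Exports.

Local Open Scope classical_set_scope.
Local Open Scope ring_scope.

(** All indices are shifted down by one: planes, marked times and coordinates
    of [x] are numbered [0, ..., N - 1] instead of [1, ..., N]. *)

Definition nplanes (n : nat) : nat := ((n * n.-1) %/ 2)%N.

Definition plane_ordering (n : nat) (pl : 'I_(nplanes n) -> 'I_n * 'I_n) : Prop :=
  injective pl /\
  forall p : 'I_n * 'I_n, (exists i, pl i = p) <-> (p.1 < p.2)%N.

Section matrices.
Context {R : realType}.

Definition rotation (n : nat) (p : 'I_n * 'I_n) (theta : R) : 'M[R]_n :=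
  \matrix_(a, b)
    if (a == p.1) && (b == p.1) || (a == p.2) && (b == p.2) then cos theta
    else if (a == p.1) && (b == p.2) then sin theta
    else if (a == p.2) && (b == p.1) then - sin theta
    else (a == b)%:R.

Definition SO (n : nat) : set 'M[R]_n :=
  [set A | A^T *m A = 1%:M /\ \det A = 1].

(** [T_A SO(n)]: kernel of the differential at [A] of [A |-> A^T *m A]. *)
Definition tangent_SO (n : nat) (A : 'M[R]_n) : set 'M[R]_n :=
  [set V | A^T *m V + V^T *m A = 0].

Definition HS (n : nat) (A B : 'M[R]_n) : R := \tr (A^T *m B).

Definition orthonormal_basis (n N : nat) (S : set 'M[R]_n)
    (b : 'I_N -> 'M[R]_n) : Prop :=
  [/\ forall k, S (b k),
      forall k l, HS (b k) (b l) = (k == l)%:R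
    & forall V, S V -> exists c : 'I_N -> R, V = \sum_k c k *: b k].

Definition singular_value (N : nat) (D : 'M[R]_N) (s : R) : Prop :=
  0 <= s /\ eigenvalue (D^T *m D) (s ^+ 2).

Definition sigma1 (N : nat) (D : 'M[R]_N) : R := inf [set s | singular_value D s].

End matrices.

(** [min {t | p t}], with the junk value [0] if no such [t] exists. *)
Definition first_time (p : pred nat) : nat :=
  if pselect (exists t, p t) is left h then ex_minn h else 0%N.

Section random_map.
Context {R : realType}.
Variables (Q : R) (n : nat) (pl : 'I_(nplanes n) -> 'I_n * 'I_n).
(** One outcome of the sequences [i_t] and [eta_t]. *)
Variables (idx : nat -> 'I_(nplanes n)) (eta : nat -> R).
Variable X : 'M[R]_n.

(** Junk values of [first_time] only occur on a null event. *)
Fixpoint marked_time (l : nat) : nat :=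
  if l is l'.+1 then
    first_time (fun t => ((marked_time l')%:R + Q * n%:R ^+ 2 * ln n%:R <= t%:R)
                         && (idx t == l'.+1 :> nat))
  else first_time (fun t => idx t == 0%N :> nat).

Definition end_time : nat := (marked_time (nplanes n).-1).+1.

Definition angle (x : 'rV[R]_(nplanes n)) (t : nat) : R :=
  if [pick l : 'I_(nplanes n) | t == marked_time l] is Some l
  then eta t + x 0 l else eta t.

Fixpoint walk (x : 'rV[R]_(nplanes n)) (t : nat) : 'M[R]_n :=
  if t is t'.+1 then rotation (pl (idx t')) (angle x t') *m walk x t' else X.

Definition rotmap (x : 'rV[R]_(nplanes n)) : 'M[R]_n := walk x end_time.

(** Matrix of [df_0] in the standard basis of [R^N] and the family [b], meant to
    be an orthonormal basis of the tangent space at [f(0)]. *)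
Definition jac (b : 'I_(nplanes n) -> 'M[R]_n) : 'M[R]_(nplanes n) :=
  \matrix_(k, l) HS (b k) ('d rotmap (0 : 'rV[R]_(nplanes n)) (delta_mx 0 l)).

End random_map.

Section probability_notions.
Context {d : measure_display} {T : measurableType d} {R : realType}.
Variable P : probability T R.

Definition independent_family (I : choiceType) (F : I -> set_system T) : Prop :=
  forall (s : seq I) (A : I -> set T), uniq s ->
    (forall j, j \in s -> F j (A j)) ->
    P (\bigcap_(j in [set` s]) A j) = (\prod_(j <- s) P (A j))%E.

Definition independent_systems (F G : set_system T) : Prop :=
  forall A B, F A -> G B -> P (A `&` B) = (P A * P B)%E.

Definition sigma_index (N : nat) (i : T -> 'I_N) : set_system T :=
  [set i @^-1` B | B in [set: set 'I_N]].

Definition sigma_real (X : {RV P >-> R}) : set_system T :=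
  [set X @^-1` B | B in measurable].

Definition iid_uniform_index (N : nat) (i : nat -> T -> 'I_N) : Prop :=
  [/\ forall t k, measurable (i t @^-1` [set k]),
      forall t k, P (i t @^-1` [set k]) = (N%:R^-1)%:E
    & independent_family (fun t => sigma_index (i t))].

Lemma two_pi_gt0 : 0 < 2 * pi :> R.
Proof. by rewrite mulr_gt0// pi_gt0. Qed.

(** [uniform_prob] is uniform on the closed interval; the endpoint is null, so
    this is also the uniform law on [[0, 2 pi)]. *)
Definition iid_uniform_angle (eta : nat -> {RV P >-> R}) : Prop :=
  (forall t A, measurable A ->
     distribution P (eta t) A = uniform_prob two_pi_gt0 A) /\
  independent_family (fun t => sigma_real (eta t)).

Definition independent_sequences (N : nat) (i : nat -> T -> 'I_N)
    (eta : nat -> {RV P >-> R}) : Prop :=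
  independent_systems <<s \bigcup_t sigma_index (i t) >>
                      <<s \bigcup_t sigma_real (eta t) >>.

Section phi.
Variables (Q : R) (n : nat) (pl : 'I_(nplanes n) -> 'I_n * 'I_n).
Variables (i : nat -> T -> 'I_(nplanes n)) (eta : nat -> {RV P >-> R}).
Variables (X : 'M[R]_n) (b : T -> 'I_(nplanes n) -> 'M[R]_n).

Definition random_rotmap (w : T) : 'rV[R]_(nplanes n) -> 'M[R]_n :=
  rotmap Q pl (i^~ w) (fun t => eta t w) X.

Definition random_jac (w : T) : 'M[R]_(nplanes n) :=
  jac Q pl (i^~ w) (fun t => eta t w) X (b w).

(** [maxe 0] implements [sup set0 = 0] ([ereal_sup set0] is [-oo]). *)
Definition phi : \bar R :=
  mine ((2 * n%:R) ^- 30)%:E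
    (maxe 0%:E (ereal_sup
      [set r%:E | r in [set r | 0 < r /\
        (P [set w | (sigma1 (random_jac w) <= r)%R] < (1 / Num.sqrt n%:R)%:E)%E]])).

End phi.
End probability_notions.

(* Main.v *)
Require Import Defs.
From HB Require Import structures.
From mathcomp Require Import all_boot all_order all_algebra.
From mathcomp Require Import all_classical all_reals all_analysis.
From mathcomp Require Import perm measurable_realfun.
From mathcomp Require Import ring lra zify.

Set Implicit Arguments.
Unset Strict Implicit.
Unset Printing Implicit Defensive.

Import Order.TTheory GRing.Theory Num.Theory.
Import numFieldNormedType.Exports.

Local Open Scope classical_set_scope.
Local Open Scope ring_scope.

(** Let [u_l] be the derivative of [f] along the [l]-th coordinate, transported
    back to the antisymmetric matrices: [u_l] is the generator of the [l]-th
    plane conjugated by all rotations made after time [s_l], and [D^T D] is the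
    Gram matrix of the [u_l]. If [sigma_1(D) <= r] then, with a loss exponential
    in [N], some [u_l] is within [eps] of the span of the [u_j], [j > l].

    Fix all angles after the window of [L ~ 7 n log n] steps following [s_l], and
    let [y] be a unit antisymmetric matrix orthogonal to all [u_j], [j > l]. After
    being pulled back through the window, [y] must have an entry of size less
    than [eps] at the [l]-th plane. A rotation replaces two entries [A], [B] by
    [A cos t + B sin t] and [B cos t - A sin t], and the mean over [t] of
    [g(A cos t + B sin t)], where [g(v) = (v^2 + eps^2)^(-1/4)], is at most twice
    both [g(A)] and [g(B)]. Hence the entry is small with probability at most
    [a(x, z) g(y_xz) / g(eps)] for every site [(x, z)] that the window links to the
    [l]-th plane, where the weight [a(x, z)] counts doublings, and some entry
    of [y] has size at least [1 / n].

    All sites are linked with weights at most [n^89], outside an event of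
    probability [2 n^-3] for the indices in the window: the set of linked sites
    grows by an isoperimetric inequality for pairs, and the total weight grows on
    average by a factor [1 + 12 / n] per step. Finally, marked times and indices up
    to the last marked time take countably many values, so that one may condition
    on them and use only the randomness of the angles. *)

(** * Averaging over one angle *)

Section Average.
Context {R : realType}.
Implicit Types A B e x : R.

(** For $|v|$ above $\varepsilon$, $g(v)$ is of order $|v|^{-1/2}$. This singularity is weak enough
    to be integrable over an angle, so the loss per step does not depend on $\varepsilon$, and
    strong enough for $g(1/n)/g(\varepsilon)$, of order $(n\varepsilon)^{1/2}$, to beat polynomial
    weights.

    Comparing each $u_l$ with the later ones fits the order of time: $u_j$ depends only on angles
    after $s_j$, and marked times are at least $100n^2\log n$ apart, so the window after $s_l$
    closes before any $u_j$, $j>l$, starts. The matrix $y$ is chosen separately for every value of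
    the angles after the window; as the estimate is uniform in them, no measurable selection occurs.

    The choice $\varepsilon=n^{-190}$ balances two demands. Each plane is made to fail with
    probability $O(n^{-3})$, so that all $N<n^2/2$ planes together stay below $n^{-1/2}$; against
    weights $n^{89}$ this asks for $g(1/n)/g(\varepsilon)\le n^{-92}$. Conversely
    $N(20/\varepsilon^2)^N r^2<1$ must hold with $r^{-1}=(4N^{24})^{5N}$, that is
    $\varepsilon^{-2}\le(4N)^{190}$ competes with $N^{240}$. *)

Definition regpow (e y : R) : R := (y ^+ 2 + e) `^ (- 4^-1).

Lemma powRN4 (X : R) : 0 < X -> (X `^ (- 4^-1)) ^- 4 = X.
Proof.
move=> X0; rewrite -exprVn -powRN opprK -powR_mulrn ?powR_ge0//.
by rewrite -powRrM mulVf ?powRr1 ?ltW// pnatr_eq0.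
Qed.

(** Concavity of $X^{3/4}$ at $X=z^4$: the right side is the tangent line at $X=z_0^4$, written
    without fractional powers. *)
Lemma three_quarters_tangent (z z0 : R) : 0 < z -> 0 < z0 ->
  z ^+ 3 <= (z0 ^+ 4 / 4 + 3 / 4 * z ^+ 4) / z0.
Proof.
move=> z_gt0 z0_gt0; rewrite ler_pdivlMr//.
have -> : z0 ^+ 4 / 4 + 3 / 4 * z ^+ 4 =
  z ^+ 3 * z0 + (z - z0) ^+ 2 * (3 * z ^+ 2 + 2 * z * z0 + z0 ^+ 2) / 4 by field.
rewrite lerDl divr_ge0// mulr_ge0 ?sqr_ge0// !addr_ge0 ?mulr_ge0// ?exprn_ge0//; lra.
Qed.

Let lin A B x := A * cos x + B * sin x.

Lemma is_derive_lin A B x : is_derive x 1 (lin A B) (lin B (- A) x).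
Proof.
rewrite /lin; apply: is_derive_eq; rewrite /GRing.scale/= ; lra.
Qed.

Lemma lin_sqr A B x : lin A B x ^+ 2 + lin B (- A) x ^+ 2 = A ^+ 2 + B ^+ 2.
Proof.
have := cos2Dsin2 x; rewrite /lin => cs.
have -> : A ^+ 2 + B ^+ 2 = (A ^+ 2 + B ^+ 2) * (cos x ^+ 2 + sin x ^+ 2) by rewrite cs mulr1.
ring.
Qed.


Lemma continuous_regpow_lin A B e a : 0 < e ->
  continuous (fun x => (lin A B x ^+ 2 + e) `^ a).
Proof.
move=> e0 x; apply/differentiable_continuous/derivable1_diffP.
have D1 := is_derive_lin A B x.
pose X x := lin A B x ^+ 2 + e.
have X0 : 0 < X x by rewrite ltr_wpDl ?sqr_ge0.
have DX : is_derive x 1 X (2 * lin A B x * lin B (- A) x).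
  by apply: is_derive_eq; rewrite /GRing.scale/=; ring.
by have [] := is_derive1_comp (is_derive1_powR a X0) DX.
Qed.

(* With [X = f^2 + e], [f = A cos + B sin] and [f' = g], the derivative of
   [f g X^(-1/4)] and the tangent inequality for [X^(3/4)] at [X = P / 2] bound
   [regpow e f] by a function with an explicit primitive. *)
Lemma le_regpow_derive A B e (P := A ^+ 2 + B ^+ 2 + e)
    (w0 := (P / 2) `^ (- 4^-1)) : 0 < e ->
  exists H h : R -> R, [/\ forall x, is_derive x 1 H (h x), continuous h,
    forall x, regpow e (lin A B x) <= h x &
    H (2 * pi) - H 0 = 2 * pi * (3 / 2 * w0)].
Proof.
move=> e0.
have P0 : 0 < P by rewrite ltr_wpDl ?addr_ge0 ?sqr_ge0.
have w00 : 0 < w0 by rewrite powR_gt0 ?divr_gt0.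
pose f := lin A B; pose g := lin B (- A).
pose X x := f x ^+ 2 + e; pose w a x := X x `^ a.
have X0 x : 0 < X x by rewrite ltr_wpDl ?sqr_ge0.
have Df x : is_derive x 1 f (g x) by exact: is_derive_lin.
have Dg x : is_derive x 1 g (- f x).
  by have := is_derive_lin B (- A) x; congr is_derive; rewrite /f /lin; lra.
have DX x : is_derive x 1 X (2 * f x * g x).
  by apply: is_derive_eq; rewrite /GRing.scale/=; ring.
have Dw a x : is_derive x 1 (w a) (a * w (a - 1) x * (2 * f x * g x)).
  exact: (is_derive1_comp (is_derive1_powR a (X0 x)) (DX x)).
(* Since $g^2=P-X$ and $f^2=X-e$, the derivative of $fgX^{-1/4}$ is at least
   $(P/2+e)X^{-1/4}-\frac32X^{3/4}$; [k] normalises the first coefficient. The term in $9/16$ comes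
   from the tangent line and integrates to zero over a period, because $g^2-f^2=(fg)'$. *)
pose k := (P / 2 + e)^-1.
pose H x := 3 / 2 * w0 * x + k * (f x * g x * w (- 4^-1) x - 9 / 16 * w0 * (f x * g x)).
pose h x := 3 / 2 * w0 + k * ((g x ^+ 2 - f x ^+ 2) * w (- 4^-1) x
  - 2^-1 * f x ^+ 2 * g x ^+ 2 * w (- 4^-1 - 1) x - 9 / 16 * w0 * (g x ^+ 2 - f x ^+ 2)).
exists H, h; split.
- by move=> x; apply: is_derive_eq; rewrite /GRing.scale/= /h; field.
- move=> x; apply/differentiable_continuous/derivable1_diffP.
  by rewrite /h; apply: ex_derive.
- move=> x; rewrite /h.
  have k0 : 0 < P / 2 + e by rewrite addr_gt0 ?divr_gt0.
  rewrite -(ler_pM2l k0) mulrDr [_ * (k * _)]mulrA /k mulfV ?gt_eqF// mul1r.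
  have -> : regpow e (lin A B x) = w (- 4^-1) x by [].
  have -> : w (- 4^-1 - 1) x = w (- 4^-1) x / X x.
    by rewrite /w powRB ?powRr1 ?ltW// (gt_eqF (X0 x)) implybT.
  have wx0 : 0 < w (- 4^-1) x by rewrite powR_gt0.
  set z := w (- 4^-1) x in wx0 *.
  have zX : z ^-1 ^+ 4 = X x by rewrite exprVn powRN4.
  have z0X : w0 ^-1 ^+ 4 = P / 2 by rewrite exprVn powRN4// divr_gt0.
  have := @three_quarters_tangent z^-1 w0^-1; rewrite !invr_gt0 => /(_ wx0 w00).
  rewrite zX z0X invrK.
  have -> : z^-1 ^+ 3 = X x * z by rewrite -zX [z^-1 ^+ 4]exprSr mulfVK ?gt_eqF.
  have XE : X x = f x ^+ 2 + e by [].
  have PE : P = f x ^+ 2 + g x ^+ 2 + e by rewrite /P -(lin_sqr A B x).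
  move=> tang; have t0 : 0 <= 2^-1 * e * g x ^+ 2 * (z / X x).
    apply: mulr_ge0; last by rewrite divr_ge0 ?(ltW wx0) ?(ltW (X0 x)).
    by rewrite mulr_ge0 ?sqr_ge0// mulr_ge0 ?(ltW e0).
  have we0 : 0 <= w0 * e by rewrite mulr_ge0 ?(ltW w00) ?(ltW e0).
  have zq : z = z / X x * X x by rewrite mulfVK ?gt_eqF.
  move: (z / X x) zq t0 tang => q zq t0; rewrite zq PE XE => tang; lra.
- rewrite /H /w /X /f /g /lin cos0 sin0 [2 * pi]mulr_natl cos2pi sin2pi.
  ring.
Qed.

(** The mean is at most $\frac32(P/2)^{-1/4}$ with $P=A^2+B^2+e$, and $2\le(4/3)^4$ turns this into
    $\frac32\cdot\frac43=2$ times $P^{-1/4}$. The condition on [C] admits both [A] and [B], so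
    either of the two mixed entries can serve as the reference. *)
Lemma integral_regpow_lin A B C e : 0 < e -> C ^+ 2 <= A ^+ 2 + B ^+ 2 ->
  (\int[uniform_prob (@two_pi_gt0 R)]_x
     (regpow e (A * cos x + B * sin x))%:E <= (2 * regpow e C)%:E)%E.
Proof.
move=> e0 CAB; have pi0 := two_pi_gt0 (R := R).
have mg : measurable_fun [set: R] (fun x : R => regpow e (A * cos x + B * sin x)).
  by apply: continuous_measurable_fun; exact: continuous_regpow_lin.
have mf : measurable_fun [set: R] (EFin \o (fun x : R => regpow e (A * cos x + B * sin x))).
  exact/measurable_EFinP.
rewrite [leLHS](integral_uniform pi0 mf); last by move=> x; rewrite lee_fin powR_ge0.
have [H [h [DH ch leh HE]]] := le_regpow_derive A B e0.
rewrite subr0 -lee_pdivlMl ?invr_gt0//.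
have FTC := @continuous_FTC2 _ h H _ _ pi0.
apply: (@le_trans _ _ (\int[lebesgue_measure]_(x in `[0%R, (2 * pi)%R]) (h x)%:E)%E).
  apply: ge0_le_integral => //.
  - by move=> x _; rewrite lee_fin powR_ge0.
  - exact: measurable_funTS.
  - by apply/measurable_funTS/measurable_EFinP; exact: continuous_measurable_fun.
  - by move=> x _; rewrite lee_fin; exact: leh.
rewrite FTC; last 3 first.
- exact: continuous_subspaceT.
- split => [x _| |].
  + by have [] := DH x.
  + apply: cvg_at_right_filter; apply: differentiable_continuous.
    by apply/derivable1_diffP; have [] := DH 0.
  + apply: cvg_at_left_filter; apply: differentiable_continuous.
    by apply/derivable1_diffP; have [] := DH (2 * pi).
- by move=> x _; rewrite derive1E; have [] := DH x.
rewrite -EFinB HE invrK -EFinM lee_fin ler_pM2l//.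
set P := A ^+ 2 + B ^+ 2 + e.
have Ce : 0 < C ^+ 2 + e by rewrite ltr_wpDl ?sqr_ge0.
have P0 : 0 < P by apply: lt_le_trans Ce _; rewrite /P lerD2r.
rewrite /regpow !powRN.
set z := C ^+ 2 + e in Ce *; set a := _ `^ 4^-1; set b := z `^ 4^-1.
have a4 : a ^+ 4 = P / 2.
  by rewrite -powR_mulrn ?powR_ge0// -powRrM mulVf ?pnatr_eq0// powRr1 ?ltW ?divr_gt0.
have b4 : b ^+ 4 = z.
  by rewrite -powR_mulrn ?powR_ge0// -powRrM mulVf ?pnatr_eq0// powRr1 ?ltW.
have a0 : 0 < a by rewrite powR_gt0 ?divr_gt0.
have b0 : 0 < b by rewrite powR_gt0.
have ba : b <= 4 / 3 * a.
  rewrite -(@ler_pXn2r _ 4)// ?nnegrE ?ltW// ?mulr_gt0//.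
  rewrite exprMn a4 b4.
  have zP : z <= P by rewrite lerD2r.
  lra.
rewrite ler_pdivlMr// mulrAC ler_pdivrMr//.
lra.
Qed.

End Average.

(** * Rotations and the differential of the walk *)

Section Rotations.
Context {R : realType} {n : nat}.
Implicit Types (p : 'I_n * 'I_n) (M y : 'M[R]_n) (t : R).

Definition on_plane p (x : 'I_n) := (x == p.1) || (x == p.2).

(* Conjugation by a rotation in the plane [p] mixes the entry [(x, z)] of an
   antisymmetric matrix with the entry [(swap p x, swap p z)] when [hits p x z], and
   keeps it otherwise, in particular when [x] and [z] both lie on [p]. *)
Definition hits p (x z : 'I_n) := on_plane p x (+) on_plane p z.

Definition swap p (x : 'I_n) := tperm p.1 p.2 x.

Definition rotation_gen p : 'M[R]_n := delta_mx p.1 p.2 - delta_mx p.2 p.1.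

Lemma tr_rotation_mulE p t M x z : p.1 != p.2 ->
  ((rotation p t)^T *m M) x z = if on_plane p x then
    cos t * M x z + (-1) ^+ (x == p.1) * sin t * M (swap p x) z else M x z.
Proof.
move=> p12; rewrite mxE /on_plane /swap.
have p21 : p.2 != p.1 by rewrite eq_sym.
have [->|x1] /= := eqVneq x p.1.
  rewrite tpermL (bigD1 p.1)//= (bigD1 p.2)//= big1 ?addr0; last first.
    move=> i /andP[i1 i2]; rewrite !mxE (negbTE i1) (negbTE i2)/=.
    by rewrite mul0r.
  by rewrite !mxE !eqxx/= (negbTE p21) (negbTE p12)/= expr1 mulN1r.
have [->|x2] /= := eqVneq x p.2.
  rewrite tpermR (bigD1 p.2)//= (bigD1 p.1)//= big1 ?addr0; last first.
    move=> i /andP[i1 i2]; rewrite !mxE (negbTE i1) (negbTE i2)/=.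
    by rewrite mul0r.
  by rewrite !mxE !eqxx/= (negbTE p21) (negbTE p12)/= mul1r.
rewrite (bigD1 x)//= big1 ?addr0; last first.
  move=> i ix; rewrite !mxE (negbTE x1) (negbTE x2) !andbF/=.
  by rewrite (negbTE ix) mul0r.
by rewrite !mxE (negbTE x1) (negbTE x2)/= eqxx mul1r.
Qed.

Lemma mul_rotationE p t M x z : p.1 != p.2 ->
  (M *m rotation p t) x z = if on_plane p z then
    cos t * M x z + (-1) ^+ (z == p.1) * sin t * M x (swap p z) else M x z.
Proof.
move=> p12; have -> : M *m rotation p t = ((rotation p t)^T *m M^T)^T.
  by rewrite trmx_mul !trmxK.
by rewrite mxE tr_rotation_mulE// !mxE.
Qed.

(** Antisymmetry enters when both indices lie on the plane: the $2\times2$ block is then a multiple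
    of the generator and commutes with the rotation. *)
Lemma rotation_conjE p t y x z : p.1 != p.2 -> y^T = - y -> x != z ->
  ((rotation p t)^T *m y *m rotation p t) x z = if hits p x z then
    cos t * y x z + (-1) ^+ ((x == p.1) || (z == p.1)) * sin t * y (swap p x) (swap p z)
  else y x z.
Proof.
move=> p12 yT xz.
have yN a b : y a b = - y b a by have := congr1 (fun M => M b a) yT; rewrite !mxE.
have y0 a : y a a = 0 by have := yN a a; lra.
rewrite mul_rotationE// !tr_rotation_mulE// /hits.
have [xp|xp] := boolP (on_plane p x); have [zp|zp] //= := boolP (on_plane p z).
- have cs := cos2Dsin2 t.
  transitivity ((cos t ^+ 2 + sin t ^+ 2) * y x z); last by rewrite cs mul1r.
  case/orP: xp xz => /eqP ->; case/orP: zp => /eqP -> ; rewrite ?eqxx// => _;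
    rewrite /swap ?tpermL ?tpermR ?eqxx ?(negbTE p12) ?[p.2 == _]eq_sym ?(negbTE p12) /=;
    rewrite !y0 ?[y p.2 p.1]yN; ring.
- move: zp; rewrite /on_plane negb_or => /andP[z1 z2].
  by rewrite (negbTE z1) orbF /swap (tpermD (z := z)) 1?eq_sym.
- move: xp; rewrite /on_plane negb_or => /andP[x1 x2].
  by rewrite (negbTE x1) /swap (tpermD (z := x)) 1?eq_sym.
Qed.

Lemma rotation_orthogonal p t : p.1 != p.2 ->
  (rotation p t)^T *m rotation p t = 1%:M.
Proof.
move=> p12; have p21 : p.2 != p.1 by rewrite eq_sym.
have cs := cos2Dsin2 t.
apply/matrixP => x z; rewrite tr_rotation_mulE// /on_plane /swap.
have [->|x1] /= := eqVneq x p.1.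
  rewrite tpermL !mxE !eqxx (negbTE p12) (negbTE p21)/=.
  have [->|z1] /= := eqVneq z p.1; first by rewrite ?eqxx ?(negbTE p12) /=; lra.
  have [_|z2] /= := eqVneq z p.2; first lra.
  lra.
have [->|x2] /= := eqVneq x p.2.
  rewrite tpermR !mxE !eqxx (negbTE p12) (negbTE p21)/=.
  have [->|z1] /= := eqVneq z p.1; first by rewrite ?eqxx ?(negbTE p21) ?(negbTE p12) /=; lra.
  have [_|z2] /= := eqVneq z p.2; lra.
by rewrite !mxE (negbTE x1) (negbTE x2)/=.
Qed.

Lemma rotation_orthogonalr p t : p.1 != p.2 ->
  rotation p t *m (rotation p t)^T = 1%:M.
Proof. by move=> p12; apply: mulmx1C; exact: rotation_orthogonal. Qed.

Lemma rotation_gen_mulE p M x z : p.1 != p.2 ->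
  (rotation_gen p *m M) x z = (x == p.1)%:R * M p.2 z - (x == p.2)%:R * M p.1 z.
Proof.
move=> p12; rewrite mulmxBl !mxE; congr (_ - _).
- rewrite (bigD1 p.2)//= big1 ?addr0; first by rewrite mxE eqxx andbT.
  by move=> i ip; rewrite mxE (negbTE ip) andbF mul0r.
- rewrite (bigD1 p.1)//= big1 ?addr0; first by rewrite mxE eqxx andbT.
  by move=> i ip; rewrite mxE (negbTE ip) andbF mul0r.
Qed.

Lemma is_derive_rotation p t a b : p.1 != p.2 ->
  is_derive t 1 (fun t => rotation p t a b) ((rotation_gen p *m rotation p t) a b).
Proof.
move=> p12; have p21 : p.2 != p.1 by rewrite eq_sym.
rewrite rotation_gen_mulE//.
suff : is_derive t 1 (fun t : R =>
    if (a == p.1) && (b == p.1) || (a == p.2) && (b == p.2) then cos t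
    else if (a == p.1) && (b == p.2) then sin t
    else if (a == p.2) && (b == p.1) then - sin t
    else (a == b)%:R) ((a == p.1)%:R * rotation p t p.2 b - (a == p.2)%:R * rotation p t p.1 b).
  by congr is_derive; apply/funext => u; rewrite mxE.
rewrite !mxE !eqxx (negbTE p12) (negbTE p21) /=.
have [->|a1] := eqVneq a p.1.
  rewrite (negbTE p12) /=.
  have [->|b1] := eqVneq b p.1; first by rewrite (negbTE p12)/=; apply: is_derive_eq; lra.
  have [_|b2] /= := eqVneq b p.2; rewrite ?[p.1 == b]eq_sym ?(negbTE b1); apply: is_derive_eq; lra.
have [->|a2] := eqVneq a p.2.
  have [->|b1] := eqVneq b p.1.
    by rewrite (negbTE p12)/=; apply: is_derive_eq; lra.
  have [_|b2] /= := eqVneq b p.2; apply: is_derive_eq; lra.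
rewrite /= !mul0r subr0; exact: is_derive_cst.
Qed.

Lemma tr_rotation_gen p : (rotation_gen p)^T = - rotation_gen p.
Proof. by rewrite linearB/= !trmx_delta opprB. Qed.

Lemma HSE (A B : 'M[R]_n) : HS A B = \sum_a \sum_b A a b * B a b.
Proof.
rewrite /HS /mxtrace exchange_big /=; apply: eq_bigr => i _; rewrite mxE.
by apply: eq_bigr => j _; rewrite mxE.
Qed.

Lemma HS_gen p y : p.1 != p.2 -> y^T = - y -> HS (rotation_gen p) y = 2 * y p.1 p.2.
Proof.
move=> p12 yT.
have yN a b : y a b = - y b a by have := congr1 (fun M => M b a) yT; rewrite !mxE.
rewrite /HS tr_rotation_gen mulNmx linearN/= /mxtrace (bigD1 p.1)//= (bigD1 p.2)/=; last by rewrite eq_sym.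
rewrite big1 ?addr0; last first.
  move=> i /andP[i1 i2]; rewrite rotation_gen_mulE// (negbTE i1) (negbTE i2).
  by rewrite !mul0r subr0.
rewrite !rotation_gen_mulE// !eqxx [p.2 == _]eq_sym (negbTE p12) [y p.2 p.1]yN/=; lra.
Qed.

End Rotations.

Section WalkDerivative.
Context {R : realType}.

Lemma differentiable_mx (V : normedModType R) m n (f : V -> 'M[R]_(m, n)) x :
  (forall i j, differentiable (fun y => f y i j) x) -> differentiable f x.
Proof.
move=> df; have -> : f = \sum_(i < m) \sum_(j < n) (fun y => f y i j *: (delta_mx i j : 'M[R]_(m, n))).
  apply/funext => y; rewrite fct_sumE [LHS]matrix_sum_delta; apply: eq_bigr => i _.
  by rewrite fct_sumE.
by apply: differentiable_sum => i; apply: differentiable_sum => j; exact: differentiableZl.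
Qed.

Variables (Q : R) (n : nat) (pl : 'I_(nplanes n) -> 'I_n * 'I_n).
Variables (idx : nat -> 'I_(nplanes n)) (eta : nat -> R) (X : 'M[R]_n).
Hypothesis pl_neq : forall i, (pl i).1 != (pl i).2.

Local Notation rot t := (rotation (pl (idx t)) (eta t)).

Definition mark (t : nat) : option 'I_(nplanes n) := [pick l : 'I_(nplanes n) | t == marked_time Q idx l].

(* [field l t *m walk t] is the derivative of [walk _ t] along the [l]-th axis. *)
Fixpoint field (l : 'I_(nplanes n)) (t : nat) : 'M[R]_n :=
  if t is t'.+1 then
    (if mark t' == Some l then rotation_gen (pl (idx t')) else 0)
      + rot t' *m field l t' *m (rot t')^T
  else 0.

Let W x t := walk Q pl idx eta X x t.

Lemma angle0 t : angle Q idx eta 0 t = eta t.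
Proof. by rewrite /angle; case: pickP => // l _; rewrite mxE addr0. Qed.

Lemma walkS0 t : W 0 t.+1 = rot t *m W 0 t.
Proof. by rewrite /W /= angle0. Qed.

Lemma walk_orthogonal t : SO X -> (W 0 t)^T *m W 0 t = 1%:M.
Proof.
move=> [XX _]; elim: t => [//|t IH].
rewrite walkS0 trmx_mul mulmxA -[_ *m (rot t)^T *m _]mulmxA.
by rewrite rotation_orthogonal// mulmx1.
Qed.

Lemma differentiable_rotation p (f : 'rV[R]_(nplanes n) -> R) x a b : p.1 != p.2 ->
  differentiable f x -> differentiable (fun y => @rotation R n p (f y) a b) x.
Proof.
move=> p12 df; apply: (@differentiable_comp _ _ _ _ f (fun t => rotation p t a b)) => //.
by apply/derivable1_diffP; have [] := is_derive_rotation (f x) a b p12.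
Qed.

Lemma differentiable_angle t x : differentiable (angle Q idx eta ^~ t) x.
Proof.
rewrite /angle; case: pickP => [l _|_]; last exact: differentiable_cst.
by apply: differentiableD; [exact: differentiable_cst | exact: differentiable_coord].
Qed.

Lemma differentiable_walk t x a b : differentiable (fun y => W y t a b) x.
Proof.
elim: t a b => [|t IH] a b /=; first exact: differentiable_cst.
have -> : (fun y => W y t.+1 a b) = \sum_(c < n)
    ((fun y => rotation (pl (idx t)) (angle Q idx eta y t) a c) * (fun y => W y t c b)).
  by apply/funext => y; rewrite fct_sumE /W /= mxE.
apply: differentiable_sum => c; apply: differentiableM => //.
by apply: differentiable_rotation => //; exact: differentiable_angle.
Qed.

Lemma is_derive_line (V : normedModType R) (f : V -> R) (v : V) (d : R) :
  is_derive (0 : R) 1 (fun h : R => f (h *: v)) d -> is_derive 0 v f d.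
Proof.
have E : (fun h : R => h^-1 *: ((f \o shift 0) (h *: v) - f 0)) =
    (fun h : R => h^-1 *: (((fun k : R => f (k *: v)) \o shift 0) (h *: 1) - f (0 *: v))).
  by apply/funext => h /=; rewrite !addr0 scale0r [h *: 1]mulr1.
by move=> [D1 D2]; split; [rewrite /derivable E | rewrite -D2 /derive E].
Qed.

Lemma is_derive_walk_line t l a b :
  is_derive (0 : R) 1 (fun h => W (h *: delta_mx 0 l) t a b) ((field l t *m W 0 t) a b).
Proof.
elim: t a b => [|t IH] a b; first by rewrite mul0mx mxE; exact: is_derive_cst.
pose ang h := angle Q idx eta (h *: delta_mx 0 l) t.
have -> : (fun h => W (h *: delta_mx 0 l) t.+1 a b) = \sum_(c < n)
    ((fun h => rotation (pl (idx t)) (ang h) a c) * (fun h => W (h *: delta_mx 0 l) t c b)).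
  by apply/funext => y; rewrite fct_sumE /W /= mxE.
have Dang : is_derive (0 : R) 1 ang (mark t == Some l)%:R.
  rewrite /ang /angle /mark; case: pickP => [k _|_]; last exact: is_derive_cst.
  have -> : (fun h => eta t + (h *: delta_mx 0 l : 'rV[R]__) 0 k) =
      (fun h : R => eta t + (k == l)%:R * h).
    by apply/funext => h; rewrite !mxE eqxx mulrC.
  by apply: is_derive_eq; rewrite /GRing.scale/= add0r mul1r mulr1.
have ang0 : ang 0 = eta t by rewrite /ang scale0r angle0.
have Drot c : is_derive (0 : R) 1 (fun h => rotation (pl (idx t)) (ang h) a c)
    ((rotation_gen (pl (idx t)) *m rot t) a c * (mark t == Some l)%:R).
  apply: (is_derive1_comp (f := fun s => rotation (pl (idx t)) s a c)).
  by rewrite ang0; exact: is_derive_rotation.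
apply: is_derive_eq.
rewrite ang0 scale0r.
have -> : field l t.+1 *m W 0 t.+1 =
    (if mark t == Some l then rotation_gen (pl (idx t)) else 0) *m rot t *m W 0 t
    + rot t *m (field l t *m W 0 t).
  rewrite walkS0 [field l t.+1]/= mulmxDl; congr (_ + _); first by rewrite mulmxA.
  rewrite -[LHS]mulmxA [_ *m (rot t *m W 0 t)]mulmxA rotation_orthogonal// mul1mx.
  by rewrite mulmxA.
rewrite big_split/= addrC [RHS]mxE; congr (_ + _); last by rewrite [RHS]mxE.
rewrite [RHS]mxE; apply: eq_bigr => c _; rewrite /GRing.scale/= mulrC; congr (_ * _).
by case: ifP => _; rewrite /= ?mulr1// mulr0 mul0mx [RHS]mxE.
Qed.

Lemma diff_rotmap l : 'd (rotmap Q pl idx eta X) 0 (delta_mx 0 l) =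
  field l (end_time Q idx) *m rotmap Q pl idx eta X 0.
Proof.
have D : differentiable (rotmap Q pl idx eta X) 0.
  by apply: differentiable_mx => a b; exact (differentiable_walk (end_time Q idx) 0 a b).
rewrite -deriveE// derive_mx; last exact: diff_derivable.
apply/matrixP => a b; rewrite mxE.
have D1 : is_derive (0 : 'rV[R]_(nplanes n)) (delta_mx 0 l)
    (fun x => W x (end_time Q idx) a b) ((field l (end_time Q idx) *m W 0 (end_time Q idx)) a b).
  by apply: is_derive_line; exact: is_derive_walk_line.
by have [] := D1.
Qed.

Lemma tr_field l t : (field l t)^T = - field l t.
Proof.
elim: t => [|t IH] /=; first by rewrite linear0 oppr0.
rewrite linearD /= !trmx_mul trmxK IH mulNmx mulmxN mulmxA opprD; congr (_ + _).
by case: ifP => _; rewrite ?tr_rotation_gen// linear0 oppr0.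
Qed.

Lemma HS_mulr (A B O : 'M[R]_n) : O *m O^T = 1%:M -> HS (A *m O) (B *m O) = HS A B.
Proof.
by move=> OO; rewrite /HS trmx_mul -mulmxA mxtrace_mulC -!mulmxA OO mulmx1.
Qed.

(** The columns of the Jacobian are the coordinates of [field l T *m F] ([T] the end time) in an
    orthonormal basis of the tangent space at [F], so Parseval gives their inner products, and right
    multiplication by the orthogonal [F] drops out. Thus neither [b] nor [X] influences the singular
    values. *)
Lemma jac_gram (b : 'I_(nplanes n) -> 'M[R]_n) : SO X ->
  orthonormal_basis (tangent_SO (rotmap Q pl idx eta X 0)) b ->
  (jac Q pl idx eta X b)^T *m jac Q pl idx eta X b =
  \matrix_(i, j) HS (field i (end_time Q idx)) (field j (end_time Q idx)).
Proof.
move=> SOX [bS bo bspan]; set F := rotmap Q pl idx eta X 0.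
have FF : F^T *m F = 1%:M := walk_orthogonal (end_time Q idx) SOX.
have FF' : F *m F^T = 1%:M by exact: mulmx1C.
set u := field^~ (end_time Q idx).
have uT l : tangent_SO F (u l *m F).
  change (F^T *m (u l *m F) + (u l *m F)^T *m F = 0).
  have uN : (u l)^T = - u l := tr_field l _.
  by rewrite (trmx_mul (u l) F) uN mulmxA mulmxN mulNmx subrr.
apply/matrixP => i j; rewrite !mxE.
have [c uj] := bspan _ (uT j).
have cE k : HS (b k) (u j *m F) = c k.
  rewrite uj /HS mulmx_sumr linear_sum/= (bigD1 k)//= big1 ?addr0.
    by rewrite -scalemxAr linearZ/= -/(HS _ _) bo eqxx mulr1.
  by move=> l lk; rewrite -scalemxAr linearZ/= -/(HS _ _) bo eq_sym (negbTE lk) mulr0.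
rewrite -(HS_mulr (u i) (u j) FF') uj [in RHS]/HS mulmx_sumr linear_sum/=.
apply: eq_bigr => k _; rewrite !mxE !diff_rotmap -/F -/(u _) -/(u _) cE.
rewrite -scalemxAr linearZ/= mulrC; congr (_ * _).
by rewrite /HS -mxtrace_tr trmx_mul trmxK.
Qed.

End WalkDerivative.

(** * The smallest singular value *)

Section SmallestSingularValue.
Context {R : realType}.

Lemma horner_char_poly N (G : 'M[R]_N) a : (char_poly G).[a] = \det (a%:M - G).
Proof.
rewrite /char_poly -[LHS]/(horner_eval a _) -det_map_mx; congr (\det _).
by apply/matrixP => i j; rewrite !mxE /= /horner_eval hornerD hornerN hornerMn hornerX hornerC.
Qed.

Lemma eigenvalue_det N (G : 'M[R]_N) a : eigenvalue G a = (\det (a%:M - G) == 0).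
Proof.
apply/eigenvalueP/det0P => [] [v]; [move=> vG v0 | move=> v0 vG]; exists v => //.
  by rewrite mulmxBr vG mul_mx_scalar subrr.
by apply/esym/eqP; rewrite -mul_mx_scalar -subr_eq0 -mulmxBr vG.
Qed.

Lemma continuous_det_sqr N (G : 'M[R]_N) : continuous (fun s : R => \det ((s ^+ 2)%:M - G)).
Proof.
have -> : (fun s : R => \det ((s ^+ 2)%:M - G)) = (fun s => (char_poly G \Po 'X^2).[s]).
  by apply/funext => s; rewrite -horner_char_poly horner_comp hornerXn.
move=> s; apply/differentiable_continuous/derivable1_diffP.
by have [] := is_derive_poly (char_poly G \Po 'X^2) s.
Qed.

Let qf N (G : 'M[R]_N) (v : 'rV[R]_N) : R := (v *m G *m v^T) 0 0.

Lemma differentiable_qf N (G : 'M[R]_N) v : differentiable (qf G) v.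
Proof.
have -> : qf G = \sum_(i < N) ((\sum_(j < N) (fun v : 'rV[R]_N => G j i *: v 0 j)) * (fun v : 'rV[R]_N => v 0 i)).
  apply/funext => w; rewrite /qf fct_sumE mxE; apply: eq_bigr => i _.
  rewrite !mxE; congr (_ * _); rewrite fct_sumE.
  by apply: eq_bigr => j _; rewrite mulrC.
apply: differentiable_sum => i; apply: differentiableM; last exact: differentiable_coord.
by apply: differentiable_sum => j; apply: differentiableZ; exact: differentiable_coord.
Qed.

Lemma qf1E N (v : 'rV[R]_N) : qf 1%:M v = \sum_i v 0 i ^+ 2.
Proof.
by rewrite /qf mulmx1 mxE; apply: eq_bigr => i _; rewrite mxE expr2.
Qed.

Lemma compact_sphere N : compact [set v : 'rV[R]_N | qf 1%:M v = 1].
Proof.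
apply: bounded_closed_compact.
- exists 1; split => // M M1 v /= v1.
  apply: (le_trans _ (ltW M1)); rewrite /Num.Def.normr/= mx_normrE.
  apply: bigmax_le => // -[i j] _ /=; rewrite ord1.
  rewrite -(@ler_pXn2r _ 2)// ?nnegrE// expr1n real_normK ?num_real//.
  rewrite -v1 qf1E (bigD1 j)//= lerDl sumr_ge0// => k _; exact: sqr_ge0.
- have -> : [set v : 'rV[R]_N | qf 1%:M v = 1] = qf 1%:M @^-1` [set 1] by [].
  apply: closed_comp => [v _|]; last exact: closed_eq.
  exact/differentiable_continuous/differentiable_qf.
Qed.

Lemma sum_sqr_eq0 N (v : 'rV[R]_N) : \sum_i v 0 i ^+ 2 <= 0 -> v = 0.
Proof.
move=> v0; have /eqP : \sum_i v 0 i ^+ 2 = 0.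
  by apply: le_anti; rewrite v0 sumr_ge0// => i _; exact: sqr_ge0.
rewrite psumr_eq0; last by move=> i _; exact: sqr_ge0.
move=> /allP v0'; apply/rowP => i; rewrite mxE; apply/eqP; rewrite -sqrf_eq0; exact: v0' (mem_index_enum i).
Qed.

(** The minimum [l] of the quadratic form of $G=D^TD$ on the unit sphere is an eigenvalue:
    [K = G - l] is positive semidefinite and its form vanishes at the minimiser, which must then lie
    in the kernel of [K]. *)
Lemma singular_value_exists N (D : 'M[R]_N) : (0 < N)%N -> exists s, singular_value D s.
Proof.
move=> N0; set G := D^T *m D.
have GT : G^T = G by rewrite /G trmx_mul trmxK.
have ne : [set v : 'rV[R]_N | qf 1%:M v = 1] !=set0.
  exists (delta_mx 0 (Ordinal N0)); rewrite /= qf1E (bigD1 (Ordinal N0))//= big1 ?addr0.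
    by rewrite mxE !eqxx expr1n.
  by move=> i i0; rewrite mxE (negbTE i0) expr0n.
have cG : {within [set v : 'rV[R]_N | qf 1%:M v = 1], continuous (qf G)}.
  by apply: continuous_subspaceT => v; exact/differentiable_continuous/differentiable_qf.
have [v v1 vmin] := EVT_min_rV ne (@compact_sphere N) cG.
move: v1; rewrite inE /= => v1.
set l := qf G v; pose K := G - l%:M.
have KT : K^T = K by rewrite linearB/= GT tr_scalar_mx.
have qK w : qf K w = qf G w - l * qf 1%:M w.
  rewrite /qf /K mulmxBr mulmxBl mul_mx_scalar -scalemxAl mulmx1 mxE; congr (_ + _).
  by rewrite mxE; congr (- _); rewrite mxE.
have K0 w : 0 <= qf K w.
  rewrite qK subr_ge0; have [w0|w0] := leP (qf 1%:M w) 0.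
    by rewrite qf1E in w0; rewrite (sum_sqr_eq0 w0) /qf !mul0mx !mxE mulr0.
  set c := (Num.sqrt (qf 1%:M w))^-1.
  have qZ (H : 'M[R]_N) : qf H (c *: w) = (qf 1%:M w)^-1 * qf H w.
    rewrite /qf linearZ/= -!scalemxAl -scalemxAr scalerA mxE; congr (_ * _).
    by rewrite /c -expr2 exprVn sqr_sqrtr// ltW.
  have := vmin (c *: w); rewrite inE /= !qZ mulVf ?gt_eqF// => /(_ erefl).
  by rewrite ler_pdivlMl// mulrC.
have Kv : qf K v = 0 by rewrite qK v1 mulr1 subrr.
pose u := v *m K.
have ku (t : R) : qf K (v + t *: u) = 2 * t * (\sum_i u 0 i ^+ 2) + t ^+ 2 * qf K u.
  rewrite {1}/qf; have -> : \sum_i u 0 i ^+ 2 = (u *m u^T) 0 0 by rewrite -qf1E /qf mulmx1.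
  have aD (A B : 'M[R]_1) : (A + B) 0 0 = A 0 0 + B 0 0 by rewrite mxE.
  have aZ c (A : 'M[R]_1) : (c *: A) 0 0 = c * A 0 0 by rewrite mxE.
  have -> : (v + t *: u)^T = v^T + t *: u^T by rewrite linearD; congr (_ + _); rewrite linearZ.
  rewrite mulmxDl -scalemxAl mulmxDr !mulmxDl -!scalemxAl -!scalemxAr -/u.
  have -> : u *m K *m v^T = u *m u^T by rewrite /u trmx_mul KT mulmxA.
  have uv : (u *m v^T) 0 0 = 0 by exact: Kv.
  rewrite !(aD, aZ) uv (_ : (u *m K *m u^T) 0 0 = qf K u)//; ring.
(* Along [v + t *: u] the form is $2t|u|^2+t^2K(u)$, which is negative for small $t<0$ unless $u=0$;
   adding 1 to $K(u)$ in the choice of $t$ keeps the denominator positive. *)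
have u0 : u = 0.
  apply: sum_sqr_eq0; rewrite leNgt; apply/negP => S0.
  set S := \sum_i _ in S0 ku.
  have := K0 (v + (- (S / (1 + qf K u))) *: u); rewrite ku.
  have q0 := K0 u; have q1 : 0 < 1 + qf K u by rewrite ltr_wpDr.
  rewrite leNgt => /negP; apply.
  rewrite sqrrN expr2; set a := S / _; have a0 : 0 < a by rewrite divr_gt0.
  have aS : a * (1 + qf K u) = S by rewrite mulfVK ?gt_eqF.
  have : a * (a * qf K u) <= a * S by rewrite ler_pM2l// -aS ler_pM2l// lerDr.
  have : 0 < a * S by rewrite mulr_gt0.
  lra.
have l0 : 0 <= l.
  rewrite /l /qf /G -!mulmxA mulmxA; have -> : D *m v^T = (v *m D^T)^T by rewrite trmx_mul trmxK.
  by have := qf1E (v *m D^T); rewrite /qf mulmx1 => ->; rewrite sumr_ge0// => i _; exact: sqr_ge0.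
exists (Num.sqrt l); split; first exact: sqrtr_ge0.
rewrite sqr_sqrtr//; apply/eigenvalueP; exists v.
  by apply/eqP; rewrite -subr_eq0 -mul_mx_scalar -mulmxBr; apply/eqP.
apply/eqP => v0; move: v1; rewrite v0 /qf !mul0mx mxE => /eqP.
by rewrite eq_sym oner_eq0.
Qed.

(** The infimum defining [sigma1] is over a nonempty set and is attained: a nonzero determinant at
    [sigma1 D] would stay nonzero nearby, against the singular values that approach the infimum. The
    determinant form is the one whose measurability can be checked. *)
Lemma sigma1_le N (D : 'M[R]_N) r : (0 < N)%N ->
  sigma1 D <= r <-> exists s, [/\ 0 <= s, s <= r & \det ((s ^+ 2)%:M - D^T *m D) = 0].
Proof.
move=> N0; have [s0 s0D] := singular_value_exists D N0.
have lb : has_lbound [set s | singular_value D s] by exists 0 => s [].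
split=> [sr|[s [s_ge0 sr ds]]]; last first.
  apply: le_trans sr; apply: ge_inf => //; split=> //.
  by rewrite eigenvalue_det ds.
exists (sigma1 D); split => //; first by apply: lb_le_inf; [exists s0 | move=> s []].
apply/eqP/negP => /negP ds0.
have := @continuous_det_sqr _ (D^T *m D) (sigma1 D).
move=> /cvgrPdist_lt /(_ `|\det ((sigma1 D ^+ 2)%:M - D^T *m D)|).
rewrite normr_gt0 => /(_ ds0) [e /= e0 He].
have [s sD] := @inf_adherent _ [set s | singular_value D s] e e0 (conj (ex_intro _ s0 s0D) lb).
rewrite -/(sigma1 D) => se.
have := He s; rewrite /ball_ /= => /(_ _)/wrap[].
  by rewrite ltr_norml; have := ge_inf lb sD; rewrite -/(sigma1 D); lra.
by case: sD => _; rewrite eigenvalue_det => /eqP ->; rewrite subr0 ltxx.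
Qed.

End SmallestSingularValue.

Definition box {R : realType} (B : nat -> set R) : set (nat -> R) := [set th | forall j, B j (th j)].

(** Finite-dimensional cylinders, a pi-system generating the product sigma-algebra on sequences. *)
Definition boxes (R : realType) : set (set (nat -> R)) :=
  [set A | exists (k : nat) (B : nat -> set R), [/\ forall j, measurable (B j),
    forall j, (k <= j)%N -> B j = setT & A = box B]].

Arguments boxes R : clear implicits.

Definition angles (R : realType) := g_sigma_algebraType (boxes R).

HB.instance Definition _ (R : realType) := Measurable.on (angles R).

(** * Sequences of independent angles *)

Section AngleSpace.
Context {R : realType}.

Definition upd (th : angles R) (t : nat) (x : R) : angles R := fun j => if j == t then x else th j.

Lemma measurable_box k (B : nat -> set R) : (forall j, measurable (B j)) ->
  (forall j, (k <= j)%N -> B j = setT) -> measurable (box B : set (angles R)).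
Proof. by move=> mB Bk; apply: sub_gen_smallest; exists k, B. Qed.

Lemma measurable_coord t : measurable_fun [set: angles R] (fun th : angles R => th t : R).
Proof.
move=> _ B mB; rewrite setTI.
pose C j := if j == t then B else setT.
have -> : (fun th : angles R => th t) @^-1` B = box C.
  apply/seteqP; split=> th /=; last by move/(_ t); rewrite /C eqxx.
  by move=> Bt j; rewrite /C; case: eqP => [->|].
apply: (@measurable_box t.+1) => j; rewrite /C; first by case: eqP.
by case: eqP => // ->; rewrite ltnn.
Qed.

Lemma measurable_to_angles d (T : measurableType d) (f : T -> angles R) :
  (forall t, measurable_fun setT (fun w => f w t : R)) -> measurable_fun setT f.
Proof.
move=> mf; apply: (@measurability _ _ T (angles R) setT f (boxes R)); first by [].
move=> _ [_ [k [B [mB Bk ->]]] <-]; rewrite setTI.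
have -> : f @^-1` box B = \bigcap_j ((fun w => f w j) @^-1` B j).
  by apply/seteqP; split=> [w fw j _|w fw j]; [exact: fw | exact: fw].
by apply: bigcapT_measurable => j; rewrite -[X in measurable X]setTI; exact: mf.
Qed.

Lemma setI_closed_boxes : setI_closed (boxes R).
Proof.
move=> _ _ [k [B [mB Bk ->]]] [k' [B' [mB' Bk' ->]]].
exists (maxn k k'), (fun j => B j `&` B' j); split.
- by move=> j; exact: measurableI.
- by move=> j; rewrite geq_max => /andP[? ?]; rewrite Bk ?Bk' ?setIT.
- by apply/seteqP; split=> th /= => [[a b] j | ab]; [split | split=> j; have [] := ab j].
Qed.

Notation mu := (uniform_prob (@two_pi_gt0 R)).

Variable L : probability (angles R) R.
Hypothesis Lbox : forall k (B : nat -> set R), (forall j, measurable (B j)) ->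
  (forall j, (k <= j)%N -> B j = setT) -> L (box B) = (\prod_(j <- iota 0 k) mu (B j))%E.

Lemma measurable_upd t : measurable_fun setT (fun z : angles R * measurableTypeR R => upd z.1 t z.2).
Proof.
apply: measurable_to_angles => j; rewrite /upd; case: eqP => _.
  exact: measurable_snd.
exact: (measurableT_comp (measurable_coord j) measurable_fst).
Qed.

Lemma measurable_upd1 t th : measurable_fun [set: R] (upd th t).
Proof.
apply: measurable_to_angles => j; rewrite /upd; case: eqP => _ //.
Qed.

(** Replacing one angle by a fresh uniform one preserves the law: on a box this only exchanges the
    factor of [B t], and boxes determine the measure. *)
Lemma resample_measure t (D : set (angles R)) : measurable D ->
  L D = (L \x mu)%E ((fun z : angles R * measurableTypeR R => upd z.1 t z.2) @^-1` D).
Proof.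
move=> mD; have mt := measurable_upd t.
pose m : {measure set (angles R) -> \bar R} :=
  pushforward (L \x mu)%E (fun z : angles R * measurableTypeR R => upd z.1 t z.2).
pose m2 := m mt.
have m2E (A : set (angles R)) :
  m2 A = (L \x mu)%E ((fun z : angles R * measurableTypeR R => upd z.1 t z.2) @^-1` A) by [].
rewrite -m2E.
suff /(_ D mD) : forall D, measurable D -> L D = m2 D by [].
apply: (@measure_unique _ R (angles R) (boxes R) (fun=> setT)) => //.
- exact: setI_closed_boxes.
- by move=> _; exists 0%N, (fun=> setT); split => //; apply/seteqP; split.
- by apply/seteqP; split=> // x _; exists 0%N.
- move=> _ [k [B [mB Bk ->]]].
  pose K := maxn k t.+1.
  have BK j : (K <= j)%N -> B j = setT by rewrite geq_max => /andP[? _]; exact: Bk.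
  pose C j := if j == t then setT else B j.
  have mC j : measurable (C j) by rewrite /C; case: eqP.
  have CK j : (K <= j)%N -> C j = setT by rewrite /C; case: eqP => // _; exact: BK.
  rewrite m2E.
  have -> : (fun z : angles R * measurableTypeR R => upd z.1 t z.2) @^-1` box B = (box C : set (angles R)) `*` B t.
    apply/seteqP; split=> -[th x] /=.
      move=> H; split; last by have := H t; rewrite /upd eqxx.
      by move=> j; have := H j; rewrite /upd /C; case: eqP.
    move=> [H1 H2] j; have := H1 j; rewrite /upd /C; case: eqP => // -> _; exact: H2.
  rewrite (product_measure1E L mu (measurable_box mC CK) (mB t)).
  apply: etrans (Lbox mB BK) _.
  suff -> : (\prod_(j <- iota 0 K) mu (B j) = (\prod_(j <- iota 0 K) mu (C j)) * mu (B t))%E.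
    by rewrite -(Lbox mC CK).
  have tK : t \in iota 0 K by rewrite mem_iota leq0n add0n leq_maxr.
  rewrite (perm_big _ (perm_to_rem tK)) big_cons [X in _ = (X * _)%E](perm_big _ (perm_to_rem tK)) big_cons /=.
  rewrite {1}/C eqxx probability_setT mul1e muleC; congr (_ * _)%E.
  rewrite big_seq [RHS]big_seq; apply: eq_bigr => j.
  by rewrite mem_rem_uniq ?iota_uniq// inE /C => /andP[/negbTE -> _].
- by move=> k; rewrite (le_lt_trans (probability_le1 _ _))// ltry.
Qed.

Lemma resample_integral t (f : angles R -> \bar R) : measurable_fun setT f ->
  (forall th, 0 <= f th)%E ->
  (\int[L]_th f th = \int[L]_th \int[mu]_x f (upd th t x))%E.
Proof.
move=> mf f0; have mt := measurable_upd t.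
pose m : {measure set (angles R) -> \bar R} :=
  pushforward (L \x mu)%E (fun z : angles R * measurableTypeR R => upd z.1 t z.2).
rewrite (eq_measure_integral (m mt)); last first.
  by move=> A mA _; exact: resample_measure.
transitivity (\int[(L \x mu)%E]_z (f (upd z.1 t z.2)))%E.
  have f0' : {in [set: angles R], forall y, (0 <= f y)%E} by move=> th _; exact: f0.
  by have := ge0_integral_pushforward mt (L \x mu)%E measurableT mf f0'; rewrite preimage_setT.
rewrite fubini_tonelli1//; exact: measurableT_comp mf mt.
Qed.

(** A version of the conditional expectation given the angles from [t] on, defined at every sequence
    and not merely almost everywhere. The latest angle is the outermost integral, so an induction on
    [t] removes angles backwards in time. *)
Fixpoint iter_resample (t : nat) (f : angles R -> \bar R) (th : angles R) : \bar R :=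
  if t is t'.+1 then (\int[mu]_x iter_resample t' f (upd th t' x))%E else f th.

Lemma iter_resample_ge0 t f th : (forall th, 0 <= f th)%E -> (0 <= iter_resample t f th)%E.
Proof. by move=> f0; elim: t th => [|t IH] th //=; exact: integral_ge0. Qed.

Lemma measurable_iter_resample t f : measurable_fun setT f -> (forall th, 0 <= f th)%E ->
  measurable_fun setT (iter_resample t f).
Proof.
move=> mf f0; elim: t => [//|t IH].
apply: (@measurable_fun_fubini_tonelli_F _ _ _ _ _ mu
  (fun z : angles R * measurableTypeR R => iter_resample t f (upd z.1 t z.2))).
  exact: measurableT_comp IH (measurable_upd t).
by move=> z; exact: iter_resample_ge0.
Qed.

Lemma integral_iter_resample t f : measurable_fun setT f -> (forall th, 0 <= f th)%E ->
  (\int[L]_th f th = \int[L]_th iter_resample t f th)%E.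
Proof.
move=> mf f0; elim: t => [//|t IH]; rewrite IH (@resample_integral t)//.
  exact: measurable_iter_resample.
by move=> th; exact: iter_resample_ge0.
Qed.

Lemma iter_resample_le t f th (g : R -> R) : measurable_fun setT f -> (forall th, 0 <= f th)%E ->
  measurable_fun setT g ->
  (forall x, iter_resample t f (upd th t x) <= (g x)%:E)%E ->
  (iter_resample t.+1 f th <= \int[mu]_x (g x)%:E)%E.
Proof.
move=> mf f0 mg fg; apply: ge0_le_integral => //.
- by move=> x _; exact: iter_resample_ge0.
- apply: measurableT_comp (measurable_upd1 t th).
  exact: measurable_iter_resample.
- exact/measurable_EFinP.
Qed.

Lemma iter_resample_le_cst t (f : angles R -> \bar R) (th : angles R) (c : R) : measurable_fun setT f -> (forall th, 0 <= f th)%E ->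
  (forall th' : angles R, (forall j, (t <= j)%N -> th' j = th j) -> (f th' <= c%:E)%E) ->
  (iter_resample t f th <= c%:E)%E.
Proof.
move=> mf f0; elim: t th => [|t IH] th fc; first exact: fc.
apply: (@le_trans _ _ (\int[mu]_x (cst c%:E x))%E).
  apply: (@iter_resample_le t f th (cst c)) => // x; apply: IH => th' th'E; apply: fc => j tj.
  by rewrite th'E 1?ltnW// /upd gtn_eqF.
by rewrite integral_cst//= [X in (_ * X)%E]probability_setT mule1.
Qed.

Lemma law_le_iter_resample t (D : set (angles R)) (c : R) : measurable D ->
  (forall th, iter_resample t (fun th => (\1_D th)%:E) th <= c%:E)%E -> (L D <= c%:E)%E.
Proof.
move=> mD Dc.
have mf : measurable_fun setT (fun th => (\1_D th)%:E : \bar R).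
  exact/measurable_EFinP/measurable_indic.
have f0 th : (0 <= (\1_D th)%:E :> \bar R)%E by rewrite lee_fin.
rewrite -[X in L X]setIT -integral_indic// (integral_iter_resample t)//.
apply: (@le_trans _ _ (\int[L]_x (cst c%:E x))%E).
  apply: ge0_le_integral => //.
  - by move=> x _; exact: iter_resample_ge0.
  - exact: measurable_iter_resample.
by rewrite integral_cst//= [X in (_ * X)%E]probability_setT mule1.
Qed.

End AngleSpace.

(** * Anticoncentration of one entry *)

Section Anticoncentration.
Context {R : realType} {n : nat}.
Implicit Types (p : 'I_n * 'I_n) (y : 'M[R]_n).

Notation mu := (uniform_prob (@two_pi_gt0 R)).

Definition conj_step p (t : R) y := (rotation p t)^T *m y *m rotation p t.

(** Carries [y] backwards from time [s + j] to time [s]; the latest rotation acts first. *)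
Fixpoint conj_walk (w : nat -> 'I_n * 'I_n) (s j : nat) (th : nat -> R) y : 'M[R]_n :=
  if j is j'.+1 then conj_walk w s j' th (conj_step (w j') (th (s + j')%N) y) else y.

(* A weight [a x z = 0] means that the site [(x, z)] is not linked to the target yet. *)
Definition spread p (a : 'I_n -> 'I_n -> nat) : 'I_n -> 'I_n -> nat := fun x z =>
  if hits p x z then (2 * (if a x z != 0 then a x z else a (swap p x) (swap p z)))%N else a x z.

(** Built forward from the target at the start of the window, whereas [conj_walk] descends from its
    end: after [j] steps, the weight of a site is the cost of controlling the target entry at time
    [s] by the entry of that site at time [s + j]. *)
Fixpoint weights (tgt : 'I_n * 'I_n) (w : nat -> 'I_n * 'I_n) (j : nat) : 'I_n -> 'I_n -> nat :=
  if j is j'.+1 then spread (w j') (weights tgt w j')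
  else fun x z => ((x, z) == tgt) || ((z, x) == tgt).

Lemma tr_conj_step p t y : y^T = - y -> (conj_step p t y)^T = - conj_step p t y.
Proof. by move=> yT; rewrite /conj_step !trmx_mul trmxK yT mulNmx mulmxN mulmxA. Qed.

Lemma regpow_ge0 (e y : R) : 0 <= regpow e y.
Proof. exact: powR_ge0. Qed.

Lemma regpow_antitone (e x y : R) : 0 < e -> x ^+ 2 <= y ^+ 2 -> regpow e y <= regpow e x.
Proof.
move=> e0 xy; rewrite /regpow !powRN lef_pV2 ?posrE ?powR_gt0 ?ltr_wpDl ?sqr_ge0//.
apply: ge0_ler_powR; rewrite ?invr_ge0// ?nnegrE ?addr_ge0 ?sqr_ge0 ?(ltW e0)//.
by rewrite lerD2r.
Qed.

Lemma integral_regpow_conj_step p y x z e C : p.1 != p.2 -> y^T = - y -> x != z ->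
  0 < e -> hits p x z -> C = y x z \/ C = y (swap p x) (swap p z) ->
  (\int[mu]_t (regpow e (conj_step p t y x z))%:E <= (2 * regpow e C)%:E)%E.
Proof.
move=> p12 yT xz e0 h CE; set s : R := (-1) ^+ ((x == p.1) || (z == p.1)).
under eq_integral => t _ do rewrite /conj_step rotation_conjE// h -/s -mulrA [s * _]mulrCA [cos t * _]mulrC.
have s2 : s ^+ 2 = 1 by rewrite /s sqrr_sign.
under eq_integral => t _ do rewrite [sin t * _]mulrC.
apply: integral_regpow_lin => //; rewrite exprMn s2 mul1r.
by case: CE => ->; [rewrite lerDl | rewrite lerDr]; exact: sqr_ge0.
Qed.

Lemma measurable_regpow_conj_step p y x z e : p.1 != p.2 -> y^T = - y -> x != z -> 0 < e ->
  measurable_fun [set: R] (fun t => regpow e (conj_step p t y x z)).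
Proof.
move=> p12 yT xz e0; case h : (hits p x z); last first.
  under eq_fun => t do rewrite /conj_step rotation_conjE// h.
  exact: measurable_cst.
set s : R := (-1) ^+ ((x == p.1) || (z == p.1)).
have -> : (fun t => regpow e (conj_step p t y x z)) =
    (fun t => (((y x z) * cos t + (s * y (swap p x) (swap p z)) * sin t) ^+ 2 + e) `^ (- 4^-1)).
  by apply/funext => t; rewrite /conj_step rotation_conjE// h -/s /regpow mulrC mulrAC.
by apply: continuous_measurable_fun; exact: continuous_regpow_lin.
Qed.

Lemma hits_swap_neq p x z : x != z -> swap p x != swap p z.
Proof. by rewrite /swap (inj_eq perm_inj). Qed.

Lemma swapK p x : swap p (swap p x) = x. Proof. exact: tpermK. Qed.

Lemma on_plane_swap p x : on_plane p (swap p x) = on_plane p x.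
Proof.
rewrite /on_plane /swap; case: tpermP => [->|->|/eqP/negbTE-> /eqP/negbTE->//].
  by rewrite !eqxx orbT.
by rewrite !eqxx orbT.
Qed.

Lemma hits_swap p x z : hits p (swap p x) (swap p z) = hits p x z.
Proof. by rewrite /hits !on_plane_swap. Qed.

(** For [j = 0] this is Markov's inequality: where the target entry is below [eps], the indicator is
    at most $g(y_{xz})/g(\varepsilon)$. Each further step integrates the latest angle: an entry that
    is not hit is unchanged, and a hit costs the factor 2 of the averaging inequality. *)
Lemma iter_resample_small (D : set (angles R)) (tgt : 'I_n * 'I_n) (w : nat -> 'I_n * 'I_n)
    (s j : nat) (eps : R) (th : angles R) y :
  measurable D -> (forall i, (w i).1 != (w i).2) -> 0 < eps -> y^T = - y ->
  (forall th' : angles R, D th' -> (forall i, (s + j <= i)%N -> th' i = th i) ->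
     `|conj_walk w s j th' y tgt.1 tgt.2| < eps) ->
  forall x z, x != z -> weights tgt w j x z != 0 ->
  (iter_resample (s + j) (fun th => (\1_D th)%:E) th <=
    ((weights tgt w j x z)%:R * (regpow (eps ^+ 2) (y x z) / regpow (eps ^+ 2) eps))%:E)%E.
Proof.
move=> mD w12 eps0 yT.
have mf : measurable_fun setT (fun th : angles R => (\1_D th)%:E : \bar R).
  exact/measurable_EFinP/measurable_indic.
have f0 (u : angles R) : (0 <= (\1_D u)%:E :> \bar R)%E by rewrite lee_fin.
have e0 : 0 < eps ^+ 2 by rewrite exprn_gt0.
set e := eps ^+ 2 in e0 *.
have r0 : 0 < regpow e eps by rewrite powR_gt0// addr_gt0.
elim: j th y yT => [|j IH] th y yT Dsmall x z xz axz.
  rewrite addn0 in Dsmall *; apply: iter_resample_le_cst => // th' th'E.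
  have axz1 : weights tgt w 0 x z = 1%N by move: axz => /=; case: (_ || _).
  rewrite lee_fin indicE axz1 mul1r; case: (boolP (th' \in D)) => [|_] /=; last first.
    by rewrite divr_ge0 ?regpow_ge0// ltW.
  rewrite inE => Dth'; have /= := Dsmall _ Dth' th'E.
  rewrite ler_pdivlMr// mul1r => ye.
  apply: regpow_antitone => //; rewrite -[leLHS]real_normK ?num_real//.
  rewrite ler_pXn2r ?nnegrE ?(ltW eps0)//; apply: le_trans (ltW ye).
  move: axz => /=; case: ((x, z) =P tgt) => [<-//|_] /=; case: ((z, x) =P tgt) => [<- _ /=|//].
  by rewrite -[y in leLHS]opprK -yT !mxE normrN.
have step x' z' : x' != z' -> weights tgt w j x' z' != 0 ->
    (iter_resample (s + j.+1) (fun th => (\1_D th)%:E) th <=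
    \int[mu]_t ((weights tgt w j x' z')%:R *
       (regpow e (conj_step (w j) t y x' z') / regpow e eps))%:E)%E.
  move=> xz' axz'; rewrite addnS; apply: iter_resample_le => //.
    apply: measurable_funM => //; apply: measurable_funM => //.
    exact: measurable_regpow_conj_step.
  move=> t; apply: IH => //; first exact: tr_conj_step.
  move=> th' Dth' th'E.
  have := Dsmall th' Dth'; rewrite /= th'E// /upd eqxx; apply=> i si.
  by rewrite th'E /upd ?gtn_eqF// -?addnS// ltnW// -addnS.
have intE x' z' (k : R) : 0 <= k -> x' != z' ->
   (\int[mu]_t (k * (regpow e (conj_step (w j) t y x' z') / regpow e eps))%:E =
    (k / regpow e eps)%:E * \int[mu]_t (regpow e (conj_step (w j) t y x' z'))%:E)%E.
  move=> k0 xz'; rewrite -ge0_integralZl_EFin//.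
  - by apply: eq_integral => t _; rewrite -EFinM mulrA mulrAC.
  - by move=> t _; rewrite lee_fin regpow_ge0.
  - by apply/measurable_EFinP; exact: measurable_regpow_conj_step.
  - by rewrite divr_ge0// ltW.
move: axz; rewrite /= /spread; case: ifPn => [h|h] axz; last first.
  apply: le_trans (step _ _ xz axz) _.
  under eq_integral => t _ do rewrite /conj_step rotation_conjE// (negbTE h).
  by rewrite integral_cst//= [X in (_ * X)%E]probability_setT mule1.
set a := if _ then _ else _ in axz *.
have {axz} a0 : a != 0 by move: axz; rewrite muln_eq0.
have bound x' z' : x' != z' -> a = weights tgt w j x' z' -> hits (w j) x' z' ->
    (y x z = y x' z' \/ y x z = y (swap (w j) x') (swap (w j) z')) ->
    (iter_resample (s + j.+1) (fun th => (\1_D th)%:E) th <=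
     ((2 * a)%:R * (regpow e (y x z) / regpow e eps))%:E)%E.
  move=> xz' aE h' yE; apply: le_trans (step _ _ xz' _) _; first by rewrite -aE.
  rewrite intE// -aE; apply: (@le_trans _ _ ((a%:R / regpow e eps)%:E * (2 * regpow e (y x z))%:E)%E).
    apply: lee_wpmul2l; first by rewrite lee_fin divr_ge0// ltW.
    exact: integral_regpow_conj_step.
  rewrite -EFinM lee_fin (_ : (2 * a)%:R * _ = a%:R / regpow e eps * (2 * regpow e (y x z)))//.
  by rewrite natrM; ring.
(* The induction hypothesis is used at whichever of $(x,z)$ and its partner is linked; after
   averaging, both admit [y x z] as reference. *)
case axz : (weights tgt w j x z != 0).
  by apply: (bound x z) => //; [rewrite /a axz | left].
apply: (bound (swap (w j) x) (swap (w j) z)); rewrite ?hits_swap ?hits_swap_neq//.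
  by rewrite /a axz.
by right; rewrite !swapK.
Qed.

End Anticoncentration.

(** * Spreading of the weights *)

Section SpreadingCombinatorics.
Local Open Scope nat_scope.
Context {n : nat}.
Implicit Types (p : 'I_n * 'I_n) (a : 'I_n -> 'I_n -> nat).

Definition symm a := forall x z, a x z = a z x.

Lemma hitsC p x z : hits p x z = hits p z x. Proof. by rewrite /hits addbC. Qed.

Lemma spread_symm p a : symm a -> symm (spread p a).
Proof. by move=> sa x z; rewrite /spread hitsC (sa x z) (sa (swap p x)). Qed.

Definition mass a := \sum_(x : 'I_n) \sum_(z : 'I_n | x != z) a x z.
Definition supp_size a := \sum_(x : 'I_n) \sum_(z : 'I_n | x != z) (a x z != 0 : nat).

Lemma swap_inj p : injective (swap p).
Proof. exact: perm_inj. Qed.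

Lemma sum_swap p (F : 'I_n -> 'I_n -> nat) :
  \sum_(x : 'I_n) \sum_(z : 'I_n | x != z) F (swap p x) (swap p z) =
  \sum_(x : 'I_n) \sum_(z : 'I_n | x != z) F x z.
Proof.
rewrite [RHS](reindex_inj (@swap_inj p)); apply: eq_bigr => x _.
rewrite [RHS](reindex_inj (@swap_inj p)); apply: eq_bigl => z.
by rewrite (inj_eq (@swap_inj p)).
Qed.

Lemma sum_mask p (F : 'I_n -> 'I_n -> nat) :
  \sum_(x : 'I_n) \sum_(z : 'I_n | x != z) hits p x z * F (swap p x) (swap p z) =
  \sum_(x : 'I_n) \sum_(z : 'I_n | x != z) hits p x z * F x z.
Proof.
rewrite -(sum_swap p (fun x z => hits p x z * F x z)).
by apply: eq_bigr => x _; apply: eq_bigr => z _; rewrite hits_swap.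
Qed.

(** A hit site gains at most its own weight plus twice that of its partner; partners permute the hit
    sites, whence the factor 3. *)
Lemma mass_spread p a : mass (spread p a) <=
  mass a + 3 * \sum_(x : 'I_n) \sum_(z : 'I_n | x != z) hits p x z * a x z.
Proof.
have -> : 3 * \sum_(x : 'I_n) \sum_(z : 'I_n | x != z) hits p x z * a x z =
    \sum_(x : 'I_n) \sum_(z : 'I_n | x != z) hits p x z * a x z +
    2 * \sum_(x : 'I_n) \sum_(z : 'I_n | x != z) hits p x z * a (swap p x) (swap p z).
  by rewrite sum_mask; lia.
rewrite big_distrr -!big_split /=; apply: leq_sum => x _.
rewrite big_distrr -!big_split /=; apply: leq_sum => z _.
rewrite /spread; case: ifP => _ /=; last by lia.
by case: eqP => /= [->|_]; lia.
Qed.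

Variables (N : nat) (pl : 'I_N -> 'I_n * 'I_n).
Hypothesis pl_inj : injective pl.
Hypothesis pl_im : forall p : 'I_n * 'I_n, (exists i, pl i = p) <-> (p.1 < p.2).

Lemma plane_sum (F : 'I_n * 'I_n -> nat) : (forall k l, F (k, l) = F (l, k)) ->
  2 * \sum_i F (pl i) = \sum_(k : 'I_n) \sum_(l : 'I_n | k != l) F (k, l).
Proof.
move=> sF; have -> : \sum_i F (pl i) = \sum_(p : 'I_n * 'I_n | p.1 < p.2) F p.
  have E : (fun p : 'I_n * 'I_n => p.1 < p.2) =1 (fun p => p \in pl @: predT).
    move=> p; apply/idP/imsetP => [/pl_im[i <-]|[i _ ->]]; first by exists i; rewrite ?inE.
    by apply/pl_im; exists i.
  rewrite (eq_bigl _ _ E) big_imset /=; last by move=> ? ? _ _; exact: pl_inj.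
  by apply: eq_bigl.
rewrite mul2n -addnn.
have E1 : \sum_(p : 'I_n * 'I_n | p.1 < p.2) F p = \sum_(k : 'I_n) \sum_(l : 'I_n | k < l) F (k, l).
  by rewrite pair_big_dep /=; apply: eq_big => [[k l]|[k l] _].
rewrite E1 [X in _ + X](exchange_big_dep predT)//= -big_split /=; apply: eq_bigr => k _.
rewrite [RHS](bigID (fun l : 'I_n => k < l)) /=; congr (_ + _).
  by apply: eq_bigl => l; rewrite andb_idl// => kl; rewrite -val_eqE /= neq_ltn kl.
apply: eq_big => [l|l _]; last exact: sF.
by rewrite -val_eqE /= -leqNgt ltn_neqAle eq_sym.
Qed.

Lemma card_neq (x : 'I_n) : \sum_(l : 'I_n | x != l) 1 = n.-1.
Proof.
have := cardC (pred1 x); rewrite card1 card_ord add1n => /(congr1 predn) /= <-.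
by rewrite sum1_card; apply: eq_card => l; rewrite !inE eq_sym.
Qed.

Lemma two_planes : 2 * N = n * n.-1.
Proof.
have := @plane_sum (fun=> 1) (fun _ _ => erefl).
rewrite sum1_card card_ord => ->.
by under eq_bigr => k _ do rewrite card_neq; rewrite sum_nat_const card_ord.
Qed.

Lemma hits_sym (k l x z : 'I_n) : hits (k, l) x z = hits (l, k) x z :> bool.
Proof. by rewrite /hits /on_plane /= ![(x == k) || _]orbC ![(z == k) || _]orbC. Qed.

Lemma swap_sym (k l x : 'I_n) : swap (k, l) x = swap (l, k) x.
Proof. by rewrite /swap /= tpermC. Qed.

Lemma sum_hits x z : \sum_i (hits (pl i) x z : nat) <= 2 * n.-1.
Proof.
suff : \sum_(k : 'I_n) \sum_(l : 'I_n | k != l) (hits (k, l) x z : nat) <= 4 * n.-1.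
  rewrite -(@plane_sum (fun p => hits p x z : nat)); first lia.
  by move=> k l; rewrite hits_sym.
have S1 (c : 'I_n) : \sum_(k : 'I_n) \sum_(l : 'I_n | k != l) (k == c : nat) = n.-1.
  rewrite (bigD1 c)//= [X in _ + X]big1 => [|k kc]; last by rewrite (negbTE kc) big1.
  by rewrite addn0 eqxx card_neq.
have S2 (c : 'I_n) : \sum_(k : 'I_n) \sum_(l : 'I_n | k != l) (l == c : nat) = n.-1.
  rewrite (exchange_big_dep predT)//= -(S1 c); apply: eq_bigr => k _.
  by apply: eq_bigl => l; rewrite eq_sym.
apply: (@leq_trans (\sum_(k : 'I_n) \sum_(l : 'I_n | k != l)
    ((k == x) + (k == z) + (l == x) + (l == z)))).
  apply: leq_sum => k _; apply: leq_sum => l _.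
  rewrite /hits /on_plane /= ![x == _]eq_sym ![z == _]eq_sym.
  by do 4 case: eqP => _ //=.
under eq_bigr => k _ do rewrite !big_split /=.
by rewrite !big_split /= !S1 !S2; lia.
Qed.

(** A site is hit by at most $2(n-1)$ of the planes. After division by $N=n(n-1)/2$, the term
    $6(n-1)$ becomes the rate $12/n$. *)
Lemma sum_mass_spread a : \sum_i mass (spread (pl i) a) <= (N + 6 * n.-1) * mass a.
Proof.
apply: (@leq_trans (\sum_i (mass a + 3 * \sum_(x : 'I_n) \sum_(z : 'I_n | x != z) hits (pl i) x z * a x z))).
  by apply: leq_sum => i _; exact: mass_spread.
rewrite big_split /= sum_nat_const card_ord mulnDl leq_add2l -big_distrr /=.
rewrite (_ : 6 * _ * _ = 3 * (2 * n.-1 * mass a)); last by lia.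
rewrite leq_mul2l /= /mass big_distrr /= exchange_big /=.
apply: leq_sum => x _; rewrite big_distrr /= exchange_big /=.
by apply: leq_sum => z _; rewrite -big_distrl /= leq_mul2r sum_hits orbT.
Qed.

Definition boundary (f : 'I_n -> 'I_n -> bool) :=
  \sum_(x : 'I_n) \sum_(b : 'I_n | x != b) \sum_(c : 'I_n | x != c) (f x b && ~~ f x c : nat).

(* A pair [(x, z)] with [f] and a pair [(c, d)] without [f] are joined by the path
   [(x, z), (x, c), (c, d)], one step of which leaves [f]. *)
Lemma isoperimetry (f : 'I_n -> 'I_n -> bool) : (forall x z, f x z = f z x) ->
  (\sum_(x : 'I_n) \sum_(z : 'I_n | x != z) (f x z : nat)) *
  (\sum_(x : 'I_n) \sum_(z : 'I_n | x != z) (~~ f x z : nat)) <= (2 * n.-1 + 1) * boundary f.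
Proof.
move=> fC.
rewrite big_distrl /=.
(* For $c=x$ the middle point $(x,c)$ is not a site, and the path is the single step from $(x,z)$ to
   $(x,d)$; this accounts for the [+ 1] in the constant. *)
apply: (@leq_trans (\sum_(x : 'I_n) \sum_(c : 'I_n) \sum_(z : 'I_n | x != z) \sum_(d : 'I_n | c != d)
   ((x == c) * (f x z && ~~ f x d) + (x != c) * ((f x z && ~~ f x c) + (f c x && ~~ f c d))))).
  apply: leq_sum => x _; rewrite big_distrr /=; apply: leq_sum => c _.
  rewrite big_distrl /=; apply: leq_sum => z xz; rewrite big_distrr /=; apply: leq_sum => d cd.
  case: eqP => [<-|_] /=; rewrite ?mul1n ?addn0.
    by case: (f x z); case: (f x d).
  by rewrite (fC c x); case: (f x z); case: (f x c); case: (f c d).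
rewrite mulnDl mul1n addnC.
rewrite (eq_bigr (fun x => \sum_(z | x != z) \sum_(d | x != d) (f x z && ~~ f x d : nat) +
   \sum_(c | x != c) \sum_(z | x != z) \sum_(d | c != d) ((f x z && ~~ f x c) + (f c x && ~~ f c d)))).
  rewrite big_split /= leq_add2l.
  rewrite (eq_bigr (fun x => \sum_(c | x != c) \sum_(z | x != z) \sum_(d | c != d) (f x z && ~~ f x c : nat) +
     \sum_(c | x != c) \sum_(z | x != z) \sum_(d | c != d) (f c x && ~~ f c d : nat))); last first.
    move=> x _; rewrite -big_split /=; apply: eq_bigr => c _; rewrite -big_split /=; apply: eq_bigr => z _.
    by rewrite -big_split.
  rewrite big_split /= mul2n -addnn mulnDl; apply: leq_add.
    rewrite /boundary big_distrr /=; apply: leq_sum => x _.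
    rewrite exchange_big /= big_distrr /=; apply: leq_sum => b _.
    rewrite big_distrr /=; apply: leq_sum => c _.
    by rewrite -(card_neq c) big_distrl /=; apply: leq_sum => d _; rewrite mul1n.
  rewrite /boundary (exchange_big_dep predT)//= big_distrr /=; apply: leq_sum => c _.
  rewrite big_distrr /= [X in _ <= X](eq_bigl (fun x => x != c)); last by move=> x; rewrite eq_sym.
  apply: leq_sum => x xc; rewrite -(card_neq x) big_distrl /=; apply: leq_sum => z _.
  by rewrite mul1n.
move=> x _; rewrite (bigD1 x)//= eqxx; congr (_ + _).
  by apply: eq_bigr => z _; apply: eq_bigr => d _; rewrite mul1n addn0.
apply: eq_big => [c|c]; first by rewrite eq_sym.
rewrite eq_sym => xc; apply: eq_bigr => z _; apply: eq_bigr => d _.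
by rewrite (negbTE xc) mul1n.
Qed.

Lemma supp_size_le a : supp_size a <= n * n.-1.
Proof.
rewrite -[n in n * _]card_ord -sum_nat_const; apply: leq_sum => x _.
by rewrite -(card_neq x); apply: leq_sum => z _; exact: leq_b1.
Qed.

Definition new_sites p a := \sum_(x : 'I_n) \sum_(z : 'I_n | x != z)
  hits p x z * ((a x z == 0) && (a (swap p x) (swap p z) != 0)).

Lemma supp_size_spread p a : supp_size (spread p a) = supp_size a + new_sites p a.
Proof.
rewrite /supp_size /new_sites -big_split /=; apply: eq_bigr => x _.
rewrite -big_split /=; apply: eq_bigr => z _; rewrite /spread.
case: ifP => _; last by rewrite mul0n addn0.
by rewrite mul1n; case: (eqVneq (a x z) 0) => [->|a0] /=; rewrite muln_eq0 //= (negbTE a0).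
Qed.

(** Passing to the partner injects the new sites into the linked ones, so the support at most
    doubles. *)
Lemma new_sites_le p a : new_sites p a <= supp_size a.
Proof.
rewrite /new_sites.
have := sum_mask p (fun x z => (a (swap p x) (swap p z) == 0) && (a x z != 0)).
under eq_bigr => x _ do under eq_bigr => z _ do rewrite !swapK.
move=> ->; apply: leq_sum => x _; apply: leq_sum => z _.
by case: (hits p x z); case: (_ == 0); case: (_ == 0).
Qed.

Lemma sum_cond (P : pred 'I_n) (F : 'I_n -> nat) : \sum_(z | P z) F z = \sum_z P z * F z.
Proof. by rewrite big_mkcond; apply: eq_bigr => z _; case: (P z); rewrite /= ?mul1n ?mul0n. Qed.

Lemma sum_delta (k : 'I_n) (F : 'I_n -> nat) : \sum_x (x == k) * F x = F k.
Proof.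
rewrite (bigD1 k)//= eqxx mul1n big1 ?addn0// => x xk.
by rewrite (negbTE xk).
Qed.

(** The plane of axes $k,l$ links $(k,z)$ when $(l,z)$ is linked and $(k,z)$ is not, which is a
    boundary pair with common index $z$. The factor 2 accounts for the mirror site $(z,k)$. *)
Lemma sum_new_sites a : symm a ->
  \sum_i new_sites (pl i) a = 2 * boundary (fun x z => a x z != 0).
Proof.
move=> sa; apply/eqP; rewrite -(eqn_pmul2l (isT : 0 < 2)); apply/eqP.
rewrite (@plane_sum (fun p => new_sites p a)); last first.
  move=> k l; apply: eq_bigr => x _; apply: eq_bigr => z _.
  by rewrite hits_sym !(swap_sym k).
pose g k l z := (a k z == 0) && (a l z != 0).
(* Indicator that $(k,z)$ becomes linked through $(l,z)$; four terms of this kind cover the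
   positions of $k$ or $l$ in the pair $(x,z)$. *)
pose h k l z : nat := (k != z) * ((l != z) * g k l z).
have boundE : boundary (fun x z => a x z != 0) = \sum_k \sum_l \sum_z (k != l) * h k l z.
  rewrite /boundary [RHS]exchange_big /= [RHS](eq_bigr (fun l => \sum_z \sum_k (k != l) * h k l z)); last first.
    by move=> l _; rewrite exchange_big.
  rewrite [RHS]exchange_big /=; apply: eq_bigr => x _.
  rewrite sum_cond; apply: eq_bigr => b _; rewrite sum_cond big_distrr /=.
  apply: eq_bigr => c _; rewrite /h /g ![x == _]eq_sym negbK (sa x b) (sa x c).
  case: (c =P b) => [->|_] /=; last by rewrite mul1n [RHS]mulnCA [in RHS]andbC.
  by case: (a b x == 0); rewrite ?muln0.
rewrite boundE; transitivity (\sum_(k : 'I_n) \sum_(l : 'I_n) (k != l) * (\sum_(x : 'I_n) \sum_(z : 'I_n)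
    ((x == k) * h k l z + (x == l) * h l k z + ((z == k) * h k l x + (z == l) * h l k x)))).
  apply: eq_bigr => k _; rewrite sum_cond; apply: eq_bigr => l _.
  case: (k =P l) => //= kl; rewrite !mul1n; apply: eq_bigr => x _; rewrite sum_cond.
  apply: eq_bigr => z _; rewrite /h /g /hits /on_plane /swap /=.
  have {}kl : k != l by apply/eqP.
  have lk : l != k by rewrite eq_sym.
  have [->|xk] := eqVneq x k.
    rewrite tpermL (negbTE kl) /=.
    have [->|zk] := eqVneq z k; first by rewrite ?eqxx /= (negbTE kl) !muln0.
    have [->|zl] := eqVneq z l; first by rewrite ?eqxx ?kl ?lk ?(negbTE kl) /= !(mul0n, muln0).
    have -> : tperm k l z = z by rewrite tpermD// eq_sym.
    by rewrite /= !(mul1n, mul0n, addn0, add0n).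
  have [->|xl] := eqVneq x l.
    rewrite tpermR /=.
    have [->|zk] := eqVneq z k; first by rewrite ?eqxx (negbTE kl) ?lk /= !(mul0n, muln0).
    have [->|zl] := eqVneq z l; first by rewrite ?eqxx /= !(mul0n, muln0).
    have -> : tperm k l z = z by rewrite tpermD// eq_sym.
    by rewrite /= !(mul1n, mul0n, addn0, add0n).
  have [->|zk] := eqVneq z k.
    have -> : tperm k l x = x by rewrite tpermD// eq_sym.
    rewrite tpermL (sa x k) (sa x l) /= ?[k == x]eq_sym ?[l == x]eq_sym ?xk ?xl /=.
    by rewrite ?(negbTE kl) !(mul1n, mul0n, addn0, add0n).
  have [->|zl] := eqVneq z l.
    have -> : tperm k l x = x by rewrite tpermD// eq_sym.
    rewrite tpermR (sa x k) (sa x l) /= ?[k == x]eq_sym ?[l == x]eq_sym ?xk ?xl /=.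
    by rewrite !(mul1n, mul0n, addn0, add0n).
  by rewrite /= !(mul0n, muln0).
rewrite (eq_bigr (fun k => \sum_l (k != l) * (\sum_z h k l z + \sum_z h l k z + (\sum_z h k l z + \sum_z h l k z)))).
  rewrite (eq_bigr (fun k => 2 * (\sum_l (k != l) * \sum_z h k l z) + 2 * (\sum_l (k != l) * \sum_z h l k z))).
    rewrite big_split /= -!big_distrr /= [X in _ + 2 * X]exchange_big /=.
    rewrite [X in _ + 2 * X](eq_bigr (fun k => \sum_l (k != l) * \sum_z h k l z)); last first.
      by move=> k _; apply: eq_bigr => l _; rewrite eq_sym.
    rewrite -mulnDr addnn -mul2n; congr (2 * (2 * _)); apply: eq_bigr => k _; apply: eq_bigr => l _.
    by rewrite big_distrr.
  move=> k _; rewrite !big_distrr -big_split /=; apply: eq_bigr => l _; lia.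
move=> k _; apply: eq_bigr => l _; congr (_ * _).
rewrite (eq_bigr (fun x : 'I_n => (\sum_z (x == k) * h k l z + \sum_z (x == l) * h l k z) +
  (\sum_z (z == k) * h k l x + \sum_z (z == l) * h l k x))); last first.
  by move=> x _; rewrite -!big_split.
rewrite !big_split /=; congr (_ + _ + (_ + _)).
- by under eq_bigr => x _ do rewrite -big_distrr /=; rewrite sum_delta.
- by under eq_bigr => x _ do rewrite -big_distrr /=; rewrite sum_delta.
- by apply: eq_bigr => x _; rewrite sum_delta.
- by apply: eq_bigr => x _; rewrite sum_delta.
Qed.

End SpreadingCombinatorics.

(** * Expected growth of support and weights under uniform planes *)

Section SpreadingBound.
Context {R : realType} {n N : nat} (pl : 'I_N -> 'I_n * 'I_n).
Hypothesis n2 : (2 <= n)%N.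
Hypothesis pl_inj : injective pl.
Hypothesis pl_im : forall p : 'I_n * 'I_n, (exists i, pl i = p) <-> (p.1 < p.2)%N.
Implicit Types (a : 'I_n -> 'I_n -> nat) (Phi : ('I_n -> 'I_n -> nat) -> R).

(** Expectation of [Phi] after [L] independent uniform planes, as a finite sum; [bad_window_prob]
    identifies it with a probability. *)
Fixpoint avg (L : nat) Phi a : R :=
  if L is L'.+1 then N%:R^-1 * \sum_i avg L' Phi (spread (pl i) a) else Phi a.

Definition live a := symm a /\ (0 < supp_size a)%N.

Lemma live_spread p a : live a -> live (spread p a).
Proof.
move=> [sa a0]; split; first exact: spread_symm.
by rewrite supp_size_spread ltn_addr.
Qed.

Lemma N_gt0 : (0 < N)%N.
Proof. by have := two_planes pl_inj pl_im; case: N => //; case: (n) n2 => [|[]]. Qed.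

Lemma avg_le L Phi Psi a : live a -> (forall a, live a -> Phi a <= Psi a) ->
  avg L Phi a <= avg L Psi a.
Proof.
move=> la PP; elim: L a la => [|L IH] a la /=; first exact: PP.
rewrite ler_wpM2l ?invr_ge0 ?ler0n//; apply: ler_sum => i _.
by apply: IH; exact: live_spread.
Qed.

Lemma avg_lin L (c d : R) Phi Psi a :
  avg L (fun a => c * Phi a + d * Psi a) a = c * avg L Phi a + d * avg L Psi a.
Proof.
elim: L a => [//|L IH] a /=.
rewrite (eq_bigr (fun i => c * avg L Phi (spread (pl i) a) + d * avg L Psi (spread (pl i) a))).
  by rewrite big_split /= -!mulr_sumr; ring.
by move=> i _; exact: IH.
Qed.

Lemma avg_geometric L Phi a (c : R) : 0 <= c -> live a ->
  (forall a, live a -> \sum_i Phi (spread (pl i) a) <= N%:R * (c * Phi a)) ->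
  avg L Phi a <= c ^+ L * Phi a.
Proof.
move=> c0 la H; elim: L a la => [|L IH] a la /=; first by rewrite mul1r.
rewrite ler_pdivrMl ?ltr0n ?N_gt0//.
apply: (@le_trans _ _ (\sum_i c ^+ L * Phi (spread (pl i) a))).
  by apply: ler_sum => i _; apply: IH; exact: live_spread.
rewrite -mulr_sumr exprSr -mulrA mulrCA ler_wpM2l ?exprn_ge0//.
exact: H.
Qed.

Lemma realN : N%:R = (n%:R * (n.-1)%:R) / 2 :> R.
Proof.
by rewrite -natrM -(two_planes pl_inj pl_im) natrM mulrAC divff ?mul1r// pnatr_eq0.
Qed.

Let n1_gt0 : 0 < (n.-1)%:R :> R.
Proof. by rewrite ltr0n; case: (n) n2 => [|[]]. Qed.

Let n_gt0 : 0 < n%:R :> R.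
Proof. by rewrite ltr0n; case: (n) n2. Qed.

Lemma mass_growth a : \sum_i (mass (spread (pl i) a))%:R <= N%:R * ((1 + 12 / n%:R) * (mass a)%:R) :> R.
Proof.
rewrite -natr_sum; have := sum_mass_spread pl_inj pl_im a.
rewrite -(ler_nat R) natrM natrD => /le_trans; apply.
rewrite mulrA ler_wpM2r ?ler0n// mulrDr mulr1 lerD2l realN natrM.
rewrite le_eqVlt; apply/orP; left; apply/eqP; field; exact: lt0r_neq0.
Qed.

(* Dividing by [supp_size a] rather than by [n * n.-1] makes the expected decay geometric
   from the first step on, when only two sites are linked. *)
Definition deficit a : R := ((n * n.-1)%N%:R - (supp_size a)%:R) / (supp_size a)%:R.

(** With $b$ linked sites, $D\le b$ new ones and $M=n(n-1)$, the deficit $M/b-1$ drops by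
    $MD/(b(b+D))\ge MD/(2b^2)$. The $D$ sum to twice the boundary, and isoperimetry bounds the
    boundary below by $b(M-b)/(2n-1)$, giving an average drop of at least the fraction $1/n$. *)
Lemma deficit_decay a : live a ->
  \sum_i deficit (spread (pl i) a) <= N%:R * ((1 - n%:R^-1) * deficit a).
Proof.
move=> [sa a0]; set b : R := (supp_size a)%:R; set M : R := (n * n.-1)%N%:R.
have b0 : 0 < b by rewrite ltr0n.
have bM : b <= M by rewrite ler_nat supp_size_le.
pose D i : R := (new_sites (pl i) a)%:R.
apply: (@le_trans _ _ (\sum_i (deficit a - M * D i / (2 * b ^+ 2)))).
  apply: ler_sum => i _; rewrite /deficit supp_size_spread natrD -/b -/(D i) -/M.
  have D0 : 0 <= D i by exact: ler0n.
  have Db : D i <= b by rewrite ler_nat new_sites_le.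
  have bD0 : 0 < b + D i by rewrite ltr_wpDr.
  rewrite ler_pdivrMr// -subr_ge0.
  have -> : ((M - b) / b - M * D i / (2 * b ^+ 2)) * (b + D i) - (M - (b + D i)) =
     M * D i * (b - D i) / (2 * b ^+ 2) by field; exact: lt0r_neq0.
  rewrite divr_ge0 ?mulr_ge0 ?subr_ge0 ?exprn_ge0 ?(ltW b0)//; exact: ler0n.
rewrite sumrB sumr_const card_ord -mulr_suml -mulr_sumr.
have -> : \sum_i D i = 2 * (boundary (fun x z => a x z != 0%N))%:R.
  by rewrite -natr_sum sum_new_sites// natrM.
set E : R := (boundary _)%:R.
have iso : b * (M - b) <= (2 * n%:R - 1) * E.
  have := @isoperimetry n (fun x z => a x z != 0%N).
  move=> /(_ _)/wrap[|]; first by move=> x z; rewrite sa.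
  rewrite -(ler_nat R) !natrM -/b -/E.
  have -> : (\sum_(x < n) \sum_(z < n | x != z) ~~ (a x z != 0))%N%:R = M - b :> R.
    have tot : (supp_size a + \sum_(x < n) \sum_(z < n | x != z) ~~ (a x z != 0))%N = (n * n.-1)%N.
      rewrite /supp_size -big_split /= (eq_bigr (fun=> n.-1)) ?sum_nat_const ?card_ord// => x _.
      rewrite -big_split /= -(card_neq x); apply: eq_bigr => z _.
      by case: (a x z == 0%N).
    by rewrite /M /b -tot natrD addrAC subrr add0r.
  have -> : (2 * n.-1 + 1)%N%:R = 2 * n%:R - 1 :> R.
    by case: (n) n2 => // k _; rewrite /= natrD natrM -[k.+1]addn1 natrD; lra.
  by [].
have E0 : 0 <= E by exact: ler0n.
have dE : deficit a = (M - b) / b by [].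
have MN : M = 2 * N%:R by rewrite realN /M natrM; field.
have key : (M - b) / b / n%:R <= 2 * E / b ^+ 2.
  rewrite -subr_ge0; have -> : 2 * E / b ^+ 2 - (M - b) / b / n%:R =
    (2 * n%:R * E - b * (M - b)) / (b ^+ 2 * n%:R) by field; rewrite !lt0r_neq0.
  rewrite divr_ge0 ?mulr_ge0 ?exprn_ge0 ?(ltW b0) ?ler0n//; lra.
rewrite -dE in key.
have N0 : 0 < N%:R :> R by rewrite ltr0n N_gt0.
have -> : M * (2 * E) / (2 * b ^+ 2) = N%:R * (2 * E / b ^+ 2).
  by rewrite MN; field; exact: lt0r_neq0.
rewrite -[_ *+ N]mulr_natl -mulrBr ler_pM2l// mulrBl mul1r lerD2l lerN2 mulrC.
exact: key.
Qed.

Definition good (K : R) a : bool :=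
  [forall x, forall z, (x != z) ==> ((a x z != 0%N) && ((a x z)%:R <= K))].

(** A missing site forces a deficit of at least $1/(n(n-1))$, and a weight above [K] forces the mass
    above [K]: both failures reduce to Markov's inequality. *)
Lemma bad_le K a : 0 < K -> live a ->
  (~~ good K a)%:R <= (n * n.-1)%N%:R * deficit a + K^-1 * (mass a)%:R.
Proof.
move=> K0 [sa a0].
have b0 : 0 < (supp_size a)%:R :> R by rewrite ltr0n.
have M0 : 0 <= (n * n.-1)%N%:R :> R by exact: ler0n.
have d0 : 0 <= deficit a by rewrite divr_ge0 ?(ltW b0)// subr_ge0 ler_nat supp_size_le.
have S0 : 0 <= K^-1 * (mass a)%:R by rewrite mulr_ge0 ?ler0n ?invr_ge0 ?(ltW K0).
have [|/forallPn[x /forallPn[z]]] := boolP (good K a); first by rewrite /= addr_ge0// mulr_ge0.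
rewrite negb_imply negb_and negbK => /andP[xz /orP[axz|axz]]; last first.
  apply: ler_wpDl; first by rewrite mulr_ge0.
  rewrite -ltNge in axz; rewrite mulrC ler_pdivlMr// mul1r (le_trans (ltW axz))// ler_nat.
  by rewrite /mass (bigD1 x)//= (bigD1 z)//= -addnA leq_addr.
apply: ler_wpDr => //=.
have bM : (supp_size a < n * n.-1)%N.
  rewrite -[n in (n * _)%N]card_ord -sum_nat_const /supp_size (bigD1 x)//= [X in (_ < X)%N](bigD1 x)//=.
  rewrite -addSn leq_add//; last first.
    by apply: leq_sum => y _; rewrite -(card_neq y); apply: leq_sum => ? _; exact: leq_b1.
  rewrite -(card_neq x) (bigD1 z)//= [X in (_ < X)%N](bigD1 z)//= (eqP axz) /= add0n add1n ltnS.
  by apply: leq_sum => ? _; exact: leq_b1.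
rewrite /deficit mulrA ler_pdivlMr// mul1r; set M := (n * n.-1)%N in M0 bM *.
apply: (@le_trans _ _ (M%:R * 1)); first by rewrite mulr1 ler_nat ltnW.
by rewrite ler_wpM2l// lerBrDr nat1r ler_nat.
Qed.

(** The prefactor $n^4$ bounds $n(n-1)$ times the initial deficit, itself at most $n(n-1)$; the
    factor 2 is the initial mass, a site and its mirror. *)
Lemma avg_bad K L a : 0 < K -> live a -> (mass a <= 2)%N ->
  avg L (fun a => (~~ good K a)%:R) a <=
  (n%:R ^+ 4) * (1 - n%:R^-1) ^+ L + 2 * (1 + 12 / n%:R) ^+ L / K.
Proof.
move=> K0 la m2; set M : R := (n * n.-1)%N%:R.
have M0 : 0 <= M by exact: ler0n.
have nM : M <= n%:R ^+ 2 by rewrite /M -natrX ler_nat expnS expn1 leq_mul2l leq_pred orbT.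
apply: (@le_trans _ _ (avg L (fun a => M * deficit a + K^-1 * (mass a)%:R) a)).
  by apply: avg_le => // a' la'; exact: bad_le.
rewrite avg_lin; apply: lerD.
  have c0 : 0 <= 1 - n%:R^-1 :> R by rewrite subr_ge0 invf_le1// ler1n; case: (n) n2.
  apply: (@le_trans _ _ (M * ((1 - n%:R^-1) ^+ L * deficit a))).
    rewrite ler_wpM2l//; apply: avg_geometric => //; exact: deficit_decay.
  rewrite mulrCA [leRHS]mulrC ler_wpM2l ?exprn_ge0//.
  have dM : deficit a <= M.
    case: la => _ b0; rewrite /deficit ler_pdivrMr ?ltr0n//.
    rewrite (@le_trans _ _ M)// ?gerBl ?ler0n// -[leLHS]mulr1 ler_wpM2l// ler1n//.
  apply: (@le_trans _ _ (M * M)); first by rewrite ler_wpM2l.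
  by rewrite (_ : 4 = 2 + 2)%N// exprD ler_pM.
have g0 : 0 <= 1 + 12 / n%:R :> R by rewrite addr_ge0// divr_ge0// ltW.
apply: (@le_trans _ _ (K^-1 * ((1 + 12 / n%:R) ^+ L * (mass a)%:R))).
  rewrite ler_wpM2l ?invr_ge0 ?(ltW K0)//.
  by apply: (@avg_geometric _ (fun a => (mass a)%:R)) => // a' _; exact: mass_growth.
rewrite mulrC ler_wpM2r ?invr_ge0 ?(ltW K0)// mulrC ler_wpM2r ?exprn_ge0//.
by rewrite ler_nat.
Qed.

Lemma live_target (tgt : 'I_n * 'I_n) w : tgt.1 != tgt.2 -> live (weights tgt w 0).
Proof.
move=> t12; split; first by move=> x z /=; rewrite orbC.
rewrite /supp_size (bigD1 tgt.1)//= (bigD1 tgt.2)//= -surjective_pairing eqxx /=.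
by rewrite -addnA add1n.
Qed.

Lemma mass_target (tgt : 'I_n * 'I_n) w : (mass (weights tgt w 0) <= 2)%N.
Proof.
rewrite /mass.
apply: (@leq_trans (\sum_(x < n) \sum_(z < n) ((x == tgt.1) * ((z == tgt.2) * 1) + (x == tgt.2) * ((z == tgt.1) * 1))))%N.
  apply: leq_sum => x _; rewrite sum_cond; apply: leq_sum => z _ /=.
  by rewrite -!pair_eqE /=; case: (x == tgt.1); case: (z == tgt.2); case: (z == tgt.1); case: (x == tgt.2); case: (x == z).
under eq_bigr => x _ do rewrite big_split /= -!big_distrr /= !sum_delta.
by rewrite big_split /= !sum_delta.
Qed.

(** Peels off the first step, as [avg] and conditioning on the past require, while [weights] peels
    off the last one, as [conj_walk] requires; [weights_run] reconciles the two. *)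
Fixpoint run (f : nat -> 'I_n * 'I_n) L a :=
  if L is L'.+1 then run (f \o succn) L' (spread (f 0%N) a) else a.

Lemma runS f L a : run f L.+1 a = spread (f L) (run f L a).
Proof. by elim: L f a => [//|L IH] f a; rewrite [LHS]IH. Qed.

Lemma weights_run tgt f L : weights tgt f L = run f L (weights tgt f 0).
Proof. by elim: L => [//|L IH]; rewrite runS -IH. Qed.

End SpreadingBound.

(** * Windows after the marked times *)

Section IndexProbability.
Context {d : measure_display} {T : measurableType d} {R : realType} (P : probability T R).
Context {N : nat} (i : nat -> T -> 'I_N).
Hypothesis iid : iid_uniform_index P i.
Hypothesis N0 : (0 < N)%N.

Lemma bigsetU_ordP n (F : 'I_n -> set T) w : (\big[setU/set0]_(k < n) F k) w <-> exists k, F k w.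
Proof.
split=> [|[k Fk]]; last by rewrite (bigD1 k)//=; left.
by elim/big_ind : _ => [//|A B HA HB [/HA|/HB]//|k _ Fk]; exists k.
Qed.

Lemma measurable_index t (B : set 'I_N) : measurable (i t @^-1` B).
Proof.
have [mi _ _] := iid.
have -> : i t @^-1` B = \big[setU/set0]_(k < N) (if k \in B then i t @^-1` [set k] else set0).
  apply/seteqP; split=> w /=.
    by move=> Bw; apply/bigsetU_ordP; exists (i t w); rewrite mem_set.
  by move=> /bigsetU_ordP[k]; case: ifPn => // /set_mem Bk /= ->.
by apply: bigsetU_measurable => k _; case: ifP.
Qed.

Lemma prob_cylinder (s : seq nat) (B : nat -> set 'I_N) : uniq s ->
  P (\bigcap_(j in [set` s]) (i j @^-1` B j)) = (\prod_(j <- s) P (i j @^-1` B j))%E.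
Proof.
have [_ _ ind] := iid => us.
by apply: (ind s (fun j => i j @^-1` B j)) => // j _; exists (B j).
Qed.

Definition prefix_event t (A : set T) :=
  forall w w', (forall j, (j < t)%N -> i j w = i j w') -> A w -> A w'.

(** Induction on [t], splitting [A] by the value of the last index. Measurability is proved along
    the way, since [prefix_event] only says that [A] depends on finitely many indices. *)
Lemma prefix_indep t (A : set T) : prefix_event t A -> measurable A /\
  forall (s : seq nat) (B : nat -> set 'I_N), uniq s -> (forall j, j \in s -> (t <= j)%N) ->
  P (A `&` \bigcap_(j in [set` s]) (i j @^-1` B j)) = (P A * \prod_(j <- s) P (i j @^-1` B j))%E.
Proof.
elim: t A => [|t IH] A pA.
  case: (pselect (A !=set0)) => [[w Aw]|/set0P/negP/negPn/eqP ->].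
    have -> : A = setT by apply/seteqP; split=> // w' _; apply: pA Aw.
    by split=> // s B us _; rewrite setTI probability_setT mul1e prob_cylinder.
  by split=> // s B us _; rewrite set0I measure0 mul0e.
(* The trace of [A] on the event that the last index is [k], with that index forgotten. The sample
   space need not contain outcomes with one index altered, hence the existential over outcomes with
   the same earlier indices. *)
pose Ak k : set T := [set w | exists w', [/\ forall j, (j < t)%N -> i j w = i j w', i t w' = k & A w']].
have pAk k : prefix_event t (Ak k).
  move=> w w' ww' [v [vw vk Av]]; exists v; split => // j jt.
  by rewrite -ww'// vw.
have AE (E : set T) : A `&` E = \big[setU/set0]_(k < N) (Ak k `&` (i t @^-1` [set k] `&` E)).
  apply/seteqP; split=> w.
    by move=> [Aw Ew]; apply/bigsetU_ordP; exists (i t w); split => //; exists w.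
  move=> /bigsetU_ordP[k [[v [vw vk Av]] [/= iw Ew]]]; split=> //.
  apply: pA Av => j; rewrite ltnS leq_eqVlt => /orP[/eqP->|jt]; first by rewrite vk.
  by rewrite vw.
have [mi Pi _] := iid.
have PE (s : seq nat) (B : nat -> set 'I_N) : uniq s -> (forall j, j \in s -> (t.+1 <= j)%N) ->
    P (A `&` \bigcap_(j in [set` s]) (i j @^-1` B j)) =
    (\sum_(k < N) (P (Ak k) * ((N%:R^-1)%:E * \prod_(j <- s) P (i j @^-1` B j))))%E.
  move=> us st; rewrite AE measure_bigsetU_ord; first last.
  - apply/trivIsetP => k k' _ _ kk'; rewrite -subset0 => w [[_ [/= ik _]] [_ [/= ik' _]]].
    by move/eqP: kk'; apply; rewrite -ik -ik'.
  - move=> k; apply: measurableI; first by have [] := IH _ (pAk k).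
    apply: measurableI => //; apply: fin_bigcap_measurable; first exact: finite_seq.
    by move=> j _; exact: measurable_index.
  apply: eq_bigr => k _.
  pose C j := if j == t then [set k] else B j.
  have ts : t \notin s by apply/negP => /st; rewrite ltnn.
  have -> : i t @^-1` [set k] `&` \bigcap_(j in [set` s]) (i j @^-1` B j) =
      \bigcap_(j in [set` t :: s]) (i j @^-1` C j).
    apply/seteqP; split=> w /=.
      move=> [ik H] j /=; rewrite inE /C => /predU1P[->|js]; first by rewrite eqxx.
      case: eqP => [jt|_]; last exact: H.
      by move: ts; rewrite -jt js.
    move=> H; split; first by have := H t; rewrite /= inE eqxx /C eqxx; exact.
    move=> j js; have := H j; rewrite /= inE js orbT /C; case: eqP => [jt|_]; last exact.
    by move: ts; rewrite -jt js.
  have [_ indk] := IH _ (pAk k).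
  have us' : uniq (t :: s) by rewrite /= ts us.
  have st' j : j \in t :: s -> (t <= j)%N by rewrite inE => /predU1P[->|/st/ltnW].
  apply: etrans (indk (t :: s) C us' st') _.
  congr (_ * _)%E; rewrite big_cons {1}/C eqxx Pi; congr (_ * _)%E.
  rewrite big_seq [RHS]big_seq; apply: eq_bigr => j js; rewrite /C.
  by case: eqP => // jt; move: ts; rewrite -jt js.
have PA : P A = (\sum_(k < N) P (Ak k) * (N%:R^-1)%:E)%E.
  have := PE [::] (fun=> setT) isT; rewrite set_nil bigcap_set0 setIT => -> //.
  by apply: eq_bigr => k _; rewrite big_nil mule1.
split.
  have := AE setT; rewrite setIT => ->; apply: bigsetU_measurable => k _.
  by rewrite setIT; apply: measurableI => //; have [] := IH _ (pAk k).
move=> s B us st; rewrite PE// PA ge0_sume_distrl; last first.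
  by move=> k _; rewrite mule_ge0// lee_fin invr_ge0.
by apply: eq_bigr => k _; rewrite muleA.
Qed.

Lemma prefix_measurable t A : prefix_event t A -> measurable A.
Proof. by move=> /prefix_indep[]. Qed.

Lemma prefix_step t A k : prefix_event t A -> P (A `&` i t @^-1` [set k]) = (P A * (N%:R^-1)%:E)%E.
Proof.
move=> /prefix_indep[_ /(_ [:: t] (fun=> [set k]) isT)].
have [_ Pi _] := iid.
rewrite big_seq1 Pi => <-; last by move=> j; rewrite inE => /eqP ->.
congr (P (_ `&` _)); apply/seteqP; split=> w /=; last by apply; rewrite /= inE.
by move=> iw j; rewrite /= inE => /eqP ->.
Qed.

Lemma prefix_setI t A B : prefix_event t A -> prefix_event t B -> prefix_event t (A `&` B).
Proof. by move=> pA pB w w' ww' [Aw Bw]; split; [exact: pA Aw | exact: pB Bw]. Qed.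

Lemma prefix_le t t' A : (t <= t')%N -> prefix_event t A -> prefix_event t' A.
Proof. by move=> tt' pA w w' ww'; apply: pA => j jt; apply: ww'; exact: leq_trans tt'. Qed.

Variables (n : nat) (pl : 'I_N -> 'I_n * 'I_n) (bad : pred ('I_n -> 'I_n -> nat)).

Definition bad_window t L a : set T := [set w | bad (run (fun j => pl (i (t + j)%N w)) L a)].

Lemma run_ext (f g : nat -> 'I_n * 'I_n) L a : (forall j, (j < L)%N -> f j = g j) -> run f L a = run g L a.
Proof.
elim: L f g a => [//|L IH] f g a fg /=; rewrite fg//.
by apply: IH => j jL /=; rewrite fg.
Qed.

Lemma prefix_bad_window t L a : prefix_event (t + L) (bad_window t L a).
Proof.
move=> w w' ww'; rewrite /bad_window /= (@run_ext _ (fun j => pl (i (t + j)%N w'))) // => j jL.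
by rewrite ww'// ltn_add2l.
Qed.

(** The first index of the window is absorbed into the past event, and [spread] is applied to the
    weights. With $A=\{s_l=s\}$ and $t=s+1$ this acts as the Markov property at the stopping time
    $s_l$. *)
Lemma bad_window_prob t L a A : prefix_event t A ->
  P (A `&` bad_window t L a) = (P A * (avg pl L (fun a => (bad a)%:R) a)%:E)%E.
Proof.
elim: L t a A => [|L IH] t a A pA.
  rewrite /bad_window /=; case: (bad a) => /=; last first.
    by rewrite mule0 (_ : [set _ | _] = set0) ?setI0 ?measure0// -subset0.
  by rewrite mule1 (_ : [set _ | _] = setT) ?setIT// -subTset.
have AE : A `&` bad_window t L.+1 a =
    \big[setU/set0]_(k < N) ((A `&` i t @^-1` [set k]) `&` bad_window t.+1 L (spread (pl k) a)).
  have E w : (fun j => pl (i (t + j)%N w)) \o succn = (fun j => pl (i (t.+1 + j)%N w)).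
    by apply/funext => j /=; rewrite addnS.
  apply/seteqP; split=> w.
    move=> [Aw]; rewrite /bad_window /= addn0 E => bw.
    by apply/bigsetU_ordP; exists (i t w).
  move=> /bigsetU_ordP[k [[Aw /= ik]]]; rewrite /bad_window /= addn0 E => bw.
  by split => //; rewrite ik.
have pAk k : prefix_event t.+1 (A `&` i t @^-1` [set k]).
  apply: prefix_setI; first exact: (prefix_le (leqnSn t)).
  by move=> w w' ww' /= <-; rewrite ww'.
rewrite AE measure_bigsetU_ord.
- rewrite (eq_bigr (fun k => (P A * (N%:R^-1 * avg pl L (fun a => (bad a)%:R) (spread (pl k) a))%:E)%E)).
    rewrite -ge0_sume_distrr; last first.
      move=> k _; rewrite lee_fin mulr_ge0 ?invr_ge0//.
      by elim: (L) (spread _ _) => [a'|L' IH' a'] /=; rewrite ?ler0n// mulr_ge0 ?invr_ge0// sumr_ge0.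
    by congr (_ * _)%E; rewrite /= sumEFin -mulr_sumr.
  move=> k _; apply: etrans (IH _ _ _ (pAk k)) _.
  by apply: etrans (congr1 (fun z => (z * _)%E) (prefix_step k pA)) _; rewrite -muleA -EFinM.
- move=> k; apply: measurableI; first exact: prefix_measurable (pAk k).
  by apply: (@prefix_measurable (t.+1 + L)); exact: prefix_bad_window.
- apply/trivIsetP => k k' _ _ kk'; rewrite -subset0 => w [[[_ /= ik] _] [[_ /= ik'] _]].
  by move/eqP: kk'; apply; rewrite -ik -ik'.
Qed.

End IndexProbability.

Lemma first_timeP (p : pred nat) : (exists t, p t) ->
  p (first_time p) /\ forall t, p t -> (first_time p <= t)%N.
Proof. by move=> h; rewrite /first_time; case: pselect => // h'; case: ex_minnP. Qed.

Lemma first_time_agree (p p' : pred nat) s : (exists t, p t) -> (exists t, p' t) ->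
  (forall t, (t <= s)%N -> p t = p' t) -> (first_time p <= s)%N -> first_time p' = first_time p.
Proof.
move=> /first_timeP[pt mt] /first_timeP[pt' mt'] pp' ts.
have le : (first_time p' <= first_time p)%N by apply: mt'; rewrite -pp'.
by apply/eqP; rewrite eqn_leq le mt// pp'// (leq_trans le).
Qed.

Lemma measure_bigsetU_le d (T : measurableType d) (R : realType)
    (P : {measure set T -> \bar R}) n (F : 'I_n -> set T) : (forall k, measurable (F k)) ->
  (P (\big[setU/set0]_(k < n) F k) <= \sum_(k < n) P (F k))%E.
Proof.
move=> mF; suff [] : measurable (\big[setU/set0]_(k < n) F k) /\
  (P (\big[setU/set0]_(k < n) F k) <= \sum_(k < n) P (F k))%E by [].
elim/big_rec2 : _ => [|k x A _ [mA PA]]; first by rewrite measure0.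
split; first exact: measurableU.
by apply: le_trans (measureU2 _ _ _) _ => //; exact: leeD2l.
Qed.

(** * Marked times as stopping times *)

Section MarkedTimes.
Context {R : realType} (Q : R) (n : nat).
Hypothesis Q0 : 0 <= Q.
Hypothesis n2 : (2 <= n)%N.
Local Notation N := (nplanes n).
Local Notation gap := (Q * n%:R ^+ 2 * ln n%:R).
Implicit Types idx : nat -> 'I_N.

Definition recurrent idx := forall a k, exists t, (a <= t)%N /\ idx t = k.

Lemma gap_ge0 : 0 <= gap.
Proof. by rewrite mulr_ge0 ?mulr_ge0 ?exprn_ge0 ?ln_ge0// ler1n ltnW. Qed.

Lemma marked_exists idx l m : recurrent idx -> (l < N)%N ->
  exists t, ((m%:R + gap <= t%:R :> R) && (idx t == l :> nat)).
Proof.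
move=> rec lN; have x0 : 0 <= m%:R + gap by rewrite addr_ge0 ?gap_ge0.
have [t [at_ it]] := rec (Num.bound (m%:R + gap)) (Ordinal lN).
exists t; rewrite it eqxx andbT; apply: le_trans (ltW (archi_boundP x0)) _.
by rewrite ler_nat.
Qed.

Lemma marked_exists0 idx : recurrent idx -> (0 < N)%N -> exists t, idx t == 0%N :> nat.
Proof. by move=> rec N0; have [t [_ it]] := rec 0%N (Ordinal N0); exists t; rewrite it. Qed.

Lemma marked_gap idx l : recurrent idx -> (l.+1 < N)%N ->
  (marked_time Q idx l)%:R + gap <= (marked_time Q idx l.+1)%:R.
Proof.
by move=> rec lN; have [/andP[]] := first_timeP (marked_exists (marked_time Q idx l) rec lN).
Qed.

Lemma marked_hit idx l : recurrent idx -> (l < N)%N -> idx (marked_time Q idx l) = l :> nat.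
Proof.
case: l => [|l] rec lN /=.
  by have [/eqP] := first_timeP (marked_exists0 rec lN).
by have [/andP[_ /eqP]] := first_timeP (marked_exists (marked_time Q idx l) rec lN).
Qed.

Lemma marked_le idx l : recurrent idx -> (l.+1 < N)%N ->
  (marked_time Q idx l <= marked_time Q idx l.+1)%N.
Proof.
move=> rec lN; rewrite -(ler_nat R); apply: le_trans (marked_gap rec lN).
by rewrite lerDl gap_ge0.
Qed.

(** Stopping-time property: a marked time not exceeding [s] is read off the indices up to [s].
    Recurrence of both sequences keeps [first_time] away from its default value. *)
Lemma marked_agree idx idx' s l : recurrent idx -> recurrent idx' -> (l < N)%N ->
  (forall t, (t <= s)%N -> idx t = idx' t) -> (marked_time Q idx l <= s)%N ->
  marked_time Q idx' l = marked_time Q idx l.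
Proof.
move=> rec rec' lN ag; elim: l lN => [|l IH] lN ms.
  apply: (@first_time_agree _ _ s) ms; [exact: marked_exists0| exact: marked_exists0|].
  by move=> t ts; rewrite ag.
have mE := IH (ltnW lN) (leq_trans (marked_le rec lN) ms).
apply: (@first_time_agree _ _ s) ms; [exact: marked_exists| exact: marked_exists|].
by move=> t ts; rewrite -/(marked_time Q idx l) -/(marked_time Q idx' l) mE ag.
Qed.

Context {d : measure_display} {T : measurableType d} (P : probability T R).
Variable i : nat -> T -> 'I_N.
Hypothesis iid : iid_uniform_index P i.
Hypothesis N0 : (0 < N)%N.

Definition avoid a k : set T := [set w | forall t, (a <= t)%N -> i t w != k].

Lemma measurable_avoid a k : measurable (avoid a k).
Proof.
have -> : avoid a k = \bigcap_t (if (a <= t)%N then i t @^-1` [set~ k] else setT).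
  apply/seteqP; split=> w.
    by move=> H t _; case: ifP => // /H /= /eqP.
  by move=> H t at_; have := H t I; rewrite at_ /= => /eqP.
by apply: bigcapT_measurable => t; case: ifP => // _; exact: (measurable_index iid).
Qed.

Lemma avoid_null a k : P (avoid a k) = 0%E.
Proof.
set c : R := 1 - N%:R^-1.
have N1 : 0 < N%:R :> R by rewrite ltr0n.
have c0 : 0 <= c by rewrite subr_ge0 invf_le1// ler1n.
have c1 : c < 1 by rewrite ltrBlDr ltrDl invr_gt0.
have H m : (P (avoid a k) <= (c ^+ m)%:E)%E.
  have [mi Pi _] := iid.
  have -> : (c ^+ m)%:E = P (\bigcap_(j in [set` iota a m]) (i j @^-1` [set~ k])).
    rewrite (prob_cylinder iid _ (iota_uniq a m)).
    rewrite (eq_bigr (fun=> c%:E)) => [|j _].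
      by rewrite big_const_seq count_predT size_iota; elim: m => //= m <-; rewrite exprS EFinM.
    by rewrite -preimage_setC probability_setC// Pi.
  apply: le_measure; rewrite ?inE//; first exact: measurable_avoid.
    apply: fin_bigcap_measurable; first exact: finite_seq.
    by move=> j _; exact: (measurable_index iid).
  by move=> w H j /=; rewrite mem_iota => /andP[/H /eqP].
apply: le_anti; rewrite measure_ge0 andbT.
apply/lee_addgt0Pr => e e0; rewrite add0e.
have c1' : `|c| < 1 by rewrite ger0_norm.
have /cvgrPdist_lt/(_ e e0) [m _ Hm] := cvg_expr c1'.
apply: le_trans (H m) _; rewrite lee_fin; have := Hm m (leqnn m).
by rewrite /= sub0r normrN ger0_norm ?exprn_ge0// => /ltW.
Qed.

Definition irregular : set T := \bigcup_a \big[setU/set0]_(k < N) avoid a k.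

Lemma measurable_irregular : measurable irregular.
Proof.
apply: bigcupT_measurable => a; apply: bigsetU_measurable => k _.
exact: measurable_avoid.
Qed.

Lemma irregular_null : P irregular = 0%E.
Proof.
apply: measure_negligible; first exact: measurable_irregular.
apply: negligible_bigcup => a; apply/negligibleP.
  by apply: bigsetU_measurable => k _; exact: measurable_avoid.
apply: le_anti; rewrite measure_ge0 andbT.
apply: le_trans (measure_bigsetU_le _ _) _; first by move=> k; exact: measurable_avoid.
by rewrite big1// => k _; exact: avoid_null.
Qed.

Lemma regular w : ~ irregular w -> recurrent (i^~ w).
Proof.
move=> irr a k; apply: contrapT => H; apply: irr; exists a => //.
apply/bigsetU_ordP; exists k => t at_; apply/eqP => itk; apply: H.
by exists t.
Qed.

Definition cyclic_ext (s : nat) (w : T) (t : nat) : 'I_N :=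
  if (t <= s)%N then i t w else Ordinal (ltn_pmod t N0).

Lemma recurrent_cyclic_ext s w : recurrent (cyclic_ext s w).
Proof.
move=> a k; exists ((a + s.+1) * N + k)%N.
have le1 : (a + s.+1 <= (a + s.+1) * N + k)%N.
  by apply: leq_trans (leq_addr _ _); rewrite leq_pmulr.
split; first by apply: leq_trans le1; exact: leq_addr.
rewrite /cyclic_ext ifF; first by apply: val_inj; rewrite /= modnMDl modn_small.
by apply/negbTE; rewrite -ltnNge; apply: leq_trans le1; exact: leq_addl.
Qed.

(* The event [s_l = s], read off [i_0, ..., i_s] alone: the sequence is continued
   cyclically so that no [first_time] takes its junk value. *)
Definition marked_at (l s : nat) : set T := [set w | marked_time Q (cyclic_ext s w) l = s].

Lemma prefix_marked_at l s : prefix_event i s.+1 (marked_at l s).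
Proof.
move=> w w' ww'; rewrite /marked_at /=; suff -> : cyclic_ext s w = cyclic_ext s w' by [].
by apply/funext => t; rewrite /cyclic_ext; case: ifP => // ts; rewrite ww'.
Qed.

Lemma trivIset_marked_at l : (l < N)%N -> trivIset setT (marked_at l).
Proof.
move=> lN; suff H s s' w : (s <= s')%N -> marked_at l s w -> marked_at l s' w -> s = s'.
  apply/trivIsetP => s s' _ _ ss'; rewrite -subset0 => w [ms ms'].
  move/eqP: ss'; apply; have [le|le] := leqP s s'; first exact: (H _ _ w).
  by apply/esym; apply: (H _ _ w) => //; exact: ltnW.
rewrite /marked_at /= => ss' ms ms'; rewrite -ms -ms'.
apply: esym; apply: (@marked_agree _ _ s) => //; try exact: recurrent_cyclic_ext.
  by move=> t ts; rewrite /cyclic_ext ts (leq_trans ts ss').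
by rewrite ms.
Qed.

Lemma marked_at_regular l w : ~ irregular w -> (l < N)%N ->
  marked_at l (marked_time Q (i^~ w) l) w.
Proof.
move=> irr lN; rewrite /marked_at /=.
apply: (@marked_agree _ _ (marked_time Q (i^~ w) l)) => //.
- exact: regular.
- exact: recurrent_cyclic_ext.
- by move=> t ts; rewrite /cyclic_ext ts.
Qed.

Variables (m : nat) (pl : 'I_N -> 'I_m * 'I_m) (bad : pred ('I_m -> 'I_m -> nat)).
Variables (L : nat) (a0 : 'I_N -> 'I_m -> 'I_m -> nat) (beta : R).
Hypothesis beta0 : 0 <= beta.
Hypothesis avg_beta : forall l, avg pl L (fun a => (bad a)%:R) (a0 l) <= beta.

Definition bad_index : set T := irregular `|`
  \big[setU/set0]_(l < N) \bigcup_s (marked_at l s `&` bad_window i pl bad s.+1 L (a0 l)).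

Lemma measurable_marked_bad (l : 'I_N) s :
  measurable (marked_at l s `&` bad_window i pl bad s.+1 L (a0 l)).
Proof.
apply: measurableI; first exact: (prefix_measurable iid (@prefix_marked_at _ _)).
by apply: (prefix_measurable iid (t := s.+1 + L)); exact: prefix_bad_window.
Qed.

Lemma measurable_bad_index : measurable bad_index.
Proof.
apply: measurableU; first exact: measurable_irregular.
apply: bigsetU_measurable => l _; apply: bigcupT_measurable => s.
exact: measurable_marked_bad.
Qed.

(** The window opens at [s.+1], just beyond the indices deciding [marked_at l s], hence is
    independent of that event. These events being disjoint in [s], the sum over [s] costs nothing,
    and only the union over the planes contributes a factor. *)
Lemma bad_index_prob : (P bad_index <= (N%:R * beta)%:E)%E.
Proof.
apply: le_trans (measureU2 _ _ _) _; first exact: measurable_irregular.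
  apply: bigsetU_measurable => l _; apply: bigcupT_measurable => s.
  exact: measurable_marked_bad.
rewrite [X in (X + _)%E]irregular_null add0e.
apply: le_trans (measure_bigsetU_le _ _) _.
  by move=> l; apply: bigcupT_measurable => s; exact: measurable_marked_bad.
apply: (@le_trans _ _ (\sum_(l < N) beta%:E)%E); last first.
  by rewrite sumEFin sumr_const card_ord mulr_natl.
apply: lee_sum => l _.
have mm s : measurable (marked_at l s) := prefix_measurable iid (@prefix_marked_at l s).
have tm := trivIset_marked_at (ltn_ord l).
rewrite measure_semi_bigcup; first last.
- by apply: bigcupT_measurable => s; exact: measurable_marked_bad.
- apply/trivIsetP => s s' _ _ ss'; rewrite -subset0 => w [[ms _] [ms' _]].
  by have /trivIsetP/(_ s s' I I ss') := tm; rewrite -subset0; apply; split; [exact: ms | exact: ms'].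
- by move=> s; exact: measurable_marked_bad.
apply: (@le_trans _ _ (\sum_(s <oo) (beta%:E * P (marked_at l s)))%E).
  apply: lee_nneseries => s _ //.
  apply: le_trans (_ : (P (marked_at l s) * (avg pl L (fun a => (bad a)%:R) (a0 l))%:E <= _)%E).
    by rewrite le_eqVlt; apply/orP; left; apply/eqP; exact: (bad_window_prob iid _ _ _ _ (@prefix_marked_at l s)).
  by rewrite muleC; apply: lee_wpmul2r => //; rewrite lee_fin.
rewrite nneseriesZl// -[leRHS]mule1; apply: lee_wpmul2l; first by rewrite lee_fin.
rewrite -measure_semi_bigcup//; last exact: bigcupT_measurable.
by apply: probability_le1; exact: bigcupT_measurable.
Qed.

Lemma not_bad_index w : ~ bad_index w -> recurrent (i^~ w) /\ forall l : 'I_N, ~ bad (run (fun j => pl (i ((marked_time Q (i^~ w) l).+1 + j)%N w)) L (a0 l)).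
Proof.
move=> nb; have irr : ~ irregular w by move=> irr; apply: nb; left.
split; first exact: regular.
move=> l bw; apply: nb; right; apply/bigsetU_ordP; exists l.
by exists (marked_time Q (i^~ w) l) => //; split => //; exact: marked_at_regular.
Qed.

End MarkedTimes.

(** * Small linear combinations of the fields *)

Section SmallCombinations.
Context {R : realType} {n : nat}.
Implicit Types A B y : 'M[R]_n.

Lemma HSDl A B y : HS (A + B) y = HS A y + HS B y.
Proof. by rewrite /HS linearD /= mulmxDl linearD. Qed.

Lemma HSZl c A y : HS (c *: A) y = c * HS A y.
Proof. by rewrite /HS linearZ /= -scalemxAl linearZ. Qed.

Lemma HSC A B : HS A B = HS B A.
Proof. by rewrite /HS -mxtrace_tr trmx_mul trmxK. Qed.

Lemma HS_suml (I : finType) (Pr : pred I) (F : I -> 'M[R]_n) y :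
  HS (\sum_(i | Pr i) F i) y = \sum_(i | Pr i) HS (F i) y.
Proof. by rewrite /HS linear_sum /= mulmx_suml linear_sum. Qed.

Definition nrm2 A : R := HS A A.

Lemma nrm2E A : nrm2 A = \sum_a \sum_b A a b ^+ 2.
Proof. by rewrite /nrm2 HSE. Qed.

Lemma nrm2_ge0 A : 0 <= nrm2 A.
Proof. by rewrite nrm2E; do 2 apply: sumr_ge0 => ? _; exact: sqr_ge0. Qed.

Lemma nrm2Z c A : nrm2 (c *: A) = c ^+ 2 * nrm2 A.
Proof. by rewrite /nrm2 HSZl HSC HSZl mulrA expr2. Qed.

Lemma nrm2D A B : nrm2 (A + B) <= 2 * nrm2 A + 2 * nrm2 B.
Proof.
have := nrm2_ge0 (A - B); rewrite /nrm2 -scaleN1r.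
rewrite !(HSDl, HSZl) ![HS _ (_ + _)]HSC !(HSDl, HSZl) (HSC B A); lra.
Qed.

(** Cauchy--Schwarz, read off $|e^{-1}A-cy|^2\ge0$ for $c=\pm1$. *)
Lemma HS_small A y (e : R) : 0 < e -> nrm2 A < e ^+ 2 -> nrm2 y = 1 -> `|HS A y| <= e.
Proof.
move=> e0 A1 y1.
have H (c : R) : c ^+ 2 = 1 -> c * HS A y <= e.
  move=> c1; have := nrm2_ge0 (e^-1 *: A + (- c) *: y); rewrite {1}/nrm2.
  rewrite !(HSDl, HSZl) ![HS _ (_ + _)]HSC !(HSDl, HSZl) (HSC y A) -/(nrm2 A) -/(nrm2 y) y1.
  have -> : e^-1 * (e^-1 * nrm2 A + - c * HS A y) + - c * (e^-1 * HS A y + - c * 1) =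
    e^-1 * (e^-1 * nrm2 A - 2 * (c * HS A y)) + c ^+ 2 by ring.
  rewrite c1 => /(ler_wpM2l (ltW e0)); rewrite mulr0 mulrDr [e * (e^-1 * _)]mulrA mulfV ?gt_eqF// mul1r mulr1.
  have : e^-1 * nrm2 A <= e by rewrite ler_pdivrMl// -expr2 ltW.
  lra.
have N1 : (-1) ^+ 2 = 1 :> R by rewrite sqrrN expr1n.
rewrite ler_norml; have := H 1 (expr1n _ _); have := H (-1) N1; lra.
Qed.

Variables (N : nat) (pl : 'I_N -> 'I_n * 'I_n).
Hypothesis pl_inj : injective pl.
Hypothesis pl_lt : forall i, ((pl i).1 < (pl i).2)%N.

(* The conditions number [N - l - 1 < N], the dimension of the antisymmetric matrices. *)
Lemma exists_normal (u : 'I_N -> 'M[R]_n) (l : 'I_N) : exists y : 'M[R]_n,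
  [/\ y^T = - y, nrm2 y = 1 & forall j : 'I_N, (l < j)%N -> HS (u j) y = 0].
Proof.
pose J m : 'M[R]_n := rotation_gen (pl m).
(* Column [l] is zero because $l<l$ fails; this makes the square matrix singular. *)
pose A : 'M[R]_N := \matrix_(m, j) if (l < j)%N then HS (u j) (J m) else 0.
have /det0P[v v0 vA] : \det A == 0.
  rewrite (expand_det_col _ l) big1// => i _.
  by rewrite mxE ltnn mul0r.
pose y0 := \sum_m v 0 m *: J m.
have y0T : y0^T = - y0.
  rewrite /y0 linear_sum -sumrN; apply: eq_bigr => m _.
  by rewrite linearZ /= tr_rotation_gen scalerN.
have y0E m : y0 (pl m).1 (pl m).2 = v 0 m.
  rewrite /y0 summxE (bigD1 m)//= big1 ?addr0; first last.
    move=> k km; rewrite !mxE.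
    have -> : ((pl m).1 == (pl k).1) && ((pl m).2 == (pl k).2) = false.
      apply/negbTE/negP => /andP[/eqP E1 /eqP E2]; move/eqP: km; apply; apply: pl_inj.
      by apply/esym; rewrite [LHS]surjective_pairing E1 E2 -surjective_pairing.
    have -> : ((pl m).1 == (pl k).2) && ((pl m).2 == (pl k).1) = false.
      apply/negbTE/negP => /andP[/eqP E1 /eqP E2].
      have := pl_lt m; have := pl_lt k; rewrite E1 E2 => a b.
      by have := ltn_trans a b; rewrite ltnn.
    by rewrite subr0 mulr0.
  rewrite !mxE !eqxx; have -> : ((pl m).1 == (pl m).2) = false.
    by apply/negbTE; rewrite -val_eqE /= ltn_eqF// pl_lt.
  by rewrite subr0 mulr1.
have ny0 : 0 < nrm2 y0.
  rewrite lt_def nrm2_ge0 andbT; apply: contra v0 => /eqP ny0.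
  have /matrixP y00 : y0 = 0.
    apply/matrixP => a b; rewrite mxE; apply/eqP; rewrite -sqrf_eq0.
    rewrite -(@le_anti _ _ (y0 a b ^+ 2) 0) ?eqxx// sqr_ge0 andbT -ny0 nrm2E.
    rewrite (bigD1 a)//= (bigD1 b)//= -addrA lerDl addr_ge0 ?sumr_ge0// => *; rewrite ?sqr_ge0//.
    by apply: sumr_ge0 => *; exact: sqr_ge0.
  by apply/eqP/rowP => m; rewrite -y0E y00 !mxE.
exists ((Num.sqrt (nrm2 y0))^-1 *: y0); split.
- by rewrite linearZ /= y0T scalerN.
- by rewrite nrm2Z exprVn sqr_sqrtr ?nrm2_ge0// mulVf ?gt_eqF.
- move=> j lj; rewrite HSC HSZl HSC; apply/eqP; rewrite mulf_eq0; apply/orP; right; apply/eqP.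
  rewrite HSC /y0 HS_suml; transitivity ((v *m A) 0 j); last by rewrite vA mxE.
  by rewrite [RHS]mxE; apply: eq_bigr => m _; rewrite HSZl mxE lj HSC.
Qed.

Lemma exists_large_entry y : y^T = - y -> nrm2 y = 1 -> exists x z : 'I_n, x != z /\
  (n%:R^-1) ^+ 2 <= y x z ^+ 2.
Proof.
move=> yT y1; have [|n0] := posnP n.
  move=> n0; move: y1; rewrite nrm2E big1 => [/eqP|a _]; first by rewrite eq_sym oner_eq0.
  by have := ltn_ord a; rewrite {2}n0.
have y0 a : y a a = 0.
  by have := congr1 (fun M : 'M[R]_n => M a a) yT; rewrite !mxE; lra.
apply: contrapT => H.
have small a b : y a b ^+ 2 < (n%:R^-1) ^+ 2.
  have [<-|ab] := eqVneq a b; first by rewrite y0 expr0n /= exprn_gt0// invr_gt0 ltr0n.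
  by rewrite ltNge; apply/negP => ge; apply: H; exists a, b.
have : nrm2 y < 1; last by rewrite y1 ltxx.
have -> : 1 = \sum_(a < n) \sum_(b < n) (n%:R^-1) ^+ 2 :> R.
  rewrite !sumr_const !card_ord -mulrnA -[RHS]mulr_natl natrM -expr2 -exprMn divff ?expr1n//.
  by rewrite pnatr_eq0 -lt0n.
rewrite nrm2E; pose a0 : 'I_n := Ordinal n0.
apply: ltr_sum; [by apply/hasP; exists a0; rewrite ?mem_index_enum|move=> a _].
by apply: ltr_sum => //; apply/hasP; exists a0; rewrite ?mem_index_enum.
Qed.

Definition tail_comb (u : 'I_N -> 'M[R]_n) (x : 'I_N -> R) (l : 'I_N) : 'M[R]_n :=
  u l + \sum_(j : 'I_N | (l < j)%N) x j *: u j.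

(* Rational coefficients make this a countable union of conditions on [u]. *)
Definition close_to_tail (e : R) (u : 'I_N -> 'M[R]_n) (l : 'I_N) : Prop :=
  exists q : {ffun 'I_N -> rat}, nrm2 (tail_comb u (fun j => ratr (q j)) l) < e ^+ 2.

Lemma real_tail_comb (e : R) u l : 0 < e -> ~ close_to_tail e u l ->
  forall x, e ^+ 2 / 4 <= nrm2 (tail_comb u x l).
Proof.
move=> e0 ncl x.
pose B := \sum_a \sum_b (\sum_(j : 'I_N) `|u j a b|) ^+ 2.
have B0 : 0 <= B by do 2 apply: sumr_ge0 => ? _; exact: sqr_ge0.
(* Rational coefficients within [h] move the combination by squared norm at most $e^2/4$, and then
   $e^2\le2|\cdot|^2+e^2/2$ leaves $e^2/4$. *)
pose h := e / (2 * (1 + B)).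
have h0 : 0 < h by rewrite divr_gt0// mulr_gt0// ltr_wpDr.
have rat_near j : exists q : rat, `|x j - ratr q| < h.
  have /rat_in_itvoo[q] : x j - h < x j + h by lra.
  rewrite in_itv /= => /andP[q1 q2]; exists q.
  by rewrite ltr_norml; lra.
pose q : {ffun 'I_N -> rat} := [ffun j => projT1 (cid (rat_near j))].
have qP j : `|x j - ratr (q j)| < h by rewrite ffunE; exact: projT2 (cid (rat_near j)).
have : e ^+ 2 <= nrm2 (tail_comb u (fun j => ratr (q j)) l).
  by rewrite leNgt; apply/negP => lt; apply: ncl; exists q.
pose D := \sum_(j : 'I_N | (l < j)%N) (ratr (q j) - x j) *: u j.
have -> : tail_comb u (fun j => ratr (q j)) l = tail_comb u x l + D.
  rewrite /tail_comb -addrA; congr (_ + _); rewrite -big_split /=.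
  by apply: eq_bigr => j _; rewrite -scalerDl addrC subrK.
have nD : nrm2 D <= h ^+ 2 * B.
  rewrite nrm2E /B mulr_sumr; apply: ler_sum => a _; rewrite mulr_sumr; apply: ler_sum => b _.
  rewrite -exprMn -[leLHS]real_normK ?num_real// ler_pXn2r ?nnegrE//; last first.
    by rewrite mulr_ge0 ?(ltW h0)// sumr_ge0.
  rewrite /D summxE (le_trans (ler_norm_sum _ _ _))// mulr_sumr.
  rewrite [leRHS](bigID (fun j : 'I_N => (l < j)%N)) /= ler_wpDr ?sumr_ge0//.
    by move=> j _; rewrite mulr_ge0 ?(ltW h0).
  by apply: ler_sum => j _; rewrite mxE normrM ler_wpM2r// distrC ltW.
have hB : h ^+ 2 * B <= e ^+ 2 / 4.
  have B1 : 0 < 1 + B by rewrite ltr_wpDr.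
  have -> : h ^+ 2 * B = e ^+ 2 / 4 * (B / (1 + B) ^+ 2) by rewrite /h; field; exact: lt0r_neq0.
  rewrite ler_piMr ?divr_ge0 ?sqr_ge0// ler_pdivrMr ?exprn_gt0// mul1r expr2; nra.
have := nrm2D (tail_comb u x l) D; lra.
Qed.

(** Suppose every $u_l$ is far from the later ones and let $w_k=\sum_{j\ge k}v_ju_j$. Then
    $v_l^2\le(4/e^2)|w_l|^2$, so $|w_{l+1}|^2\le2|w_l|^2+4v_l^2\le(20/e^2)|w_l|^2$. Iterating from
    $w_0$ bounds every $v_l^2$ by $(20/e^2)^N|w_0|^2$, and summing over $l$ contradicts the
    smallness of $w_0$. *)
Lemma small_combination (e r : R) (u : 'I_N -> 'M[R]_n) (v : 'I_N -> R) :
  0 < e -> e <= 1 -> N%:R * (20 / e ^+ 2) ^+ N * r ^+ 2 < 1 ->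
  (forall l, nrm2 (u l) <= 2) ->
  0 < \sum_l v l ^+ 2 -> nrm2 (\sum_l v l *: u l) <= r ^+ 2 * \sum_l v l ^+ 2 ->
  exists l, close_to_tail e u l.
Proof.
move=> e0 e1 small u2 v0 uv; apply: contrapT => H.
have far l x : e ^+ 2 / 4 <= nrm2 (tail_comb u x l).
  by apply: real_tail_comb => // cl; apply: H; exists l.
pose w k := \sum_(j : 'I_N | (k <= j)%N) v j *: u j.
set q := 20 / e ^+ 2 in small.
have e2 : 0 < e ^+ 2 by rewrite exprn_gt0.
have e21 : e ^+ 2 <= 1 by rewrite exprn_ile1// ltW.
have q1 : 1 <= q by rewrite ler_pdivlMr// mul1r; lra.
have wl (l : 'I_N) : w l = v l *: u l + w l.+1.
  rewrite /w (bigD1 l)//=; congr (_ + _); apply: eq_bigl => j.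
  by rewrite ltn_neqAle andbC eq_sym.
have vw (l : 'I_N) : v l ^+ 2 * (e ^+ 2 / 4) <= nrm2 (w l).
  have [->|vl] := eqVneq (v l) 0; first by rewrite expr0n /= mul0r nrm2_ge0.
  have -> : w l = v l *: tail_comb u (fun j => (v l)^-1 * v j) l.
    rewrite wl /tail_comb scalerDr scaler_sumr; congr (_ + _); apply: eq_bigr => j _.
    by rewrite scalerA mulrA mulfV// mul1r.
  by rewrite nrm2Z ler_wpM2l// sqr_ge0.
have step (l : 'I_N) : nrm2 (w l.+1) <= q * nrm2 (w l).
  have -> : w l.+1 = w l + (- v l) *: u l by rewrite wl scaleNr addrC addKr.
  apply: le_trans (nrm2D _ _) _; rewrite nrm2Z sqrrN.
  have h1 : v l ^+ 2 <= 4 / e ^+ 2 * nrm2 (w l).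
    rewrite mulrAC ler_pdivlMr// -ler_pdivrMl// mulrC -mulrA; exact: vw.
  have h2 : v l ^+ 2 * nrm2 (u l) <= v l ^+ 2 * 2 by rewrite ler_wpM2l// sqr_ge0.
  have h3 : 2 * nrm2 (w l) <= 4 / e ^+ 2 * nrm2 (w l).
    rewrite ler_wpM2r ?nrm2_ge0// ler_pdivlMr//; lra.
  rewrite /q; have -> : 20 / e ^+ 2 = 5 * (4 / e ^+ 2) by field; exact: lt0r_neq0.
  rewrite -[5 * _ * _]mulrA; lra.
have wk k : (k <= N)%N -> nrm2 (w k) <= q ^+ k * nrm2 (w 0%N).
  elim: k => [|k IH] kN; first by rewrite mul1r.
  apply: le_trans (step (Ordinal kN)) _; rewrite exprS -mulrA ler_wpM2l ?(le_trans _ q1)//.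
  exact: IH (ltnW kN).
have vk (l : 'I_N) : v l ^+ 2 <= q ^+ N * nrm2 (w 0%N).
  have h1 : v l ^+ 2 <= q * nrm2 (w l).
    rewrite /q mulrAC ler_pdivlMr//; have := vw l; have := nrm2_ge0 (w l); lra.
  apply: le_trans h1 _; apply: (@le_trans _ _ (q * (q ^+ l * nrm2 (w 0%N)))).
    by rewrite ler_wpM2l ?(le_trans _ q1)// wk// ltnW.
  by rewrite mulrA -exprS ler_wpM2r ?nrm2_ge0// ler_weXn2l.
have w0 : w 0%N = \sum_l v l *: u l by apply: eq_bigl => j.
have : \sum_l v l ^+ 2 <= N%:R * (q ^+ N * nrm2 (w 0%N)).
  apply: (@le_trans _ _ (\sum_(l < N) q ^+ N * nrm2 (w 0%N))); first exact: ler_sum.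
  by rewrite sumr_const card_ord mulr_natl.
rewrite leNgt => /negP; apply.
apply: (@le_lt_trans _ _ (N%:R * (q ^+ N * (r ^+ 2 * \sum_l v l ^+ 2)))).
  rewrite !ler_wpM2l ?ler0n ?exprn_ge0 ?(le_trans _ q1)// w0; exact: uv.
by rewrite [q ^+ N * _]mulrA [N%:R * _]mulrA -[ltRHS]mul1r [N%:R * _]mulrA ltr_pM2r.
Qed.

End SmallCombinations.

(** * Fields after the marked times and the window estimate *)

Section FieldStructure.
Context {R : realType} (Q : R) (n : nat).
Local Notation N := (nplanes n).
Local Notation gap := (Q * n%:R ^+ 2 * ln n%:R).
Variables (pl : 'I_N -> 'I_n * 'I_n) (idx : nat -> 'I_N).
Hypothesis n2 : (2 <= n)%N.
Hypothesis Q0 : 0 <= Q.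
Hypothesis pl_inj : injective pl.
Hypothesis pl_lt : forall i, ((pl i).1 < (pl i).2)%N.
Hypothesis rec : recurrent idx.
Variable L : nat.
Hypothesis L_gap : L.+1%:R <= gap.

Local Notation s l := (marked_time Q idx l).
Local Notation u th l t := (field Q pl idx th l t).

Let pl_neq i : (pl i).1 != (pl i).2.
Proof. by rewrite -val_eqE /= ltn_eqF// pl_lt. Qed.

Lemma marked_window l : (l.+1 < N)%N -> ((s l).+1 + L <= s l.+1)%N.
Proof.
move=> lN; rewrite -(ler_nat R) addSn -addnS natrD.
by apply: le_trans (marked_gap Q0 n2 rec lN); rewrite lerD2l.
Qed.

Lemma marked_window_lt k l : (k < l)%N -> (l < N)%N -> ((s k).+1 + L <= s l)%N.
Proof.
elim: l => [//|l IH]; rewrite ltnS leq_eqVlt => /predU1P[->|kl] lN.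
  exact: marked_window.
apply: leq_trans (IH kl (ltnW lN)) _.
exact: marked_le.
Qed.

Lemma marked_inj (k l : 'I_N) : s k = s l -> k = l.
Proof.
move=> skl; apply/val_inj/eqP; rewrite eqn_leq.
have H (a b : 'I_N) : s a = s b -> (a <= b)%N.
  move=> sab; rewrite leqNgt; apply/negP => ba.
  have := marked_window_lt ba (ltn_ord a).
  by rewrite sab addSn ltnNge leq_addr.
by rewrite !H.
Qed.

Lemma markE t (l : 'I_N) : (mark Q idx t == Some l) = (t == s l).
Proof.
rewrite /mark; case: pickP => [k /eqP tk|H]; last by rewrite H.
apply/eqP/eqP => [[<-]//|tl]; congr Some; apply: marked_inj.
by rewrite -tk -tl.
Qed.

Lemma field0 th (l : 'I_N) t : (t <= s l)%N -> u th l t = 0.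
Proof.
elim: t => [//|t IH] tl /=; rewrite markE ltn_eqF// add0r IH ?(ltnW tl)//.
by rewrite mulmx0 mul0mx.
Qed.

Lemma field1 th (l : 'I_N) : u th l (s l).+1 = rotation_gen (pl l).
Proof.
rewrite /= markE eqxx field0// mulmx0 mul0mx addr0; congr (rotation_gen (pl _)).
by apply: val_inj; rewrite /= (marked_hit Q0 n2 rec).
Qed.

Lemma fieldS th (l : 'I_N) t : (s l < t)%N ->
  u th l t.+1 = rotation (pl (idx t)) (th t) *m u th l t *m (rotation (pl (idx t)) (th t))^T.
Proof. by move=> lt; rewrite /= markE gtn_eqF// add0r. Qed.

Lemma HS_conj (O A y : 'M[R]_n) : HS (O *m A *m O^T) y = HS A (O^T *m y *m O).
Proof.
rewrite /HS !trmx_mul trmxK -!mulmxA mxtrace_mulC -!mulmxA; congr (\tr _).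
Qed.

Lemma nrm2_field th (l : 'I_N) t : nrm2 (u th l t) <= 2.
Proof.
have [tl|lt] := leqP t (s l); first by rewrite field0// /nrm2 /HS mulmx0 linear0.
elim: t lt => [//|t IH]; rewrite ltnS leq_eqVlt => /predU1P[<-|lt].
  rewrite field1 /nrm2 HS_gen//; last exact: tr_rotation_gen.
  rewrite !mxE !eqxx (negbTE (pl_neq _)) /=; lra.
rewrite fieldS// /nrm2 HS_conj !mulmxA rotation_orthogonal// mul1mx -mulmxA.
by rewrite rotation_orthogonal// mulmx1; exact: IH.
Qed.

Lemma field_agree th th' (l : 'I_N) t :
  (forall j, (s l < j)%N -> th j = th' j) -> u th l t = u th' l t.
Proof.
move=> ag; have [tl|lt] := leqP t (s l); first by rewrite !field0.
elim: t lt => [//|t IH]; rewrite ltnS leq_eqVlt => /predU1P[<-|lt].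
  by rewrite !field1.
by rewrite !fieldS// ag// IH.
Qed.

Local Notation cw := (conj_walk (R := R)).

Lemma conj_walkD (w : nat -> 'I_n * 'I_n) t j k th y :
  cw w t (j + k) th y = cw w t j th (cw (fun i => w (j + i)%N) (t + j) k th y).
Proof.
elim: k y => [|k IH] y; first by rewrite addn0.
by rewrite addnS /= IH addnA.
Qed.

Lemma tr_conj_walk (w : nat -> 'I_n * 'I_n) t j th y : y^T = - y -> (cw w t j th y)^T = - cw w t j th y.
Proof. by elim: j y => [//|j IH] y yT /=; apply: IH; exact: tr_conj_step. Qed.

Lemma nrm2_conj_walk (w : nat -> 'I_n * 'I_n) t j th y : (forall i, (w i).1 != (w i).2) ->
  nrm2 (cw w t j th y) = nrm2 y.
Proof.
move=> w12; elim: j y => [//|j IH] y /=; rewrite IH /conj_step.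
set O := rotation _ _; have -> : O^T *m y *m O = O^T *m y *m O^T^T by rewrite trmxK.
rewrite /nrm2 HS_conj trmxK !mulmxA rotation_orthogonalr// mul1mx -mulmxA.
by rewrite rotation_orthogonalr// mulmx1.
Qed.

Lemma conj_walk_agree (w : nat -> 'I_n * 'I_n) t j th th' y :
  (forall i, (t <= i)%N -> th i = th' i) -> cw w t j th y = cw w t j th' y.
Proof.
by move=> ag; elim: j y => [//|j IH] y /=; rewrite IH ag// leq_addr.
Qed.

(** Conjugating the field forward in time is dual to conjugating the test matrix backward, down to
    the bare generator present at time $s_l+1$. *)
Lemma HS_field th (l : 'I_N) k y :
  HS (u th l ((s l).+1 + k)) y =
  HS (rotation_gen (pl l)) (cw (fun i => pl (idx ((s l).+1 + i)%N)) (s l).+1 k th y).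
Proof.
elim: k y => [|k IH] y; first by rewrite addn0 field1.
rewrite addnS fieldS; last by rewrite addSn ltnS leq_addr.
by rewrite HS_conj IH.
Qed.

Variable Lw : probability (angles R) R.
Hypothesis Lbox : forall k (B : nat -> set R), (forall j, measurable (B j)) ->
  (forall j, (k <= j)%N -> B j = setT) ->
  Lw (box B) = (\prod_(j <- iota 0 k) uniform_prob (@two_pi_gt0 R) (B j))%E.

Variables (K eps : R).
Hypothesis eps0 : 0 < eps.
Hypothesis eps1 : eps <= 1.
Hypothesis K0 : 0 <= K.

Local Notation T := (end_time Q idx).

Definition tail_event (l : 'I_N) : set (angles R) :=
  [set th | close_to_tail eps (fun j => u th j T) l].

Hypothesis windows_good : forall l : 'I_N,
  good K (run (fun j => pl (idx ((s l).+1 + j)%N)) L (weights (pl l) (fun _ => pl l) 0)).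

(** The matrix [y'] is the normal [y] carried back from the end time to the end of the window by
    angles that stay fixed. The window ends before $s_{l+1}$, so the fields with $j>l$ are fixed as
    well; pairing with [y] removes them and leaves twice the target entry of [y'] pulled back
    through the window. *)
Lemma tail_event_prob (l : 'I_N) : measurable (tail_event l) ->
  (Lw (tail_event l) <= (K * (regpow (eps ^+ 2) n%:R^-1 / regpow (eps ^+ 2) eps))%:E)%E.
Proof.
move=> mD; have r0 : 0 < regpow (eps ^+ 2) eps by rewrite powR_gt0// addr_gt0// exprn_gt0.
have bound0 : 0 <= K * (regpow (eps ^+ 2) n%:R^-1 / regpow (eps ^+ 2) eps).
  by rewrite mulr_ge0// divr_ge0 ?regpow_ge0// ltW.
(* The last plane has no later fields and no window before the end time; its field is a bare
   generator, of squared norm $2>\varepsilon^2$. *)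
have [lN|Nl] := ltnP l.+1 N; last first.
  have -> : tail_event l = set0; last by rewrite measure0 lee_fin.
  rewrite -subset0 => th [q]; rewrite /tail_comb big1; last first.
    by move=> j lj; have := leq_trans (ltn_ord j) (leq_trans Nl lj); rewrite ltnn.
  have TE : T = (s l).+1.
    rewrite /end_time; congr (s _).+1; have := ltn_ord l; lia.
  rewrite addr0 TE field1 /nrm2 HS_gen//; last exact: tr_rotation_gen.
  rewrite !mxE !eqxx (negbTE (pl_neq _)) /= subr0 mulr1.
  have : eps ^+ 2 <= 1 by rewrite exprn_ile1// ltW.
  lra.
apply: (law_le_iter_resample Lbox (t := (s l).+1 + L)) => // th.
have [y [yT y1 yu]] := exists_normal pl_inj pl_lt (fun j => u th j T) l.
pose w i := pl (idx ((s l).+1 + i)%N).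
have LT : ((s l).+1 + L <= T)%N.
  apply: leq_trans (marked_window lN) _; rewrite /end_time.
  have lt : (l.+1 <= N.-1)%N by lia.
  apply: ltnW; rewrite ltnS; move: lt; rewrite leq_eqVlt => /predU1P[->//|lt].
  have NN : (N.-1 < N)%N by lia.
  by apply: leq_trans (marked_window_lt lt NN); rewrite addSn leqW// leq_addr.
pose k := (T - ((s l).+1 + L))%N.
pose y' := cw (fun i => w (L + i)%N) ((s l).+1 + L) k th y.
have y'T : y'^T = - y' by rewrite /y'; exact: tr_conj_walk.
have y'1 : nrm2 y' = 1 by rewrite /y' nrm2_conj_walk// => i; exact: pl_neq.
have [x [z [xz yxz]]] := exists_large_entry y'T y'1.
have := windows_good l; set a := run _ _ _ => /forallP/(_ x)/forallP/(_ z).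
have aE : a = weights (pl l) w L by rewrite (weights_run _ w L).
rewrite xz aE /= => /andP[a0 aK].
have w12 i : (w i).1 != (w i).2 by exact: pl_neq.
have small := @iter_resample_small R n (tail_event l) (pl l) w (s l).+1 L eps th y' mD w12 eps0 y'T.
apply: le_trans (small _ x z xz a0) _ => //.
  move=> th' [q Hq] ag.
  have y'E : y' = cw (fun i => w (L + i)%N) ((s l).+1 + L) k th' y.
    by apply: conj_walk_agree => i it; rewrite ag.
  have HSE : HS (u th' l T) y = 2 * (cw w (s l).+1 L th' y') (pl l).1 (pl l).2.
    have TE : T = ((s l).+1 + (L + k))%N by rewrite addnA subnKC.
    rewrite [in LHS]TE HS_field conj_walkD -/w -y'E HS_gen//.
    exact: tr_conj_walk.
  have HSt : HS (tail_comb (fun j => u th' j T) (fun j => ratr (q j)) l) y = HS (u th' l T) y.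
    rewrite /tail_comb HSDl HS_suml big1 ?addr0// => j lj; rewrite HSZl.
    rewrite (@field_agree th' th) ?yu ?mulr0// => i si; apply: ag.
    by apply: leq_trans (marked_window_lt lj (ltn_ord j)) (ltnW si).
  have := HS_small eps0 Hq y1; rewrite HSt HSE normrM ger0_norm//.
  move: (`|_|) => c c2; have c3 : c <= eps / 2 by rewrite ler_pdivlMr// mulrC.
  by apply: le_lt_trans c3 _; rewrite ltr_pdivrMr// ltr_pMr// ltr1n.
rewrite lee_fin ler_pM// ?divr_ge0 ?regpow_ge0 ?(ltW r0)//.
rewrite ler_wpM2r ?invr_ge0 ?(ltW r0)//.
by apply: regpow_antitone => //; rewrite exprn_gt0.
Qed.

End FieldStructure.

(** * Measurability and the singular event *)

Section MatrixMeasurability.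
Context {R : realType} {d : measure_display} {T : measurableType d}.

Lemma measurable_big_sum (I : Type) (s : seq I) (Pr : pred I) (F : I -> T -> R) :
  (forall k, measurable_fun setT (F k)) -> measurable_fun setT (fun w => \sum_(k <- s | Pr k) F k w).
Proof.
move=> mF; elim: s => [|k s IH].
  by under eq_fun do rewrite big_nil; exact: measurable_cst.
under eq_fun do rewrite big_cons; case: (Pr k) => //.
exact: measurable_funD.
Qed.

Lemma measurable_big_prod (I : Type) (s : seq I) (Pr : pred I) (F : I -> T -> R) :
  (forall k, measurable_fun setT (F k)) -> measurable_fun setT (fun w => \prod_(k <- s | Pr k) F k w).
Proof.
move=> mF; elim: s => [|k s IH].
  by under eq_fun do rewrite big_nil; exact: measurable_cst.
under eq_fun do rewrite big_cons; case: (Pr k) => //.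
exact: measurable_funM.
Qed.

Definition mxmeasurable m n (F : T -> 'M[R]_(m, n)) := forall a b, measurable_fun setT (fun w => F w a b).

Lemma mxmeasurable_cst m n (A : 'M[R]_(m, n)) : mxmeasurable (fun=> A).
Proof. by move=> a b; exact: measurable_cst. Qed.

Lemma mxmeasurableD m n (F G : T -> 'M[R]_(m, n)) : mxmeasurable F -> mxmeasurable G ->
  mxmeasurable (fun w => F w + G w).
Proof. by move=> mF mG a b; under eq_fun do rewrite mxE; exact: measurable_funD. Qed.

Lemma mxmeasurableZ m n c (F : T -> 'M[R]_(m, n)) : mxmeasurable F -> mxmeasurable (fun w => c *: F w).
Proof.
by move=> mF a b; under eq_fun do rewrite mxE; apply: measurable_funM => //; exact: measurable_cst.
Qed.

Lemma mxmeasurable_sum m n (I : Type) (s : seq I) (Pr : pred I) (F : I -> T -> 'M[R]_(m, n)) :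
  (forall k, mxmeasurable (F k)) -> mxmeasurable (fun w => \sum_(k <- s | Pr k) F k w).
Proof.
move=> mF a b; under eq_fun do rewrite summxE.
by apply: measurable_big_sum => k; exact: mF.
Qed.

Lemma mxmeasurableM m n p (F : T -> 'M[R]_(m, n)) (G : T -> 'M[R]_(n, p)) :
  mxmeasurable F -> mxmeasurable G -> mxmeasurable (fun w => F w *m G w).
Proof.
move=> mF mG a b; under eq_fun do rewrite mxE.
by apply: measurable_big_sum => k; exact: measurable_funM.
Qed.

Lemma mxmeasurable_tr m n (F : T -> 'M[R]_(m, n)) : mxmeasurable F -> mxmeasurable (fun w => (F w)^T).
Proof. by move=> mF a b; under eq_fun do rewrite mxE; exact: mF. Qed.

Lemma measurable_HS n (F G : T -> 'M[R]_n) : mxmeasurable F -> mxmeasurable G ->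
  measurable_fun setT (fun w => HS (F w) (G w)).
Proof.
move=> mF mG; under eq_fun do rewrite HSE.
by do 2 (apply: measurable_big_sum => ?); exact: measurable_funM.
Qed.

Lemma measurable_det n (F : T -> 'M[R]_n) : mxmeasurable F -> measurable_fun setT (fun w => \det (F w)).
Proof.
move=> mF; rewrite /determinant; apply: measurable_big_sum => s.
apply: measurable_funM; first exact: measurable_cst.
by apply: measurable_big_prod => k; exact: mF.
Qed.

Lemma mxmeasurable_rotation n (p : 'I_n * 'I_n) (f : T -> R) : measurable_fun setT f ->
  mxmeasurable (fun w => rotation p (f w)).
Proof.
move=> mf a b; under eq_fun do rewrite mxE.
have ms : measurable_fun setT (fun w => sin (f w)).
  by apply: measurableT_comp mf; apply: continuous_measurable_fun; exact: continuous_sin.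
have mc : measurable_fun setT (fun w => cos (f w)).
  by apply: measurableT_comp mf; apply: continuous_measurable_fun; exact: continuous_cos.
case: ((a == p.1) && (b == p.1) || (a == p.2) && (b == p.2)) => //.
case: ((a == p.1) && (b == p.2)) => //; case: ((a == p.2) && (b == p.1)) => //.
  exact: measurableT_comp ms.
exact: measurable_cst.
Qed.

Lemma measurable_ltr_set (f g : T -> R) : measurable_fun setT f -> measurable_fun setT g ->
  measurable [set w | f w < g w].
Proof.
move=> mf mg; rewrite -[X in measurable X]setTI.
have -> : [set w | f w < g w] = (fun w => f w < g w) @^-1` [set true] by [].
exact: measurable_fun_ltr mf mg measurableT _ _.
Qed.

(* By compactness of [[0, r]] it suffices to test the grid points [r j / (m + 1)]. *)
Lemma measurable_singular_le N (G : T -> 'M[R]_N) (r : R) : 0 < r -> mxmeasurable G ->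
  measurable [set w | exists s, [/\ 0 <= s, s <= r & \det ((s ^+ 2)%:M - G w) = 0]].
Proof.
move=> r0 mG.
pose grid (m j : nat) : R := r * (minn j m)%:R / m.+1%:R.
pose D s w := `|\det ((s ^+ 2)%:M - G w)|.
have -> : [set w | exists s, [/\ 0 <= s, s <= r & \det ((s ^+ 2)%:M - G w) = 0]] =
    \bigcap_k \bigcup_m \bigcup_j [set w | D (grid m j) w < (k.+1%:R)^-1].
  apply/seteqP; split=> w.
    move=> [s [s0 sr ds]] k _.
    have := @continuous_det_sqr _ _ (G w) s => /cvgrPdist_lt/(_ (k.+1%:R^-1)).
    rewrite invr_gt0 ltr0n => /(_ isT) [e /= e0 He].
    have [m [r1 r2]] : exists m : nat, r / m.+1%:R < e /\ True.
      exists (Num.bound (r / e)); split => //.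
      rewrite ltr_pdivrMr ?ltr0n// mulrC -ltr_pdivrMr//.
      apply: lt_trans (archi_boundP _) _; first by rewrite divr_ge0// ltW.
      by rewrite ltr_nat.
    pose x := s * m.+1%:R / r.
    have x0 : 0 <= x by rewrite divr_ge0 ?mulr_ge0 ?(ltW r0).
    have xm : x <= m.+1%:R by rewrite ler_pdivrMr// mulrC ler_wpM2l.
    pose j := minn (Num.truncn x) m.
    have jx : j%:R <= x.
      by apply: (@le_trans _ _ (Num.truncn x)%:R); rewrite ?ler_nat ?geq_minl ?truncn_le.
    have xj : x <= j%:R + 1.
      rewrite /j; case: (leqP (Num.truncn x) m) => h.
        by rewrite natr1 ltW// truncnS_gt.
      by rewrite natr1.
    exists m => //; exists j => //=.
    have M0 : 0 < m.+1%:R :> R by rewrite ltr0n.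
    have sx : s = r * x / m.+1%:R by rewrite /x; field; rewrite !lt0r_neq0.
    have -> : grid m j = r * j%:R / m.+1%:R by rewrite /grid (_ : minn j m = j)//; apply/minn_idPl; exact: geq_minr.
    have := He (r * j%:R / m.+1%:R); rewrite /ball_/= ds sub0r normrN; apply.
    rewrite [in ltLHS]sx -mulrBl -mulrBr normrM normrM (gtr0_norm r0) (gtr0_norm (_ : 0 < _^-1)) ?invr_gt0//.
    apply: le_lt_trans r1; rewrite ler_wpM2r ?invr_ge0 ?(ltW M0)// -[leRHS]mulr1 ler_wpM2l ?(ltW r0)//.
    by rewrite ger0_norm; lra.
  move=> H.
  have [c cin cmin] := @EVT_min R (fun s => `|\det ((s ^+ 2)%:M - G w)|) 0 r (ltW r0)
    (continuous_subspaceT (fun s => continuous_comp (@continuous_det_sqr _ _ (G w) s) (@norm_continuous _ _ _))).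
  move: cin; rewrite in_itv /= => /andP[c0 cr].
  exists c; split => //; apply/eqP; rewrite -normr_eq0; apply/negP => /negP dn0.
  have d0 : 0 < `|\det ((c ^+ 2)%:M - G w)| by rewrite lt_def dn0 normr_ge0.
  set del := `|_| in d0 dn0 cmin.
  have [m _ [j _ /=]] := H (Num.bound del^-1) I.
  rewrite ltNge => /negP; apply.
  apply: le_trans (cmin _ _); last first.
    rewrite in_itv /= divr_ge0 ?mulr_ge0 ?(ltW r0)//= ler_pdivrMr ?ltr0n// ler_wpM2l ?(ltW r0)// ler_nat.
    by rewrite (leq_trans (geq_minr _ _)).
  rewrite -[leRHS]invrK lef_pV2 ?posrE ?invr_gt0 ?ltr0n//.
  apply: le_trans (ltW (archi_boundP _)) _; first by rewrite invr_ge0 ltW.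
  by rewrite ler_nat.
apply: bigcapT_measurable => k; apply: bigcupT_measurable => m; apply: bigcupT_measurable => j.
apply: measurable_ltr_set; last exact: measurable_cst.
apply: measurableT_comp => //; apply: measurable_det; apply: mxmeasurableD; first exact: mxmeasurable_cst.
by under [X in mxmeasurable X]eq_fun do rewrite -scaleN1r; exact: mxmeasurableZ.
Qed.

End MatrixMeasurability.

(** * The singular event for a fixed index sequence *)

Section AngleEvent.
Context {R : realType} (Q : R) (n : nat).
Local Notation N := (nplanes n).
Variables (pl : 'I_N -> 'I_n * 'I_n) (idx : nat -> 'I_N).

Definition gram (th : angles R) : 'M[R]_N :=
  \matrix_(i, j) HS (field Q pl idx th i (end_time Q idx)) (field Q pl idx th j (end_time Q idx)).

Definition singular_event (r : R) : set (angles R) :=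
  [set th | exists s, [/\ 0 <= s, s <= r & \det ((s ^+ 2)%:M - gram th) = 0]].

Lemma mxmeasurable_field l t : mxmeasurable (fun th : angles R => field Q pl idx th l t).
Proof.
elim: t => [|t IH] /=; first exact: mxmeasurable_cst.
have mr : mxmeasurable (fun th : angles R => rotation (pl (idx t)) (th t)).
  by apply: mxmeasurable_rotation; exact: measurable_coord.
apply: mxmeasurableD; first exact: mxmeasurable_cst.
by apply: mxmeasurableM; [exact: mxmeasurableM | exact: mxmeasurable_tr].
Qed.

Lemma measurable_singular_event r : 0 < r -> measurable (singular_event r).
Proof.
move=> r0; apply: measurable_singular_le => // a b.
have -> : (fun th => gram th a b) = (fun th => HS (field Q pl idx th a (end_time Q idx))
    (field Q pl idx th b (end_time Q idx))) by apply/funext => th; rewrite mxE.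
by apply: measurable_HS; exact: mxmeasurable_field.
Qed.

Lemma measurable_tail_event eps l : measurable (tail_event Q pl idx eps l).
Proof.
have -> : tail_event Q pl idx eps l = \bigcup_k
   (if @unpickle {ffun 'I_N -> rat} k is Some q then
     [set th : angles R | nrm2 (tail_comb (fun j => field Q pl idx th j (end_time Q idx)) (fun j => ratr (q j)) l) < eps ^+ 2]
    else set0).
  apply/seteqP; split=> th.
    by move=> [q Hq]; exists (pickle q) => //; rewrite pickleK.
  by move=> [k _]; case: unpickle => // q Hq; exists q.
apply: bigcupT_measurable => k; case: unpickle => [q|]; last exact: measurable0.
apply: measurable_ltr_set; last exact: measurable_cst.
have mt : mxmeasurable (fun th : angles R => tail_comb (fun j => field Q pl idx th j (end_time Q idx)) (fun j => ratr (q j)) l).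
  apply: mxmeasurableD; first exact: mxmeasurable_field.
  by apply: mxmeasurable_sum => j; apply: mxmeasurableZ; exact: mxmeasurable_field.
exact: measurable_HS.
Qed.

(** An eigenvector of the Gram matrix for $s^2$ gives coefficients whose combination has squared
    norm exactly $s^2|v|^2$. *)
Lemma singular_eventP r th : singular_event r th -> exists v : 'I_N -> R,
  0 < \sum_l v l ^+ 2 /\
  nrm2 (\sum_l v l *: field Q pl idx th l (end_time Q idx)) <= r ^+ 2 * \sum_l v l ^+ 2.
Proof.
move=> [s [s0 sr /eqP/det0P[v v0 vG]]].
exists (v 0); have v2 : 0 < \sum_l v 0 l ^+ 2.
  rewrite lt_def sumr_ge0 ?andbT; last by move=> *; exact: sqr_ge0.
  by apply: contra v0 => /eqP v2; apply/eqP/sum_sqr_eq0; rewrite v2.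
split => //.
have sr2 : s ^+ 2 <= r ^+ 2 by rewrite ler_pXn2r ?nnegrE ?(le_trans s0 sr).
apply: le_trans (ler_wpM2r (ltW v2) sr2).
rewrite le_eqVlt; apply/orP; left; apply/eqP.
have vE j : \sum_i v 0 i * gram th i j = s ^+ 2 * v 0 j.
  have E : v *m gram th = s ^+ 2 *: v.
    by apply/eqP; rewrite eq_sym -subr_eq0 -mul_mx_scalar -mulmxBr vG.
  transitivity ((v *m gram th) 0 j); first by rewrite [RHS]mxE.
  by rewrite E mxE.
pose u l := field Q pl idx th l (end_time Q idx).
have gE i j : gram th i j = HS (u i) (u j) by rewrite mxE.
change (nrm2 (\sum_l v 0 l *: u l) = s ^+ 2 * \sum_l v 0 l ^+ 2).
move: u gE => u gE; rewrite /nrm2 HS_suml mulr_sumr.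
rewrite (eq_bigr (fun i => \sum_j v 0 i * (v 0 j * HS (u i) (u j)))); last first.
  move=> i _; rewrite HSZl HSC HS_suml mulr_sumr; apply: eq_bigr => j _.
  by rewrite HSZl HSC.
rewrite exchange_big /=; apply: eq_bigr => j _.
rewrite [RHS](_ : _ = v 0 j * (s ^+ 2 * v 0 j)); last by rewrite expr2; ring.
rewrite -vE mulr_sumr; apply: eq_bigr => i _; rewrite gE; ring.
Qed.

Hypothesis n2 : (2 <= n)%N.
Hypothesis Q0 : 0 <= Q.
Hypothesis pl_inj : injective pl.
Hypothesis pl_lt : forall i, ((pl i).1 < (pl i).2)%N.
Hypothesis rec : recurrent idx.
Variable L : nat.
Hypothesis L_gap : L.+1%:R <= Q * n%:R ^+ 2 * ln n%:R.
Variable Lw : probability (angles R) R.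
Hypothesis Lbox : forall k (B : nat -> set R), (forall j, measurable (B j)) ->
  (forall j, (k <= j)%N -> B j = setT) ->
  Lw (box B) = (\prod_(j <- iota 0 k) uniform_prob (@two_pi_gt0 R) (B j))%E.
Variables (K eps r delta : R).
Hypothesis eps0 : 0 < eps.
Hypothesis eps1 : eps <= 1.
Hypothesis K0 : 0 <= K.
Hypothesis windows_good : forall l : 'I_N,
  good K (run (fun j => pl (idx ((marked_time Q idx l).+1 + j)%N)) L (weights (pl l) (fun _ => pl l) 0)).
Hypothesis r0 : 0 < r.
Hypothesis small : N%:R * (20 / eps ^+ 2) ^+ N * r ^+ 2 < 1.
Hypothesis deltaE : K * (regpow (eps ^+ 2) n%:R^-1 / regpow (eps ^+ 2) eps) <= delta.

Lemma singular_event_prob : (Lw (singular_event r) <= (N%:R * delta)%:E)%E.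
Proof.
have mt l := measurable_tail_event eps l.
apply: (@le_trans _ _ (Lw (\big[setU/set0]_(l < N) tail_event Q pl idx eps l))).
  apply: le_measure; rewrite ?inE.
  - exact: measurable_singular_event.
  - exact: bigsetU_measurable.
  - move=> th /singular_eventP[v [v0 vu]]; apply/bigsetU_ordP.
    apply: small_combination small _ v0 vu => // l.
    exact: (nrm2_field n2 Q0 pl_lt rec L_gap).
apply: le_trans (measure_bigsetU_le _ _) _ => //.
apply: (@le_trans _ _ (\sum_(l < N) delta%:E)%E); last first.
  by rewrite sumEFin sumr_const card_ord mulr_natl.
apply: lee_sum => l _.
apply: le_trans (tail_event_prob n2 Q0 pl_inj pl_lt rec L_gap Lbox eps0 eps1 K0 windows_good (mt l)) _.
by rewrite lee_fin.
Qed.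

End AngleEvent.

Section AngleLaw.
Context {d : measure_display} {T : measurableType d} {R : realType} (P : probability T R).
Variable eta : nat -> {RV P >-> R}.
Hypothesis iid : iid_uniform_angle eta.

Definition angle_seq (w : T) : angles R := fun t => eta t w.

Lemma angle_law_exists : exists Lw : probability (angles R) R,
  (forall A, Lw A = P (angle_seq @^-1` A)) /\
  forall k (B : nat -> set R), (forall j, measurable (B j)) ->
  (forall j, (k <= j)%N -> B j = setT) ->
  Lw (box B) = (\prod_(j <- iota 0 k) uniform_prob (@two_pi_gt0 R) (B j))%E.
Proof.
have ma : measurable_fun setT angle_seq.
  by apply: measurable_to_angles => t; exact: measurable_funP.
pose f : {RV P >-> angles R} := HB.pack angle_seq (isMeasurableFun.Build _ _ _ _ _ ma).
exists (distribution P f); split=> // k B mB Bk.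
have [unif ind] := iid.
have := ind (iota 0 k) (fun j => eta j @^-1` B j) (iota_uniq 0 k).
have -> : \bigcap_(j in [set` iota 0 k]) (eta j @^-1` B j) = f @^-1` box B.
  apply/seteqP; split=> w /=.
    move=> H j; have [jk|kj] := ltnP j k; last by rewrite Bk.
    by apply: H; rewrite /= mem_iota.
  by move=> H j _; exact: H.
move=> H; apply: etrans (H _) _; first by move=> j _; exists (B j).
by apply: eq_bigr => j _; rewrite -(unif j _ (mB j)).
Qed.

End AngleLaw.

(** * Conditioning on the indices *)

Section FirstTime.
Context {d : measure_display} {T : measurableType d}.

Lemma measurable_first_time (p : T -> pred nat) s :
  (forall t, measurable [set w | p w t]) -> measurable [set w | first_time (p w) = s].
Proof.
move=> mp.
(* The default value of [first_time] adds, for [s = 0], the event that no time qualifies. *)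
have -> : [set w | first_time (p w) = s] =
    ([set w | p w s] `&` \bigcap_t (if (t < s)%N then ~` [set w | p w t] else setT)) `|`
    (if s == 0%N then \bigcap_t ~` [set w | p w t] else set0).
  apply/seteqP; split=> w.
    move=> /= <-; rewrite /first_time; case: pselect => [h|h]; last first.
      by right => t _ /= pt; apply: h; exists t.
    case: ex_minnP => m pm mm; left; split => // t _; case: ifP => // tm /= pt.
    by have := mm t pt; rewrite leqNgt tm.
  case=> [[/= ps H]|].
    have ex : exists t, p w t by exists s.
    have [pf mf] := first_timeP ex; apply/eqP; rewrite eqn_leq mf//= leqNgt.
    by apply/negP => fs; have := H (first_time (p w)) I; rewrite fs /=.
  case: eqP => // -> H /=; rewrite /first_time; case: pselect => // -[t pt].
  by have := H t I; rewrite /= pt.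
apply: measurableU.
  apply: measurableI => //; apply: bigcapT_measurable => t; case: ifP => // _.
  exact: measurableC.
case: ifP => // _; apply: bigcapT_measurable => t; exact: measurableC.
Qed.

Lemma measurable_map_iota (f : nat -> T -> nat) m (c : seq nat) :
  (forall t s, measurable [set w | f t w = s]) ->
  measurable [set w | [seq f t w | t <- iota 0 m] = c].
Proof.
move=> mf; have [cm|cm] := eqVneq (size c) m; last first.
  rewrite [X in measurable X](_ : _ = set0)//; apply/seteqP; split=> w //= E.
  by move: cm; rewrite -E size_map size_iota eqxx.
have -> : [set w | [seq f t w | t <- iota 0 m] = c] =
    \bigcap_t (if (t < m)%N then [set w | f t w = nth 0%N c t] else setT).
  apply/seteqP; split=> w /=.
    move=> <- t _; case: ifP => // tm /=.
    by rewrite (nth_map 0%N) ?size_iota// nth_iota.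
  move=> H; apply: (@eq_from_nth _ 0%N); first by rewrite size_map size_iota.
  move=> t; rewrite size_map size_iota => tm.
  by have := H t I; rewrite tm (nth_map 0%N) ?size_iota// nth_iota.
by apply: bigcapT_measurable => t; case: ifP.
Qed.

End FirstTime.

Section Code.
Context {R : realType} (Q : R) (n : nat).
Local Notation N := (nplanes n).
Local Notation gap := (Q * n%:R ^+ 2 * ln n%:R).

(* The part of an index sequence on which the Gram matrix of the Jacobian depends. *)
Definition index_code (idx : nat -> 'I_N) : seq nat * seq nat :=
  ([seq marked_time Q idx l | l <- iota 0 N.-1.+1],
   [seq nat_of_ord (idx t) | t <- iota 0 (end_time Q idx)]).

Section Measurability.
Context {d : measure_display} {T : measurableType d}.
Variable i : nat -> T -> 'I_N.
Hypothesis mi : forall t k, measurable (i t @^-1` [set k]).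

Lemma measurable_index_nat t (k : nat) : measurable [set w | i t w = k :> nat].
Proof.
have [kN|Nk] := ltnP k N.
  have -> : [set w | i t w = k :> nat] = i t @^-1` [set Ordinal kN] => //.
  by apply/seteqP; split=> w /= E; [exact: val_inj|rewrite E].
rewrite [X in measurable X](_ : _ = set0)//; apply/seteqP; split=> w //= E.
by have := ltn_ord (i t w); rewrite E ltnNge Nk.
Qed.

Lemma measurable_marked_time l s : measurable [set w | marked_time Q (i^~ w) l = s].
Proof.
elim: l s => [|l IH] s.
  apply: measurable_first_time => t.
  have -> : [set w | i t w == 0%N :> nat] = [set w | i t w = 0%N :> nat].
    by apply/seteqP; split=> w /= /eqP.
  exact: measurable_index_nat.
have -> : [set w | marked_time Q (i^~ w) l.+1 = s] = \bigcup_m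
    ([set w | marked_time Q (i^~ w) l = m] `&`
     [set w | first_time (fun t => (m%:R + gap <= t%:R) && (i t w == l.+1 :> nat)) = s]).
  apply/seteqP; split=> w; first by move=> E; exists (marked_time Q (i^~ w) l).
  by move=> [m _ [/= -> ]].
apply: bigcupT_measurable => m; apply: measurableI => //.
apply: measurable_first_time => t; case: (_ <= _) => /=; last first.
  rewrite [X in measurable X](_ : _ = set0)//; by apply/seteqP; split.
have -> : [set w | i t w == l.+1 :> nat] = [set w | i t w = l.+1 :> nat].
  by apply/seteqP; split=> w /= /eqP.
exact: measurable_index_nat.
Qed.

Lemma measurable_index_code c : measurable [set w | index_code (i^~ w) = c].
Proof.
have -> : [set w | index_code (i^~ w) = c] =
    [set w | [seq marked_time Q (i^~ w) l | l <- iota 0 N.-1.+1] = c.1] `&`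
    \bigcup_e ([set w | marked_time Q (i^~ w) N.-1 = e] `&`
      [set w | [seq nat_of_ord (i t w) | t <- iota 0 e.+1] = c.2]).
  apply/seteqP; split=> w.
    by move=> /= <-; split => //; exists (marked_time Q (i^~ w) N.-1).
  case: c => c1 c2 [/= H [e _ [/= eE eH]]]; congr pair => //.
  by rewrite /end_time eE.
apply: measurableI; first exact: measurable_map_iota measurable_marked_time.
apply: bigcupT_measurable => e; apply: measurableI; first exact: measurable_marked_time.
apply: (measurable_map_iota (f := fun t w => nat_of_ord (i t w))).
exact: measurable_index_nat.
Qed.

End Measurability.

Lemma index_code_marked idx idx' l : index_code idx = index_code idx' ->
  (l < N.-1.+1)%N -> marked_time Q idx l = marked_time Q idx' l.
Proof.
move=> E lN; have := congr1 (fun c => nth 0%N c.1 l) E; rewrite /index_code [in LHS]/fst [in RHS]/fst.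
by rewrite !(nth_map 0%N) ?size_iota// !nth_iota.
Qed.

Lemma index_code_end idx idx' : index_code idx = index_code idx' ->
  end_time Q idx = end_time Q idx'.
Proof. by move=> E; rewrite /end_time (index_code_marked E). Qed.

Lemma index_code_idx idx idx' t : index_code idx = index_code idx' ->
  (t < end_time Q idx)%N -> idx t = idx' t.
Proof.
move=> E te; apply: val_inj; have := congr1 (fun c => nth 0%N c.2 t) E; rewrite /index_code [in LHS]/snd [in RHS]/snd.
by rewrite !(nth_map 0%N) ?size_iota -?(index_code_end E)// !nth_iota// -(index_code_end E).
Qed.

Lemma index_code_singular_event pl idx idx' r : index_code idx = index_code idx' ->
  singular_event Q pl idx r = singular_event Q pl idx' r.
Proof.
move=> E; suff H th l t : (t <= end_time Q idx)%N -> field Q pl idx th l t = field Q pl idx' th l t.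
  have gE th : gram Q pl idx th = gram Q pl idx' th.
    by apply/matrixP => a b; rewrite !mxE -(index_code_end E) !H.
  by apply/seteqP; split=> th [s Hs]; exists s; move: Hs; rewrite gE.
elim: t => [//|t IH] te.
have mE : mark Q idx t = mark Q idx' t.
  rewrite /mark; apply: eq_pick => k /=; rewrite (index_code_marked E)//.
  by rewrite prednK ?ltn_ord// (leq_ltn_trans (leq0n k) (ltn_ord k)).
change (field Q pl idx th l t.+1) with
  ((if mark Q idx t == Some l then rotation_gen (pl (idx t)) else 0)
      + rotation (pl (idx t)) (th t) *m field Q pl idx th l t *m (rotation (pl (idx t)) (th t))^T).
by rewrite IH ?(ltnW te)// (index_code_idx E te) mE.
Qed.

End Code.

(** Conditioning on a countably valued quantity, done by summing over its fibres. Measurability of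
    [E] is asked for fibre by fibre, since only there does the singular event become an event on the
    angles alone. *)
Lemma le_measure_fibers {d : measure_display} {T : measurableType d} {R : realType}
    (P : probability T R) (c : T -> nat) (E U : set T) (x : R) : 0 <= x ->
  (forall k, measurable (c @^-1` [set k])) -> measurable U ->
  (forall k, measurable (E `&` c @^-1` [set k])) ->
  (forall k, P (E `&` c @^-1` [set k]) <=
     P (U `&` c @^-1` [set k]) + x%:E * P (c @^-1` [set k]))%E ->
  (P E <= P U + x%:E)%E.
Proof.
move=> x0 mc mU mE le.
have split_fibers (A : set T) : (forall k, measurable (A `&` c @^-1` [set k])) ->
    P A = (\sum_(0 <= k <oo) P (A `&` c @^-1` [set k]))%E.
  move=> mA; have AE : A = \bigcup_k (A `&` c @^-1` [set k]).
    by apply/seteqP; split=> w; [move=> Aw; exists (c w) | move=> [k _ []]].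
  rewrite {1}AE measure_semi_bigcup//.
    apply/trivIsetP => j k _ _ /eqP jk; rewrite -subset0 => w [[_ /= wj] [_ /= wk]].
    by apply: jk; rewrite -wj.
  exact: bigcupT_measurable.
rewrite (split_fibers E)// (split_fibers U); last by move=> k; exact: measurableI.
have -> : x%:E = (x%:E * P setT)%E by rewrite probability_setT mule1.
rewrite (split_fibers setT) => [|k]; last by rewrite setTI.
under [X in (_ <= _ + _ * X)%E]eq_eseriesr do rewrite setTI.
rewrite -nneseriesZl => [|k _]; last exact: measure_ge0.
rewrite -nneseriesD => [|k _ _|k _ _]; [|exact: measure_ge0|by rewrite mule_ge0// measure_ge0].
by apply: lee_nneseries => k _ //; exact: measure_ge0.
Qed.

Lemma g_sigma_measurable (T : pointedType) (G : set_system T) (A : set (g_sigma_algebraType G)) :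
  measurable A = <<s G >> A.
Proof. by []. Qed.

(** * Combining indices and angles *)

Section SingularJacobian.
Context {d : measure_display} {T : measurableType d} {R : realType} (P : probability T R).
Variables (Q : R) (n : nat) (pl : 'I_(nplanes n) -> 'I_n * 'I_n).
Local Notation N := (nplanes n).
Variables (i : nat -> T -> 'I_N) (eta : nat -> {RV P >-> R}).
Variables (X : 'M[R]_n) (b : T -> 'I_N -> 'M[R]_n).

Hypothesis n2 : (2 <= n)%N.
Hypothesis Q0 : 0 <= Q.
Hypothesis pl_ord : plane_ordering pl.
Hypothesis iid_i : iid_uniform_index P i.
Hypothesis iid_eta : iid_uniform_angle eta.
Hypothesis indep : independent_sequences i eta.
Hypothesis SOX : SO X.
Hypothesis basis : forall w, orthonormal_basis (tangent_SO (random_rotmap Q pl i eta X w 0)) (b w).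

Let pl_inj : injective pl. Proof. by case: pl_ord. Qed.
Let pl_lt k : ((pl k).1 < (pl k).2)%N.
Proof. by have [_ H] := pl_ord; apply/H; exists k. Qed.
Let pl_neq k : (pl k).1 != (pl k).2.
Proof. by apply/eqP => E; have := pl_lt k; rewrite E ltnn. Qed.

Lemma sigma1_jac_le w r :
  sigma1 (random_jac Q pl i eta X b w) <= r <-> singular_event Q pl (i^~ w) r (angle_seq eta w).
Proof.
have N0 : (0 < N)%N by have [inj im] := pl_ord; exact: N_gt0 n2 inj im.
have -> : sigma1 (random_jac Q pl i eta X b w) <= r <->
    exists s, [/\ 0 <= s, s <= r & \det ((s ^+ 2)%:M - (random_jac Q pl i eta X b w)^T *m random_jac Q pl i eta X b w) = 0].
  exact: sigma1_le.
by rewrite /random_jac (jac_gram pl_neq SOX (basis w)).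
Qed.

Lemma index_code_sigma c :
  <<s \bigcup_t sigma_index (i t) >> [set w | index_code Q (i^~ w) = c].
Proof.
rewrite -g_sigma_measurable.
apply: (@measurable_index_code R Q n _ (g_sigma_algebraType (\bigcup_t sigma_index (i t))) i).
by move=> t k; apply: sub_sigma_algebra; exists t => //; exists [set k].
Qed.

Lemma angle_seq_sigma (D : set (angles R)) : measurable D ->
  <<s \bigcup_t sigma_real (eta t) >> (angle_seq eta @^-1` D).
Proof.
move=> mD; rewrite -g_sigma_measurable -[X in measurable X]setTI.
apply: (@measurable_to_angles R _ (g_sigma_algebraType (\bigcup_t sigma_real (eta t)))) => //.
move=> t _ B mB; rewrite setTI; apply: sub_sigma_algebra; exists t => //; exists B => //.
Qed.

Variable L : nat.
Hypothesis L_gap : L.+1%:R <= Q * n%:R ^+ 2 * ln n%:R.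
Variables (K eps r beta delta : R).
Hypothesis eps0 : 0 < eps.
Hypothesis eps1 : eps <= 1.
Hypothesis K0 : 0 <= K.
Hypothesis r0 : 0 < r.
Hypothesis small : N%:R * (20 / eps ^+ 2) ^+ N * r ^+ 2 < 1.
Hypothesis delta0 : 0 <= delta.
Hypothesis deltaE : K * (regpow (eps ^+ 2) n%:R^-1 / regpow (eps ^+ 2) eps) <= delta.
Hypothesis beta0 : 0 <= beta.
Hypothesis betaE : forall l,
  avg pl L (fun a => (~~ good K a)%:R) (weights (pl l) (fun _ => pl l) 0) <= beta.

(** On a fibre of the index code the event is a fixed singular event for the angles, and
    independence turns its probability into a product. Bad indices contribute [N * beta], small
    entries [N * delta]. *)
Lemma sigma1_jac_prob :
  (P [set w | (sigma1 (random_jac Q pl i eta X b w) <= r)%R] <= (N%:R * (beta + delta))%:E)%E.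
Proof.
have N0 : (0 < N)%N by have [inj im] := pl_ord; exact: N_gt0 n2 inj im.
have [Lw [LwE Lbox]] := angle_law_exists iid_eta.
set U := bad_index Q i N0 pl (fun a => ~~ good K a) L (fun l => weights (pl l) (fun _ => pl l) 0).
have mU : measurable U by exact: (measurable_bad_index _ iid_i).
have PU : (P U <= (N%:R * beta)%:E)%E by exact: (bad_index_prob Q0 n2 iid_i).
have [mi _ _] := iid_i.
set E := [set w | _].
have mcode c : measurable [set w | index_code Q (i^~ w) = c] by exact: measurable_index_code.
pose code w := pickle (index_code Q (i^~ w)).
have codeP w w' : code w = code w' -> index_code Q (i^~ w) = index_code Q (i^~ w').
  exact: (pcan_inj pickleK).
have EF w w' : code w = code w' -> E w <-> (angle_seq eta @^-1` singular_event Q pl (i^~ w') r) w.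
  by move=> /codeP/index_code_singular_event H; rewrite /E /= sigma1_jac_le H.
have fiberE w : code @^-1` [set code w] = [set w' | index_code Q (i^~ w') = index_code Q (i^~ w)].
  by apply/seteqP; split=> w' /=; [exact: codeP | rewrite /code => ->].
have EfiberE w : E `&` code @^-1` [set code w] =
    code @^-1` [set code w] `&` angle_seq eta @^-1` singular_event Q pl (i^~ w) r.
  by apply/seteqP; split=> w' /= [] => [/EF H c|c /EF H]; split => //; exact: H.
have mS w : measurable (angle_seq eta @^-1` singular_event Q pl (i^~ w) r).
  rewrite -[X in measurable X]setTI; apply: (@measurable_to_angles R) => //.
  exact: measurable_singular_event.
have Efiber0 k : code @^-1` [set k] = set0 \/ exists w, k = code w.
  have [->|/set0P[w <-]] := eqVneq (code @^-1` [set k]) set0; first by left.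
  by right; exists w.
have mF k : measurable (code @^-1` [set k]).
  by have [->|[w ->]] := Efiber0 k; [exact: measurable0 | rewrite fiberE].
rewrite mulrDr EFinD.
apply: (le_trans _ (leeD PU (lexx _))).
apply: (le_measure_fibers (c := code)) => // [|k|k].
- by rewrite mulr_ge0.
- have [->|[w ->]] := Efiber0 k; first by rewrite setI0.
  by rewrite EfiberE; exact: measurableI.
have [->|[w0 ->]] := Efiber0 k.
  by rewrite !setI0 !measure0 mule0 adde0.
(* [U] involves indices beyond the code, such as the window after the last marked time, so it need
   not be a union of fibres. One outcome outside [U] suffices for its whole fibre, because the
   singular event depends only on the code. *)
have [sub|/existsNP[w /not_implyP[cw nU]]] := pselect (forall w, code w = code w0 -> U w).
  apply: (@le_trans _ _ (P (U `&` code @^-1` [set code w0]))).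
    apply: le_measure; rewrite ?inE; [by rewrite EfiberE; exact: measurableI|exact: measurableI|].
    by move=> w [Ew cw]; split => //; exact: sub.
  by rewrite leeDl// mule_ge0// lee_fin mulr_ge0.
rewrite -cw EfiberE fiberE.
have -> : P ([set w' | index_code Q (i^~ w') = index_code Q (i^~ w)] `&`
      angle_seq eta @^-1` singular_event Q pl (i^~ w) r) =
    (P [set w' | index_code Q (i^~ w') = index_code Q (i^~ w)] * Lw (singular_event Q pl (i^~ w) r))%E.
  apply: etrans (indep (index_code_sigma _) (angle_seq_sigma _)) _; last by rewrite -LwE.
  exact: measurable_singular_event.
rewrite -[X in (X <= _)%E]add0e muleC leeD// lee_wpmul2r//.
have [rec wg] := not_bad_index Q0 n2 nU.
apply: (singular_event_prob n2 Q0 pl_inj pl_lt rec L_gap Lbox eps0 eps1 K0) => //.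
by move=> l; apply/negPn/negP; exact: wg.
Qed.

End SingularJacobian.

(** * Choice of the constants *)

Section Estimates.
Context {R : realType} (n : nat).
Hypothesis n100 : (100 <= n)%N.
Hypothesis ln1 : 1 <= ln n%:R :> R.
Local Notation x := (n%:R : R).

Let x100 : 100 <= x. Proof. by rewrite ler_nat. Qed.
Let x1 : 1 <= x. Proof. by rewrite ler1n; apply: leq_trans n100. Qed.
Let x0 : 0 < x. Proof. by rewrite ltr0n; apply: leq_trans n100. Qed.

Lemma divr_exprD a b : x ^+ a / x ^+ (a + b) = (x ^+ b)^-1.
Proof. by rewrite exprD invfM mulrA divff ?mul1r// gt_eqF// exprn_gt0. Qed.

Lemma expR_mul_ln k : expR (k%:R * ln x) = x ^+ k.
Proof. by rewrite expRM_natl lnK. Qed.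

Lemma mixing_length : exists L : nat, 7 * x * ln x <= L%:R /\ L%:R <= 7 * x * ln x + 1.
Proof.
have y0 : 0 <= 7 * x * ln x by rewrite !mulr_ge0 ?(ltW x0)// (le_trans _ ln1).
exists (Num.truncn (7 * x * ln x)).+1; have /andP[l u] := truncn_itv y0.
by split; [exact: ltW | rewrite -natr1 lerD2r].
Qed.

Lemma mixing_length_gap L : L%:R <= 7 * x * ln x + 1 -> L.+1%:R <= 100 * x ^+ 2 * ln x.
Proof.
move=> LE; rewrite -natr1; have : 7 * x * ln x + 2 <= 100 * x ^+ 2 * ln x.
  have xl : 1 <= x * ln x by rewrite mulr_ege1.
  have : x * ln x <= x ^+ 2 * ln x.
    by apply: ler_wpM2r; [exact: le_trans ln1 | rewrite expr2 ler_peMl// ltW].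
  rewrite -!mulrA; move: (x * ln x) (x ^+ 2 * ln x) xl => u v; lra.
lra.
Qed.

(** $L\ge7x\ln x$ makes $(1-1/x)^L\le x^{-7}$, which after the factor $x^4$ leaves $x^{-3}$.
    Likewise $(1+12/x)^L\le x^{85}$: $12\cdot7=84$, and one more power pays for rounding $L$ up. The
    threshold $x^{89}$ then leaves $2x^{-4}\le x^{-3}$. *)
Lemma mixing_failure L : 7 * x * ln x <= L%:R -> L%:R <= 7 * x * ln x + 1 ->
  x ^+ 4 * (1 - x^-1) ^+ L + 2 * (1 + 12 / x) ^+ L / x ^+ 89 <= 2 / x ^+ 3.
Proof.
move=> L1 L2.
have xi1 : x^-1 <= 1 by rewrite invf_le1.
have A : (1 - x^-1) ^+ L <= (x ^+ 7)^-1.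
  apply: (@le_trans _ _ (expR (- x^-1) ^+ L)).
    by apply: lerXn2r; rewrite ?nnegrE ?subr_ge0 ?expR_ge0// expR_ge1Dx.
  rewrite -expRM_natl -expR_mul_ln -expRN ler_expR mulrN lerN2.
  by rewrite ler_pdivlMr// mulrAC.
have B : (1 + 12 / x) ^+ L <= x ^+ 85.
  apply: (@le_trans _ _ (expR (12 / x) ^+ L)).
    by apply: lerXn2r; rewrite ?nnegrE ?expR_ge0 ?addr_ge0 ?divr_ge0 ?(ltW x0)// expR_ge1Dx.
  rewrite -expRM_natl -expR_mul_ln ler_expR mulrA ler_pdivrMr//.
  have : 12 <= x * ln x by have := ler_pM (ler0n R 100) (ler0n R 1) x100 ln1; lra.
  move: L2; rewrite -!mulrA; rewrite [ln x * x]mulrC; move: (x * ln x) => u; lra.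
have X k : 0 < x ^+ k by rewrite exprn_gt0.
have A' : x ^+ 4 * (1 - x^-1) ^+ L <= 1 / x ^+ 3.
  apply: le_trans (ler_wpM2l (ltW (X 4%N)) A) _.
  by rewrite (exprD x 4 3) invfM mulrA divff ?gt_eqF.
have B' : (1 + 12 / x) ^+ L / x ^+ 89 <= (1 / x ^+ 3) * (1 / 2).
  apply: (@le_trans _ _ (x ^+ 85 / x ^+ 89)).
    by rewrite ler_pM2r ?invr_gt0.
  rewrite [leLHS](_ : _ = (x ^+ 4)^-1); last first.
    exact: (divr_exprD 85 4).
  rewrite (exprSr x 3) invfM [1 / x ^+ 3]div1r ler_pM2l ?invr_gt0//.
  by rewrite div1r lef_pV2 ?posrE// (le_trans _ x100) ?ler_nat.
have E : 2 * (1 + 12 / x) ^+ L / x ^+ 89 <= 1 / x ^+ 3.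
  rewrite -mulrA; move: B'; move: (_ / x ^+ 89) (1 / _) => u v; lra.
apply: le_trans (lerD A' E) _; rewrite -mulrDl; lra.
Qed.

(** The ratio must be at most $x^{-92}$; raised to the power $-4$ this reads
    $2\varepsilon^2x^{368}\le x^{-2}+\varepsilon^2$, and $\varepsilon^2=x^{-380}$ satisfies it with
    room to spare. *)
Lemma regpow_ratio (eps : R) : eps = (x ^+ 190)^-1 ->
  x ^+ 89 * (regpow (eps ^+ 2) x^-1 / regpow (eps ^+ 2) eps) <= (x ^+ 3)^-1.
Proof.
move=> epsE.
have X k : 0 < x ^+ k by rewrite exprn_gt0.
have e0 : 0 < eps by rewrite epsE invr_gt0.
have e2 : 0 < eps ^+ 2 by rewrite exprn_gt0.
have c92 : (x ^+ 368) `^ (- 4^-1) = (x ^+ 92)^-1.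
  rewrite powRN; congr (_^-1); rewrite -powR_mulrn ?ltW// -powRrM -powR_mulrn ?ltW//.
  by congr (_ `^ _); rewrite (_ : 368 = 92 * 4)%N// natrM mulfK.
have H : regpow (eps ^+ 2) x^-1 <= (x ^+ 92)^-1 * regpow (eps ^+ 2) eps.
  rewrite -c92 /regpow -powRM ?(ltW (X _))//; last by rewrite ltW// addr_gt0.
  rewrite !powRN lef_pV2 ?posrE ?powR_gt0//; first last.
  - by rewrite mulr_gt0// addr_gt0.
  - by rewrite addr_gt0// exprn_gt0// invr_gt0.
  apply: ge0_ler_powR; rewrite ?nnegrE ?invr_ge0//.
  - by rewrite ltW// mulr_gt0// addr_gt0.
  - by rewrite ltW// addr_gt0// exprn_gt0// invr_gt0.
  apply: ler_wpDr; first exact: ltW.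
  have -> : eps ^+ 2 = (x ^+ 380)^-1 by rewrite epsE exprVn -exprM.
  rewrite (exprD x 368 12) invfM mulrDr mulrA divff ?gt_eqF// mul1r exprVn.
  rewrite -mulr2n -[_ *+ 2]mulr_natl (exprD x 2 10) invfM mulrCA ger_pMr ?invr_gt0//.
  rewrite ler_pdivrMr// mul1r; apply: le_trans (_ : x <= _).
    by apply: le_trans x100; rewrite ler_nat.
  by rewrite -[leLHS]expr1 ler_weXn2l.
rewrite -(divr_exprD 89 3) ler_pM2l// ler_pdivrMr// /regpow powR_gt0// addr_gt0//.
Qed.

End Estimates.

Section Radius.
Context {R : realType} (n N : nat).
Hypothesis N256 : (256 <= N)%N.
Hypothesis nN : (n ^ 2 <= 4 * N)%N.
Hypothesis n1 : (1 <= n)%N.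
Local Notation y := (N%:R : R).

Let y1 : 1 <= y. Proof. by rewrite ler1n; apply: leq_trans N256. Qed.
Let y0 : 0 < y. Proof. exact: lt_le_trans y1. Qed.

(** The $N$-th root of the inequality required of the radius, with
    $\varepsilon^{-2}=n^{380}\le(4N)^{190}$. Cancelling $4^{10}N^{191}$ leaves
    $20\cdot4^{180}<N^{49}$, which holds since $N\ge256=4^4$ gives $N^{49}\ge4^{196}$. *)
Lemma radius_base : y * (20 * (4 * y) ^+ 190) < (4 * y ^+ 24) ^+ 10.
Proof.
rewrite [ltRHS](_ : _ = 4 ^+ 10 * y ^+ 191 * y ^+ 49); last first.
  by rewrite exprMn -exprM -mulrA -exprD.
rewrite [ltLHS](_ : _ = 4 ^+ 10 * y ^+ 191 * (20 * 4 ^+ 180)); last first.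
  by rewrite exprMn (exprS y 190) (exprD 4 10 180); move: (y ^+ 190) (4 ^+ 10) (4 ^+ 180) => a b c; ring.
have c0 k : 0 < (4 : R) ^+ k by rewrite exprn_gt0.
rewrite ltr_pM2l ?mulr_gt0 ?exprn_gt0//.
apply: (@lt_le_trans _ _ (4 ^+ 16 * 4 ^+ 180)).
  by rewrite ltr_pM2r// -natrX ltr_nat.
rewrite -exprD (exprM 4 4 49); apply: lerXn2r; rewrite ?nnegrE ?exprn_ge0//.
by rewrite -natrX ler_nat.
Qed.

Lemma radius_small (eps : R) : eps = (n%:R ^+ 190)^-1 ->
  y * (20 / eps ^+ 2) ^+ N * ((4 * y ^+ 24) ^+ (5 * N))^-1 ^+ 2 < 1.
Proof.
move=> ->.
have b0 : 0 < 4 * y ^+ 24 by rewrite mulr_gt0// exprn_gt0.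
rewrite exprVn -exprM (_ : 5 * N * 2 = 10 * N)%N; last by rewrite mulnAC.
rewrite ltr_pdivrMr ?exprn_gt0// mul1r exprM.
(* The factor $N\le N^N$ is moved inside the $N$-th power. *)
apply: (@le_lt_trans _ _ ((y * (20 * (4 * y) ^+ 190)) ^+ N)).
  rewrite [leRHS]exprMn; apply: ler_pM => //.
    by rewrite ler_eXnr//; apply: leq_trans N256.
  apply: lerXn2r; rewrite ?nnegrE.
  - by rewrite divr_ge0// sqr_ge0.
  - by rewrite mulr_ge0// exprn_ge0// mulr_ge0.
  rewrite ler_pM2l// exprVn invrK exprAC.
  apply: lerXn2r; rewrite ?nnegrE ?exprn_ge0// ?mulr_ge0//.
  by rewrite -natrX -natrM ler_nat.
by rewrite ltrXn2r ?radius_base// -lt0n; apply: leq_trans N256.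
Qed.

Lemma radius_le : (n <= N)%N -> ((4 * y ^+ 24) ^+ (5 * N))^-1 <= (2 * n%:R : R) ^- 30.
Proof.
move=> leN.
have b0 : 0 < 4 * y ^+ 24 by rewrite mulr_gt0// exprn_gt0.
have x0 : 0 < n%:R :> R by rewrite ltr0n.
rewrite lef_pV2 ?posrE ?exprn_gt0 ?mulr_gt0//.
have yy : y <= y ^+ 24 by rewrite ler_eXnr.
have xy : n%:R <= y by rewrite ler_nat.
move: (y ^+ 24) yy b0 => z yy b0.
apply: (@le_trans _ _ ((4 * z) ^+ 30)).
  apply: lerXn2r; rewrite ?nnegrE; [by rewrite mulr_ge0|exact: ltW|].
  by apply: ler_pM; rewrite ?ler_nat//; exact: le_trans xy yy.
rewrite ler_weXn2l//.
  by rewrite mulr_ege1 ?ler1n//; exact: le_trans yy.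
by rewrite (leq_trans (_ : _ <= 5 * 256)%N)// leq_mul2l.
Qed.

End Radius.

(** * From the probability estimate to the bound on [phi] *)

Lemma inve_phi_le {d : measure_display} {T : measurableType d} {R : realType} (P : probability T R)
    (Q : R) n (pl : 'I_(nplanes n) -> 'I_n * 'I_n) (i : nat -> T -> 'I_(nplanes n))
    (eta : nat -> {RV P >-> R}) (X : 'M[R]_n) (b : T -> 'I_(nplanes n) -> 'M[R]_n) (r : R) :
  0 < r -> r <= (2 * n%:R) ^- 30 ->
  (P [set w | (sigma1 (random_jac Q pl i eta X b w) <= r)%R] < (1 / Num.sqrt n%:R)%:E)%E ->
  ((phi Q pl i eta X b)^-1 <= (r^-1)%:E)%E.
Proof.
move=> r0 rn Pr; have le : (r%:E <= phi Q pl i eta X b)%E.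
  rewrite /phi le_min lee_fin rn /= le_max; apply/orP; right.
  by apply: ereal_sup_ubound; exists r.
have rE : (r^-1)%:E = (r%:E)^-1%E by rewrite inver gt_eqF.
by rewrite rE lee_pV2// inE ?lee_fin ltW// (lt_le_trans _ le)// lte_fin.
Qed.

Theorem lemma6p10 (R : realType) :
  let Q : R := 100 in
  exists N0 : nat, forall n : nat, (2 <= n)%N -> (N0 < n)%N ->
  let N := nplanes n in
  forall pl : 'I_N -> 'I_n * 'I_n, plane_ordering pl ->
  forall (d : measure_display) (T : measurableType d) (P : probability T R)
         (i : nat -> T -> 'I_N) (eta : nat -> {RV P >-> R}),
    iid_uniform_index P i ->
    iid_uniform_angle eta ->
    independent_sequences i eta ->
  forall X : 'M[R]_n, SO X ->
  forall b : T -> 'I_N -> 'M[R]_n,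
    (forall w, orthonormal_basis
                 (tangent_SO (random_rotmap Q pl i eta X w 0)) (b w)) ->
  ((phi Q pl i eta X b)^-1 <= ((4 * N%:R ^+ 24) ^+ (5 * N))%:E)%E.
Proof.
(* The second bound forces $n\ge e$, hence $\ln n\ge1$. *)
move=> Q; exists (maxn 100 (Num.bound (expR 1 : R))) => n n2.
rewrite gtn_max => /andP[n100 nb] N pl pl_ord d T P i eta iid_i iid_eta indep X SOX b basis.
have [pl_inj pl_im] := pl_ord.
have x0 : 0 < n%:R :> R by rewrite ltr0n ltnW.
have ln1 : 1 <= ln n%:R :> R.
  rewrite -[leLHS]expRK ler_ln ?posrE ?expR_gt0//.
  by apply/ltW/(lt_trans (archi_boundP (expR_ge0 1))); rewrite ltr_nat.
have NE : (2 * N = n * n.-1)%N := two_planes pl_inj pl_im.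
have N256 : (256 <= N)%N by nia.
have nN : (n ^ 2 <= 4 * N)%N by nia.
have leN : (n <= N)%N by nia.
set r : R := ((4 * N%:R ^+ 24) ^+ (5 * N))^-1.
have r0 : 0 < r by rewrite invr_gt0 exprn_gt0// mulr_gt0// exprn_gt0// ltr0n; apply: leq_trans N256.
rewrite -[X in (_ <= X%:E)%E]invrK -/r.
apply: inve_phi_le => //; first exact: (radius_le N256 (ltnW n2) leN).
have [L [L1 L2]] := mixing_length (ltnW n100) ln1.
pose eps : R := (n%:R ^+ 190)^-1.
have X0 k : 0 < n%:R ^+ k :> R by rewrite exprn_gt0.
have prob : (P [set w | (sigma1 (random_jac Q pl i eta X b w) <= r)%R] <=
    (N%:R * (2 / n%:R ^+ 3 + (n%:R ^+ 3)^-1))%:E)%E.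
  apply: (@sigma1_jac_prob _ _ R P Q n pl i eta X b n2 _ pl_ord iid_i iid_eta indep SOX basis
    L _ (n%:R ^+ 89) eps r) => //.
  - exact: (mixing_length_gap (ltnW n100)).
  - by rewrite invr_gt0.
  - by rewrite invf_le1// exprn_ege1// ler1n ltnW.
  - exact: (radius_small N256 nN).
  - exact: (regpow_ratio (ltnW n100)).
  move=> l; apply: le_trans (mixing_failure (ltnW n100) ln1 L1 L2).
  apply: avg_bad => //; [|exact: mass_target].
  by apply: live_target; rewrite neq_ltn; apply/orP; left; apply/(pl_im (pl l)); exists l.
(* As $2N\le n^2$, the probability is at most $3/(2n)$, which is below $1/\sqrt n$ because $\sqrt
   n>2$. *)
apply: le_lt_trans prob _; rewrite lte_fin.
set s := Num.sqrt (n%:R : R).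
have s0 : 0 < s by rewrite sqrtr_gt0.
have ss : n%:R = s ^+ 2 by rewrite sqr_sqrtr ?ltW.
have s2 : 2 < s.
  by rewrite -(@ltr_pXn2r _ 2)// ?nnegrE ?ltW// -ss -natrX ltr_nat (leq_trans _ n100).
have N2 : 2 * N%:R <= (n%:R : R) ^+ 2 by rewrite -natrX -natrM ler_nat; nia.
rewrite (_ : _ * _ = (2 * N%:R) * (3 / 2) / n%:R ^+ 3); last by field; rewrite gt_eqF.
apply: (@le_lt_trans _ _ (n%:R ^+ 2 * (3 / 2) / n%:R ^+ 3)).
  by rewrite ler_pM2r ?invr_gt0// ler_pM2r// divr_gt0.
rewrite (_ : _ * _ = (3 / 2) / n%:R); last by field; rewrite gt_eqF.
rewrite ss (_ : 1 / s = s / s ^+ 2); last by field; rewrite gt_eqF.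
rewrite ltr_pM2r ?invr_gt0 ?exprn_gt0//; lra.
Qed.
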